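(* Let $\mathfrak{g}$ be one of $\mathfrak{gl}(V,V_* )$, $\mathfrak{sl}(V,V_* )$, $\mathfrak{so}(V)$, and $\mathfrak{sp}(V)$, and let $G$ be the corresponding group. The compatibility relation between infinite (self-)dual systems and complement data induces a bijection between $G$-conjugacy classes of infinite-dimensional submaximal toral subalgebras of $\mathfrak{g}$ and equivalence classes of nondegenerate complement data (for $\mathfrak{gl}_\infty$, $\mathfrak{sl}_\infty$, $\mathfrak{so}_\infty$, $\mathfrak{sp}_\infty$ respectively). Under this bijection, conjugacy classes of maximal toral subalgebras of $\mathfrak{g}$ correspond to equivalence classes of nondegenerate maximal complement data.
   Context: Everything is over $\mathbb{C}$. $V,V_*$ are countably infinite-dimensional with a nondegenerate pairing $\langle\cdot,\cdot\rangle$. $\mathfrak{gl}(V,V_* )$ is the Lie algebra of the associative algebra $V\otimes V_*$, $(v\otimes w)(v'\otimes w')=\langle v',w\rangle v\otimes w'$; $\mathfrak{sl}(V,V_* )$ is its derived algebra. For a nondegenerate symmetric (resp. antisymmetric) form on $V=V_*$, $\mathfrak{so}(V)=\bigwedge^2V$ (resp. $\mathfrak{sp}(V)=\mathrm{Sym}^2(V)$) in $V\otimes V$ with the commutator bracket. Write $a\wedge b=a\otimes b-b\otimes a$, $a\,\&\,b=a\otimes b+b\otimes a$ (also for linear functionals). Groups: $\mathrm{GL}(V,V_* )$ is the subgroup of $\mathrm{GL}(V)$ preserving $V_*\subseteq V^*$; $G=\mathrm{GL}(V,V_* )$ for $\mathfrak{gl}(V,V_* )$ and $\mathfrak{sl}(V,V_*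 )$; $G$ is the subgroup of $\mathrm{GL}(V,V)$ preserving the form for $\mathfrak{so}(V)$, $\mathfrak{sp}(V)$. $G$ acts naturally on $\mathfrak{g}$. (Self-)dual systems (assumed infinite): a dual system for $\mathfrak{gl}(V,V_* )$ or $\mathfrak{sl}(V,V_* )$ is a set of lines $L_i\subseteq V$, $L^i\subseteq V_*$ ($i\in\mathbb{Z}_{>0}$) with $\langle L_i,L^j\rangle=\delta_{ij}\mathbb{C}$; a self-dual system for $\mathfrak{so}(V)$ or $\mathfrak{sp}(V)$ is a set of lines $L_i\subseteq V$ ($i\in\mathbb{Z}_{\ne0}$) with $\langle L_i,L_j\rangle=\delta_{i,-j}\mathbb{C}$. The associated submaximal toral subalgebra is $\bigoplus_iL_i\otimes L^i$ for $\mathfrak{gl}$; $\mathfrak{sl}(V,V_* )\cap\bigoplus_iL_i\otimes L^i$ for $\mathfrak{sl}$; $\bigoplus_{i>0}L_i\wedge L_{-i}$ for $\mathfrak{so}$; $\bigoplus_{i>0}L_i\,\&\,L_{-i}$ for $\mathfrak{sp}$. A submaximal toral subalgebra determines its (self-)dual system uniquely. Every maximal toral subalgebra (maximal among subalgebras consisting of semisimple elements) is submaximal. Complement data. For $\mathfrak{gl}_\infty$ or $\mathfrak{sl}_\infty$: at most countable-dimensional vector spaces $X,Y$, a bilinear map $\omega:X\times Y\to\mathbb{C}$, and sequences of linear functionals $(\lambda_i)$ on $X$ and $(\mu_i)$ on $Y$, $i\in\mathbb{Z}_{>0}$. For $\mathfrak{so}_\infty$ (resp. $\mathfrak{sp}_\infty$):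 an at most countable-dimensional $X$, a symmetric (resp. antisymmetric) bilinear form $\omega$ on $X$, and linear functionals $(\lambda_i)$ on $X$, $i\in\mathbb{Z}_{\ne0}$. Compatibility. Given a dual system, choose vector space complements $X$ of $\bigoplus L_i$ in $V$ and $Y$ of $\bigoplus L^i$ in $V_*$, and generators $v_i\in L_i$, $v^i\in L^i$ with $\langle v_i,v^i\rangle=1$; the complement datum with $\omega=\langle\cdot,\cdot\rangle|_{X\times Y}$, $\lambda_i=\langle\cdot,v^i\rangle$, $\mu_i=\langle v_i,\cdot\rangle$ is compatible with it. Given a self-dual system, choose a complement $X$ of $\bigoplus L_i$ in $V$, nonzero $v_i\in L_i$ for $i>0$, and $v_{-i}\in L_{-i}$ with $\langle v_i,v_{-i}\rangle=1$; the complement datum with $\omega=\langle\cdot,\cdot\rangle|_{X\times X}$, $\lambda_i=\langle\cdot,v_i\rangle$ is compatible with it. For sequences, $(a_i)\approx(b_i)$ means $a_i=b_i$ for all but finitely many $i$. $X_0:=\{x\in X:(\lambda_i(x))\approx0\}$; $Y_0:=\{y\in Y:(\mu_i(y))\approx0\}$. Define the formal sums $\tilde\omega:=\omega-\sum_{i>0}\lambda_i\otimes\mu_i$ ($\mathfrak{gl},\mathfrak{sl}$), $\omega-\sum_{i>0}\lambda_i\,\&\,\lambda_{-i}$ ($\mathfrak{so}$), $\omega-\sum_{i>0}\lambda_i\wedge\lambda_{-i}$ ($\mathfrak{sp}$); they are well-defined when one argument lies in $X_0$ or $Y_0$. A datum is nondegenerate if for each $0\ne x_0\in X_0$ there is $y\in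 Y$ with $\tilde\omega(x_0,y)\ne0$ and for each $0\neq y_0\in Y_0$ there is $x\in X$ with $\tilde\omega(x,y_0)\neq0$ ($\mathfrak{gl},\mathfrak{sl}$); resp. for each $0\ne x_0\in X_0$ there is $x\in X$ with $\tilde\omega(x_0,x)\ne0$ ($\mathfrak{so},\mathfrak{sp}$). It is maximal if $\tilde\omega|_{X_0\otimes Y_0}=0$ ($\mathfrak{gl},\mathfrak{sl}$); $\tilde\omega|_{X_0\otimes X_0}$ has rank $0$ or $1$ ($\mathfrak{so}$); $\tilde\omega|_{X_0\otimes X_0}=0$ ($\mathfrak{sp}$). Equivalence. For $\mathfrak{gl}_\infty,\mathfrak{sl}_\infty$: $(X,Y,\omega,(\lambda_i),(\mu_i))$ and $(X',Y',\omega',(\lambda_i'),(\mu_i'))$ are equivalent if there are a bijection $\sigma$ of $\mathbb{Z}_{>0}$, isomorphisms $\pi:X\to X'$, $\pi:Y\to Y'$, and nonzero constants $\alpha_i$ with $(\lambda_i(x))\approx(\alpha_i\lambda'_{\sigma(i)}(\pi(x)))$ for all $x\in X$, $(\mu_i(y))\approx(\alpha_i^{-1}\mu'_{\sigma(i)}(\pi(y)))$ for all $y\in Y$, and $\tilde\omega-\pi^*(\tilde\omega')=0$ on $X\otimes Y$. For $\mathfrak{so}_\infty$ (resp. $\mathfrak{sp}_\infty$): there are a bijection $\sigma$ of $\mathbb{Z}_{\ne0}$ with $\sigma(-i)=-\sigma(i)$, an isomorphism $\pi:X\to X'$, and nonzero constants $\alpha_i$ with $\alpha_{-i}=\alpha_i^{-1}$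 (resp. $\alpha_{-i}=\alpha_i^{-1}\mathrm{sgn}(i)\,\mathrm{sgn}(\sigma(i))$) such that $(\lambda_i(x))\approx(\alpha_i\lambda'_{\sigma(i)}(\pi(x)))$ for all $x\in X$ and $\tilde\omega-\pi^*(\tilde\omega')=0$ on $X\otimes X$. Here $\tilde\omega-\pi^*(\tilde\omega')$ is evaluated by matching the $i$-th summand of $\tilde\omega$ with the $\sigma(i)$-th summand of $\tilde\omega'$ (e.g. for $\mathfrak{gl}$: $\omega(x,y)-\omega'(\pi x,\pi y)-\sum_i[\lambda_i(x)\mu_i(y)-\lambda'_{\sigma(i)}(\pi x)\mu'_{\sigma(i)}(\pi y)]$), which is a finite sum. *)

(* Defs.v *)
From HB Require Import structures.
From mathcomp Require Import all_boot all_order all_algebra.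
From mathcomp Require Import sesquilinear complex.
From mathcomp Require Import boolp classical_sets functions cardinality fsbigop.
From mathcomp Require Import reals.

Set Implicit Arguments.
Unset Strict Implicit.
Unset Printing Implicit Defensive.

Import Order.TTheory GRing.Theory Num.Theory.
Local Open Scope classical_set_scope.
Local Open Scope ring_scope.

Notation pairing U W := {bilinear U -> W -> _ | *%R & *%R}.

Section LinearAlgebra.
Variable C : comNzRingType.
Implicit Types U V W : lmodType C.

Definition subspace U (S : set U) : Prop :=
  S 0 /\ forall (a : C) (u v : U), S u -> S v -> S (a *: u + v).

Definition lspan U (A : set U) : set U := smallest (@subspace U) A.

Definition countable_dim U : Prop :=
  exists e : nat -> U, lspan (range e) = setT.

Definition countably_infinite_dim U : Prop :=
  exists e : nat -> U, lspan (range e) = setT /\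
    forall (n : nat) (c : 'I_n -> C),
      \sum_(i < n) c i *: e i = 0 -> forall i, c i = 0.

Definition line U (L : set U) : Prop :=
  exists2 u : U, u != 0 & L = [set a *: u | a in [set: C]].

(* [j] identifies the abstract space [X] with a complement of [S] in [U]. *)
Definition complement_of U (S : set U) (X : lmodType C) (j : {linear X -> U}) :=
  [/\ injective j, range j `&` S = [set 0]
    & forall u : U, exists x : X, exists2 s : U, S s & u = j x + s].

Definition nondegenerate_pairing V W (p : pairing V W) : Prop :=
  (forall v, (forall w, p v w = 0) -> v = 0) /\
  (forall w, (forall v, p v w = 0) -> w = 0).

(* The rank of [B] on [S] is the dimension of the space of functions
   [B x _] on [S], for [x] in [S]; the [e i] give a basis of it. *)
Definition has_rank_on (X : Type) (B : X -> X -> C) (S : set X) (r : nat) :=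
  exists e : 'I_r -> X,
    [/\ forall i, S (e i),
        forall c : 'I_r -> C,
          (forall y, S y -> \sum_(i < r) c i * B (e i) y = 0) ->
          forall i, c i = 0
      & forall x, S x -> exists c : 'I_r -> C,
          forall y, S y -> B x y = \sum_(i < r) c i * B (e i) y].

Definition almost_eq (I : Type) (a b : I -> C) : Prop :=
  finite_set [set i | a i <> b i].

(* A tensor product of [V] and [W], given by its universal property. *)
Record tensor_product V W := TensorProduct {
  tcarrier :> lmodType C;
  tens : {bilinear V -> W -> tcarrier};
  tlift : forall U, {bilinear V -> W -> U} -> {linear tcarrier -> U};
  tliftE : forall U (b : {bilinear V -> W -> U}) v w,
    tlift b (tens v w) = b v w;
  tlift_unique : forall U (f g : {linear tcarrier -> U}),
    (forall v w, f (tens v w) = g (tens v w)) -> f =1 g }.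

End LinearAlgebra.

Arguments lspan {C U} A.
Arguments tens {C V W} t.
Arguments tlift {C V W} t {U} b.
Arguments tlift_unique {C V W t U} f g.

Notation "a ≈ b" := (almost_eq a b) (at level 70).

Section TensorMap.
Variables (C : comNzRingType) (V W : lmodType C) (T : tensor_product V W).
Variables (f : {linear V -> V}) (g : {linear W -> W}).

Definition tens2 (v : V) (w : W) : T := tens T (f v) (g w).

Fact tens2_bilinear : bilinear_for *:%R *:%R tens2.
Proof.
by split=> [w|v] a x y; rewrite /tens2 linearP ?linearPl ?linearPr.
Qed.
HB.instance Definition _ :=
  bilinear_isBilinear.Build C V W T _ _ tens2 tens2_bilinear.

(* f ⊗ g *)
Definition tmap : {linear T -> T} := tlift T tens2.

Lemma tmapE v w : tmap (tens T v w) = tens T (f v) (g w).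
Proof. exact: tliftE. Qed.

End TensorMap.

Section FinitaryAlgebra.
Variables (C : comNzRingType) (V W : lmodType C) (p : pairing V W).
Variable T : tensor_product V W.

Definition rank_one (x v : V) (w : W) : V := p x w *: v.

Fact rank_one_bilinear x : bilinear_for *:%R *:%R (rank_one x).
Proof.
split=> [w|v] a y z; rewrite /rank_one /=.
- by rewrite scalerDr !scalerA mulrC.
- by rewrite linearPr scalerDl -scalerA.
Qed.
HB.instance Definition _ x :=
  bilinear_isBilinear.Build C V W V _ _ (rank_one x) (rank_one_bilinear x).

(* The natural representation on [V]: (v ⊗ w) x = <x, w> v. *)
Definition tact (a : T) (x : V) : V := tlift T (rank_one x) a.

Lemma tactE v w x : tact (tens T v w) x = p x w *: v.
Proof. exact: tliftE. Qed.

Fact tact_linear a : linear (tact a).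
Proof.
move=> k x y; rewrite /tact.
pose h (b : T) : V := k *: tlift T (rank_one x) b + tlift T (rank_one y) b.
have h_lin : linear h.
  move=> l b c; rewrite /h [X in k *: X]linearP linearP /=.
  by rewrite !scalerDr !scalerA (mulrC k) addrACA.
pose hL := GRing.isLinear.Build _ _ _ _ h h_lin.
pose H : {linear T -> V} := HB.pack h hL.
apply: (tlift_unique _ H) => v w.
by rewrite /= /h !tliftE /= /rank_one linearPl scalerDl -scalerA.
Qed.
HB.instance Definition _ a :=
  GRing.isLinear.Build C V V _ (tact a) (tact_linear a).

(* Since (v ⊗ w)(v' ⊗ w') = <v', w> v ⊗ w', left multiplication by [a] is
   [tact a ⊗ id]. *)
Definition tmul (a b : T) : T := tmap T (tact a) idfun b.

Lemma tmulE v w v' w' :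
  tmul (tens T v w) (tens T v' w') = p v' w *: tens T v w'.
Proof. by rewrite /tmul tmapE /= tactE linearZl. Qed.

Definition bracket (a b : T) : T := tmul a b - tmul b a.

(* Over an algebraically closed field, an element is semisimple when
   it is diagonalizable on the natural representation. *)
Definition semisimple (a : T) : Prop :=
  lspan [set x : V | exists c : C, tact a x = c *: x] = setT.

Definition lie_subalgebra (g t : set T) : Prop :=
  [/\ subspace t, t `<=` g & forall a b, t a -> t b -> t (bracket a b)].

Definition toral (g t : set T) : Prop :=
  lie_subalgebra g t /\ t `<=` semisimple.

Definition maximal_toral (g t : set T) : Prop :=
  toral g t /\ forall t', toral g t' -> t `<=` t' -> t' = t.

Definition gl_algebra : set T := setT.
Definition sl_algebra : set T :=
  lspan [set bracket a b | a in [set: T] & b in [set: T]].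

(* [V_* ⊆ V^*], and its setwise stabilizer in [GL(V)]. *)
Definition dual_image : set (V -> C) := range (fun w x => p x w).

Definition GL_pairing (f : {linear V -> V}) : Prop :=
  bijective f /\ [set phi \o f | phi in dual_image] = dual_image.

(* [fs] is the action of [f] on [V_*]; it is determined by [f] since the
   pairing is nondegenerate. *)
Definition gl_conjugate (t t' : set T) : Prop :=
  exists (f : {linear V -> V}) (fs : {linear W -> W}),
    [/\ GL_pairing f, forall v w, p (f v) (fs w) = p v w
      & t' = tmap T f fs @` t].

End FinitaryAlgebra.

Arguments gl_algebra {C V W} T.
Arguments sl_algebra {C V W} p T.
Arguments maximal_toral {C V W} p {T} g t.
Arguments gl_conjugate {C V W} p T t t'.

Section GeneralLinear.
Variables (C : fieldType) (V W : lmodType C) (p : pairing V W).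
Variable T : tensor_product V W.

(* The index set Z_{>0} is relabelled as [nat]. *)
Definition dual_system (L : nat -> set V) (L' : nat -> set W) : Prop :=
  [/\ forall i, line (L i), forall i, line (L' i)
    & forall i j, [set p v w | v in L i & w in L' j] =
                  if i == j then setT else [set 0]].

Definition gl_system_torus (g : set T) (L : nat -> set V) (L' : nat -> set W) :
    set T :=
  g `&` lspan (\bigcup_i [set tens T v w | v in L i & w in L' i]).

Definition gl_submaximal (g t : set T) : Prop :=
  exists L L', dual_system L L' /\ t = gl_system_torus g L L'.

Record gl_datum := GlDatum {
  glX : lmodType C;
  glY : lmodType C;
  glX_countable : countable_dim glX;
  glY_countable : countable_dim glY;
  gl_omega : pairing glX glY;
  gl_lambda : nat -> {scalar glX};
  gl_mu : nat -> {scalar glY} }.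

Definition gl_system_compatible (L : nat -> set V) (L' : nat -> set W)
    (D : gl_datum) : Prop :=
  exists (jX : {linear glX D -> V}) (jY : {linear glY D -> W})
         (v : nat -> V) (v' : nat -> W),
    [/\ complement_of (lspan (\bigcup_i L i)) jX
          /\ complement_of (lspan (\bigcup_i L' i)) jY,
        forall i, [/\ L i (v i), L' i (v' i) & p (v i) (v' i) = 1],
        forall x y, gl_omega D x y = p (jX x) (jY y),
        forall i x, gl_lambda D i x = p (jX x) (v' i)
      & forall i y, gl_mu D i y = p (v i) (jY y)].

Definition gl_compatible (g t : set T) (D : gl_datum) : Prop :=
  exists L L', [/\ dual_system L L', t = gl_system_torus g L L'
                 & gl_system_compatible L L' D].

Section Datum.
Variable D : gl_datum.

Definition glX0 : set (glX D) :=
  [set x | (fun i => gl_lambda D i x) ≈ (fun=> 0)].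
Definition glY0 : set (glY D) :=
  [set y | (fun i => gl_mu D i y) ≈ (fun=> 0)].

(* Only used when [x] is in [glX0] or [y] in [glY0]: the sum is then finite
   (the big operator has value 0 on families with infinite support). *)
Definition gl_tomega (x : glX D) (y : glY D) : C :=
  gl_omega D x y - \sum_(i \in [set: nat]) gl_lambda D i x * gl_mu D i y.

Definition gl_nondegenerate : Prop :=
  (forall x, glX0 x -> x <> 0 -> exists y, gl_tomega x y <> 0) /\
  (forall y, glY0 y -> y <> 0 -> exists x, gl_tomega x y <> 0).

Definition gl_maximal : Prop :=
  forall x y, glX0 x -> glY0 y -> gl_tomega x y = 0.

End Datum.

(* The family summed in the last clause has finite support by the two
   preceding clauses. *)
Definition gl_equivalent (D D' : gl_datum) : Prop :=
  exists (s : nat -> nat) (pX : {linear glX D -> glX D'})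
         (pY : {linear glY D -> glY D'}) (alpha : nat -> C),
    [/\ [/\ bijective s, bijective pX & bijective pY],
        forall i, alpha i != 0,
        forall x, (fun i => gl_lambda D i x) ≈
                  (fun i => alpha i * gl_lambda D' (s i) (pX x)),
        forall y, (fun i => gl_mu D i y) ≈
                  (fun i => (alpha i)^-1 * gl_mu D' (s i) (pY y))
      & forall x y, gl_omega D x y - gl_omega D' (pX x) (pY y)
          - \sum_(i \in [set: nat])
              (gl_lambda D i x * gl_mu D i y
               - gl_lambda D' (s i) (pX x) * gl_mu D' (s i) (pY y)) = 0].

End GeneralLinear.

Arguments gl_submaximal {C V W} p {T} g t.
Arguments gl_compatible {C V W} p {T} g t D.
Arguments gl_datum C : clear implicits.
Arguments gl_equivalent {C} D D'.
Arguments gl_nondegenerate {C} D.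
Arguments gl_maximal {C} D.

Definition nzint := {i : int | i != 0}.

Fact nzopp_subproof (i : nzint) : - val i != 0.
Proof. by rewrite oppr_eq0; exact: (valP i). Qed.
Definition nzopp (i : nzint) : nzint := exist _ (- val i) (nzopp_subproof i).
Definition nzpositive : set nzint := [set i | 0 < val i].
Definition nzabs (i : nzint) : nzint := if 0 < val i then i else nzopp i.

Variant form_kind := Orthogonal | Symplectic.

Section Form.
Variables (C : fieldType) (k : form_kind).

Definition form_sign : C := if k is Orthogonal then 1 else -1.

Definition form_symmetric (X : lmodType C) (B : pairing X X) : Prop :=
  forall x y, B x y = form_sign * B y x.

Variables (V : lmodType C) (p : pairing V V) (T : tensor_product V V).

(* v ∧ w = v ⊗ w - w ⊗ v when [k] is [Orthogonal],
   v & w = v ⊗ w + w ⊗ v when [k] is [Symplectic]. *)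
Definition form_tens (v w : V) : T := tens T v w - form_sign *: tens T w v.

(* Λ²V, resp. Sym²V *)
Definition form_algebra : set T :=
  lspan [set form_tens v w | v in [set: V] & w in [set: V]].

Definition form_group (f : {linear V -> V}) : Prop :=
  GL_pairing p f /\ forall v w, p (f v) (f w) = p v w.

(* An isometry acts on [V_* = V] by itself. *)
Definition form_conjugate (t t' : set T) : Prop :=
  exists2 f : {linear V -> V}, form_group f & t' = tmap T f f @` t.

Definition self_dual_system (L : nzint -> set V) : Prop :=
  (forall i, line (L i)) /\
  forall i j, [set p v w | v in L i & w in L j] =
              if i == nzopp j then setT else [set 0].

Definition form_system_torus (L : nzint -> set V) : set T :=
  lspan (\bigcup_(i in nzpositive)
           [set form_tens v w | v in L i & w in L (nzopp i)]).

Definition form_submaximal (t : set T) : Prop :=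
  exists L, self_dual_system L /\ t = form_system_torus L.

Record form_datum := FormDatum {
  formX : lmodType C;
  formX_countable : countable_dim formX;
  form_omega : pairing formX formX;
  form_omega_symmetric : form_symmetric form_omega;
  form_lambda : nzint -> {scalar formX} }.

Definition form_system_compatible (L : nzint -> set V) (D : form_datum) :=
  exists (jX : {linear formX D -> V}) (v : nzint -> V),
    [/\ complement_of (lspan (\bigcup_i L i)) jX,
        forall i, L i (v i),
        forall i, nzpositive i -> v i != 0 /\ p (v i) (v (nzopp i)) = 1,
        forall x y, form_omega D x y = p (jX x) (jX y)
      & forall i x, form_lambda D i x = p (jX x) (v i)].

Definition form_compatible (t : set T) (D : form_datum) : Prop :=
  exists L, [/\ self_dual_system L, t = form_system_torus L
              & form_system_compatible L D].

(* The [i]-th summand of the formal sum: (λ_i & λ_{-i})(x, y) when [k] is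
   [Orthogonal], (λ_i ∧ λ_{-i})(x, y) when [k] is [Symplectic]. *)
Definition form_term (D : form_datum) (i : nzint) (x y : formX D) : C :=
  form_lambda D i x * form_lambda D (nzopp i) y
  + form_sign * (form_lambda D (nzopp i) x * form_lambda D i y).

Section Datum.
Variable D : form_datum.

Definition formX0 : set (formX D) :=
  [set x | (fun i => form_lambda D i x) ≈ (fun=> 0)].

(* Only used when [x] or [y] is in [formX0]: the sum is then finite. *)
Definition form_tomega (x y : formX D) : C :=
  form_omega D x y - \sum_(i \in nzpositive) form_term i x y.

Definition form_nondegenerate : Prop :=
  forall x0, formX0 x0 -> x0 <> 0 -> exists x, form_tomega x0 x <> 0.

Definition form_maximal : Prop :=
  if k is Orthogonal
  then has_rank_on form_tomega formX0 0 \/ has_rank_on form_tomega formX0 1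
  else forall x y, formX0 x -> formX0 y -> form_tomega x y = 0.

End Datum.

Definition nzsg (i : nzint) : C := (Num.sg (val i))%:~R.

(* The [i]-th summand, [i > 0], is matched with the summand of the positive
   index [|s i|]. *)
Definition form_equivalent (D D' : form_datum) : Prop :=
  exists (s : nzint -> nzint) (pX : {linear formX D -> formX D'})
         (alpha : nzint -> C),
    [/\ [/\ bijective s, forall i, s (nzopp i) = nzopp (s i) & bijective pX],
        forall i, alpha i != 0,
        forall i, alpha (nzopp i) =
          if k is Orthogonal then (alpha i)^-1
          else (alpha i)^-1 * nzsg i * nzsg (s i),
        forall x, (fun i => form_lambda D i x) ≈
                  (fun i => alpha i * form_lambda D' (s i) (pX x))
      & forall x y, form_omega D x y - form_omega D' (pX x) (pX y)
          - \sum_(i \in nzpositive)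
              (form_term i x y - form_term (nzabs (s i)) (pX x) (pX y)) = 0].

End Form.

Arguments form_algebra {C} k {V} T.
Arguments form_conjugate {C V} p T t t'.
Arguments form_submaximal {C} k {V} p T t.
Arguments form_datum C k : clear implicits.
Arguments form_compatible {C} k {V} p T t D.
Arguments form_equivalent {C k} D D'.
Arguments form_nondegenerate {C k} D.
Arguments form_maximal {C k} D.

(* Plain predicates are used below because the type of complement data does
   not fit in the universe of the library's [set]. *)
Section Classes.

Definition is_class (T : Type) (e : T -> T -> Prop) (P : T -> Prop)
    (c : T -> Prop) : Prop :=
  exists2 x, P x & c = e x.

Variables (A B : Type) (eqA : A -> A -> Prop) (eqB : B -> B -> Prop).

Definition induced_rel (r : A -> B -> Prop) (c : A -> Prop) (d : B -> Prop) :=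
  exists a b, [/\ c = eqA a, d = eqB b & r a b].

(* [r] induces a bijection from the classes of elements of [PA] to the classes
   of elements of [PB], under which the classes of elements of [QA] correspond
   to the classes of elements of [QB]. *)
Definition induces_bijection (r : A -> B -> Prop) (PA QA : A -> Prop)
    (PB QB : B -> Prop) : Prop :=
  exists phi : (A -> Prop) -> (B -> Prop),
    [/\ [/\ forall c, is_class eqA PA c -> is_class eqB PB (phi c),
            forall c c', is_class eqA PA c -> is_class eqA PA c' ->
              phi c = phi c' -> c = c'
          & forall d, is_class eqB PB d ->
              exists2 c, is_class eqA PA c & phi c = d],
        forall c d, is_class eqA PA c -> (induced_rel r c d <-> phi c = d),
        forall c, is_class eqA QA c -> is_class eqA PA c
      & forall d, is_class eqB QB d <->
          exists2 c, is_class eqA QA c & phi c = d].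

End Classes.

(* Main.v *)
Require Import Defs.
From HB Require Import structures.
From mathcomp Require Import all_boot all_order all_algebra.
From mathcomp Require Import sesquilinear complex.
From mathcomp Require Import boolp classical_sets functions cardinality fsbigop.
From mathcomp Require Import reals.
From mathcomp Require Import ring.

(* Choosing generators of the lines turns a (self-)dual system into a dual
   family [v], [w] (for a form, [w i] is [v (- i)] up to sign), and a compatible
   datum records the pairing on complements of its span: together they form a
   frame. Two data are equivalent exactly when there is an isometry matching the
   frames up to permutation and rescaling of the families: the equations
   [λ ≈ α λ'] say which lifts of an isomorphism of the complements have the right
   coordinates, and the vanishing of [ω~ - π^* ω~'] says that the lift is
   isometric. Every datum has a frame, in the direct sum of its complements with
   finitely supported sequences, and this space is isometric to the given one by
   Mackey's theorem (any two countable-dimensional spaces in nondegenerate duality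
   have dual bases; for forms, hyperbolic bases). An isometry conjugates the tori
   exactly when it matches the families, since a torus determines its lines as
   common eigenspaces.

   A vector of [X_0] lifts uniquely to a vector orthogonal to the family, and
   [ω~] on [X_0] is the pairing of the lifts; this gives nondegeneracy. A maximal
   toral subalgebra is abelian, and simultaneous diagonalization in stages along
   a countable basis puts it inside the torus of a dual family. A torus is not
   maximal exactly when the orthogonal complement of the family contains a dual
   (resp. hyperbolic) pair: such a pair enlarges the torus, and conversely a
   semisimple element commuting with the torus and outside it has a pair of
   eigenvectors of that kind. For a symmetric form, an orthogonal complement of
   rank at least 2 contains a hyperbolic pair, whence the rank 0 or 1. *)

Set Implicit Arguments.
Unset Strict Implicit.
Unset Printing Implicit Defensive.

Import Order.TTheory GRing.Theory Num.Theory.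
Local Open Scope classical_set_scope.
Local Open Scope ring_scope.

(** * Linear algebra of countable dimension *)

Section Subspaces.
Variable C : fieldType.
Implicit Types U V : lmodType C.

(** The obstacle is that [ω~] is a formal sum which may have infinitely many nonzero terms: only
    differences of two such sums are numbers. The identity behind this is [pairing_defect]: when
    vectors are changed by elements of the spans of a dual family, the pairing changes by a finite
    sum of differences of terms [λ_i μ_i]. A second obstacle is that a toral subalgebra may be
    infinite-dimensional, out of reach of one diagonalization of matrices. But semisimple elements
    have finite rank, and on the image of one of them the whole subalgebra acts through a
    finite-dimensional space of matrices. For forms, eigenvalues of skew operators come in opposite
    pairs, and choosing one of each pair turns eigenvectors into hyperbolic pairs. For sl,
    differences [v_i ⊗ w_i - v_j ⊗ w_j], which are brackets, take over the role of single tensors.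
    That equivalence of data is an equivalence relation is not checked on the formulas: through the
    frames of the models it becomes composition and inversion of isometries. *)

Lemma subspace_lspan U (A : set U) : subspace (lspan A).
Proof.
split=> [S [[S0 _] _]//|a u v uA vA S [Ssub AS]].
by apply: Ssub.2; [apply: uA|apply: vA].
Qed.

Lemma sub_lspan U (A : set U) : A `<=` lspan A.
Proof. by move=> u Au S [_ AS]; exact: AS. Qed.

Lemma lspan_min U (A S : set U) : subspace S -> A `<=` S -> lspan A `<=` S.
Proof. by move=> Ssub AS u; apply. Qed.

Lemma lspan_mono U (A B : set U) : A `<=` B -> lspan A `<=` lspan B.
Proof.
move=> AB; apply: lspan_min; first exact: subspace_lspan.
by move=> u /AB; exact: sub_lspan.
Qed.

Lemma lspan_eq U (A B : set U) :
  A `<=` lspan B -> B `<=` lspan A -> lspan A = lspan B.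
Proof.
by move=> AB BA; apply/seteqP; split; apply: lspan_min => //;
  exact: subspace_lspan.
Qed.

Section Closure.
Variables (U : lmodType C) (S : set U) (Ssub : subspace S).

Lemma subspace0 : S 0. Proof. exact: Ssub.1. Qed.

Lemma subspaceZ a u : S u -> S (a *: u).
Proof. by move=> Su; rewrite -[_ *: _]addr0; apply: Ssub.2 => //; case: Ssub. Qed.

Lemma subspaceD u v : S u -> S v -> S (u + v).
Proof. by move=> Su Sv; rewrite -[u]scale1r; apply: Ssub.2. Qed.

Lemma subspaceN u : S u -> S (- u).
Proof. by move=> Su; rewrite -scaleN1r; apply: subspaceZ. Qed.

Lemma subspaceB u v : S u -> S v -> S (u - v).
Proof. by move=> Su Sv; apply: subspaceD => //; apply: subspaceN. Qed.

Lemma subspace_sum I (r : seq I) (P : pred I) (F : I -> U) :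
  (forall i, P i -> S (F i)) -> S (\sum_(i <- r | P i) F i).
Proof.
by move=> SF; elim/big_ind: _ => //; [exact: subspace0|exact: subspaceD].
Qed.

Lemma subspace_sum_seq (I : eqType) (r : seq I) (F : I -> U) :
  (forall i, i \in r -> S (F i)) -> S (\sum_(i <- r) F i).
Proof. by move=> SF; rewrite big_seq; apply: subspace_sum. Qed.

End Closure.

Section LspanClosure.
Variables (U : lmodType C) (A : set U).

Lemma lspan0 : lspan A 0.
Proof. exact: (subspace_lspan A).1. Qed.

Lemma lspanP a u v : lspan A u -> lspan A v -> lspan A (a *: u + v).
Proof. exact: (subspace_lspan A).2. Qed.

Lemma lspanZ a u : lspan A u -> lspan A (a *: u).
Proof. exact: (subspaceZ (subspace_lspan A)). Qed.

Lemma lspanD u v : lspan A u -> lspan A v -> lspan A (u + v).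
Proof. exact: (subspaceD (subspace_lspan A)). Qed.

Lemma lspanB u v : lspan A u -> lspan A v -> lspan A (u - v).
Proof. exact: (subspaceB (subspace_lspan A)). Qed.

Lemma lspan_sum I (r : seq I) (P : pred I) (F : I -> U) :
  (forall i, P i -> lspan A (F i)) -> lspan A (\sum_(i <- r | P i) F i).
Proof. exact: (subspace_sum (subspace_lspan A)). Qed.

End LspanClosure.

Lemma subspaceT U : subspace [set: U]. Proof. by []. Qed.

Lemma subspaceI U (S S' : set U) :
  subspace S -> subspace S' -> subspace (S `&` S').
Proof.
by move=> [S0 SD] [S'0 S'D]; split=> // a u v [? ?] [? ?]; split; auto.
Qed.

Lemma subspace_preimage U V (f : {linear U -> V}) (S : set V) :
  subspace S -> subspace (f @^-1` S).
Proof.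
move=> [S0 SD]; split=> [|a u v]; rewrite /preimage /= ?linear0 //.
by rewrite linearP; exact: SD.
Qed.

Lemma subspace_image U V (f : {linear U -> V}) (S : set U) :
  subspace S -> subspace (f @` S).
Proof.
move=> [S0 SD]; split=> [|a _ _ [u Su <-] [v Sv <-]].
  by exists 0; rewrite ?linear0.
by exists (a *: u + v); [exact: SD|rewrite linearP].
Qed.

Lemma lspan_image U V (f : {linear U -> V}) (A : set U) :
  f @` lspan A = lspan (f @` A).
Proof.
apply/seteqP; split=> [_ [u Au <-]|].
  apply: (lspan_min (S := f @^-1` lspan (f @` A))) Au.
    exact: subspace_preimage (subspace_lspan _).
  by move=> x Ax; apply: sub_lspan; exists x.
apply: lspan_min; first exact: subspace_image (subspace_lspan _).
by move=> _ [u Au <-]; exists u => //; apply: sub_lspan.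
Qed.

Lemma lspan_line U (I : Type) (L : I -> set U) (v : I -> U) :
  (forall i, L i (v i)) ->
  (forall i u, L i u -> exists a, u = a *: v i) ->
  lspan (\bigcup_i L i) = lspan (range v).
Proof.
move=> Lv vL; apply: lspan_eq => u.
  move=> [i _ /vL[a ->]]; apply: lspanZ.
  by apply: sub_lspan; exists i.
by move=> [i _ <-]; apply: sub_lspan; exists i.
Qed.

Lemma linear_eq_lspan U V (f g : {linear U -> V}) (A : set U) :
  {in A, f =1 g} -> {in lspan A, f =1 g}.
Proof.
move=> fg u /set_mem; apply: (lspan_min (S := [set u | f u = g u])) u.
  by split=> [|a x y /= fx fy] /=; rewrite ?linear0 // !linearP fx fy.
by move=> x Ax; apply: fg; exact: mem_set.
Qed.

End Subspaces.

Section SubspaceType.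
Variables (C : fieldType) (U : lmodType C) (S : set U).

(* The unused argument lets canonical structure inference find the proof that
   [S] is a subspace. *)
Definition subspace_pred of subspace S : {pred U} := mem S.

Variable Ssub : subspace S.

Fact subspace_pred_closed : GRing.submod_closed (subspace_pred Ssub).
Proof.
split=> [|a u v]; rewrite /subspace_pred !inE; first exact: subspace0.
by move=> Su Sv; apply: Ssub.2.
Qed.

HB.instance Definition _ :=
  GRing.isSubmodClosed.Build C U (subspace_pred Ssub) subspace_pred_closed.

Definition subspace_type := {u : U | subspace_pred Ssub u}.
HB.instance Definition _ := SubType.on subspace_type.
HB.instance Definition _ := Choice.on subspace_type.
HB.instance Definition _ := [SubChoice_isSubLmodule of subspace_type by <:].

Lemma subspace_typeP (x : subspace_type) : S (val x).
Proof. by have := valP x; rewrite inE. Qed.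

Lemma subspace_type_ex u : S u -> exists x : subspace_type, val x = u.
Proof. by move=> Su; exists (Sub u (mem_set Su)); rewrite SubK. Qed.

End SubspaceType.

Section Bundling.
Variable C : fieldType.

Definition linear_of (U V : lmodType C) (f : U -> V) (f_lin : linear f) :
    {linear U -> V} :=
  HB.pack f (GRing.isLinear.Build C U V *:%R f f_lin).

Definition scalar_of (U : lmodType C) (f : U -> C) (f_lin : scalar f) :
    {scalar U} :=
  HB.pack f (GRing.isLinear.Build C U C *%R f f_lin).

Definition bilinear_of (U V W : lmodType C) (f : U -> V -> W)
    (f_lin : bilinear_for *:%R *:%R f) : {bilinear U -> V -> W} :=
  HB.pack f (bilinear_isBilinear.Build C U V W *:%R *:%R f f_lin).

Definition pairing_of (U V : lmodType C) (f : U -> V -> C)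
    (f_lin : bilinear_for *%R *%R f) : pairing U V :=
  HB.pack f (bilinear_isBilinear.Build C U V C *%R *%R f f_lin).

(** Maps between frames are pinned down by conditions rather than by formulas: choice provides the
    values, and their uniqueness makes them linear. *)
Lemma linear_graph (U V : lmodType C) (r : U -> V -> Prop) :
  (forall u, exists v, r u v) ->
  (forall u v v', r u v -> r u v' -> v = v') ->
  (forall a u u' v v', r u v -> r u' v' -> r (a *: u + u') (a *: v + v')) ->
  exists f : {linear U -> V}, forall u, r u (f u).
Proof.
move=> /choice[f fP] r_fun r_lin.
have f_lin : linear f.
  by move=> a u v; apply: r_fun (fP _) _; exact: r_lin.
by exists (linear_of f_lin).
Qed.

Fact inl_linear (X Z : lmodType C) : linear (fun x : X => (x, 0 : Z)).
Proof. by move=> a x y; congr pair; rewrite /= ?scaler0 ?addr0. Qed.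
Definition inl_lin (X Z : lmodType C) := linear_of (@inl_linear X Z).

Fact inr_linear (X Z : lmodType C) : linear (fun z : Z => (0 : X, z)).
Proof. by move=> a x y; congr pair; rewrite /= ?scaler0 ?addr0. Qed.
Definition inr_lin (X Z : lmodType C) := linear_of (@inr_linear X Z).

End Bundling.

Section FiniteSums.
Variables (C : fieldType) (I : choiceType).
Implicit Types U : lmodType C.

Lemma fsum_seq U (F : I -> U) (r : seq I) : uniq r ->
  (forall i, i \notin r -> F i = 0) ->
  \sum_(i \in [set: I]) F i = \sum_(i <- r) F i.
Proof.
move=> ur rF; rewrite (fsbigE r) //; last by move=> i _; exact: rF.
by apply: eq_bigl => i; rewrite in_setT.
Qed.

Lemma finite_set_enum (A : set I) :
  finite_set A -> exists2 r : seq I, uniq r & forall i, A i -> i \in r.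
Proof.
move=> /finite_seqP[r ->]; exists (undup r); first exact: undup_uniq.
by move=> i /=; rewrite mem_undup.
Qed.

Lemma sub_seq_finite (A : set I) (r : seq I) :
  (forall i, A i -> i \in r) -> finite_set A.
Proof.
move=> Ar; apply: (sub_finite_set (B := [set` r])); first by move=> i /Ar.
exact: finite_seq.
Qed.

End FiniteSums.

(** * Complements and subspaces in countable dimension *)

Section CountableDimension.
Variable C : fieldType.
Implicit Types U V : lmodType C.

(** Padding coefficients by zero makes initial segments of [e] sufficient, so that no finite index
    sets have to be managed. *)
Lemma lspan_nat U (e : nat -> U) u : lspan (range e) u ->
  exists n, exists c : 'I_n -> C, u = \sum_(i < n) c i *: e i.
Proof.
apply: (lspan_min (S := [set u | exists n, exists c : 'I_n -> C,
  u = \sum_(i < n) c i *: e i])).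
  split=> [|a x y [n [c ->]] [m [d ->]]].
    by exists 0, (fun=> 0); rewrite big_ord0.
  pose ext k (b : 'I_k -> C) i := if insub i is Some j then b j else 0.
  have extE k (b : 'I_k -> C) N : (k <= N)%N ->
      \sum_(i < k) b i *: e i = \sum_(i < N) ext k b i *: e i.
    move=> kN; rewrite [RHS](bigID (fun i : 'I_N => i < k)%N) /=.
    rewrite -(big_ord_widen N (fun i => ext k b i *: e i)) //.
    rewrite [X in _ + X]big1 ?addr0 => [|i ik].
      by apply: eq_bigr => i _; rewrite /ext valK.
    by rewrite /ext insubF ?scale0r //; exact: negbTE.
  exists (maxn n m), (fun i => a * ext n c i + ext m d i).
  rewrite (extE n c _ (leq_maxl n m)) (extE m d _ (leq_maxr n m)).
  rewrite scaler_sumr -big_split; apply: eq_bigr => i _ /=.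
  by rewrite scalerDl scalerA.
move=> _ [i _ <-]; exists i.+1, (fun j => (j == ord_max)%:R).
rewrite (bigD1 ord_max) //= eqxx scale1r big1 ?addr0 // => j jm.
by rewrite (negbTE jm) scale0r.
Qed.

(** Greedy choice: [e n] is kept when it is not in the span of [S] and the earlier [e k]. Discarded
    vectors become 0, so that the kept ones still form a sequence indexed by [nat]. *)
Lemma complement_ex U (S : set U) : countable_dim U -> subspace S ->
  exists (X : lmodType C) (j : {linear X -> U}),
    countable_dim X /\ complement_of S j.
Proof.
move=> [e eT] Ssub.
pose new n := ~ lspan (S `|` [set e k | k in [set k | (k < n)%N]]) (e n).
pose e' n := if `[< new n >] then e n else 0.
have e'N n : new n -> e' n = e n by move=> ?; rewrite /e' asboolT.
have e'0 n : ~ new n -> e' n = 0 by move=> ?; rewrite /e' asboolF.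
pose K := lspan (range e').
have Ksub : subspace K := subspace_lspan _.
exists (subspace_type Ksub), (val : {linear subspace_type Ksub -> U}).
have e'K n : K (e' n) by apply: sub_lspan; exists n.
split.
  pose e2 n : subspace_type Ksub := Sub (e' n) (mem_set (e'K n)).
  exists e2; apply/seteqP; split=> // x _.
  have: K (val x) by exact: subspace_typeP.
  pose A := range e2.
  suff Kle : K `<=` val @` lspan A.
    by move=> /Kle[y Ay /val_inj <-].
  rewrite (lspan_image (val : {linear subspace_type Ksub -> U})).
  apply: lspan_mono => _ [n _ <-] /=.
  by exists (e2 n); [exists n|rewrite SubK].
have KS u : exists x : U, K x /\ exists2 s, S s & u = x + s.
  have: lspan (range e) u by rewrite eT.
  pose Q := [set u | exists x : U, K x /\ exists2 s, S s & u = x + s].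
  have Qsub : subspace Q.
    split=> [|a x y [x1 [Kx1 [x2 Sx2 ->]]] [y1 [Ky1 [y2 Sy2 ->]]]].
      exists 0; split; first exact: subspace0.
      by exists 0; rewrite ?addr0 //; exact: subspace0.
    exists (a *: x1 + y1); split; first exact: Ksub.2.
    exists (a *: x2 + y2); first exact: Ssub.2.
    by rewrite scalerDr addrACA.
  apply: (lspan_min (S := Q)) => // _ [n _ <-].
  elim/ltn_ind: n => n IH.
  have [Nn|/contrapT] := pselect (new n).
    exists (e n); split; last by exists 0; rewrite ?addr0 //; exact: subspace0.
    by rewrite -e'N.
  apply: (lspan_min (S := Q)) => // y [Sy|[k /= kn <-]]; last exact: IH.
  exists 0; split; first exact: subspace0.
  by exists y; rewrite ?add0r.
(* Look at the last vector: a nonzero coefficient at a kept [e n] would put it in the span of [S]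
   and its predecessors. *)
have KcapS n y : lspan [set e' k | k in [set k | (k < n)%N]] y -> S y -> y = 0.
  elim: n y => [|n IH] y.
    move=> + _; apply: (lspan_min (S := [set 0])) => [|u [k] //].
    by split=> // a u v -> ->; rewrite scaler0 addr0.
  pose Q := [set y | exists a z, y = a *: e' n + z /\
    lspan [set e' k | k in [set k | (k < n)%N]] z].
  have Qsub : subspace Q.
    split=> [|b x1 x2 [a1 [z1 [-> z1P]]] [a2 [z2 [-> z2P]]]].
      exists 0, 0; rewrite scale0r addr0; split=> //.
      exact: lspan0.
    exists (b * a1 + a2), (b *: z1 + z2); split.
      by rewrite scalerDr scalerA scalerDl addrACA.
    exact: lspanP.
  move=> yP Sy.
  have {yP} : Q y.
    apply: lspan_min yP => // _ [k /= kn <-].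
    have [->|nk] := eqVneq k n.
      exists 1, 0; rewrite scale1r addr0; split=> //.
      exact: lspan0.
    exists 0, (e' k); rewrite scale0r add0r; split=> //.
    by apply: sub_lspan; exists k => //=; rewrite ltn_neqAle nk -ltnS.
  move=> [a [z [yE zP]]].
  have [ae0|ae0] := eqVneq (a *: e' n) 0.
    by move: yE Sy; rewrite ae0 add0r => ->; exact: IH.
  exfalso; have a0 : a != 0 by apply: contraNneq ae0 => ->; rewrite scale0r.
  have [Nn|Nn] := pselect (new n); last first.
    by move: ae0; rewrite e'0 // scaler0 eqxx.
  rewrite e'N // in yE.
  apply: Nn; rewrite (_ : e n = a^-1 *: (y - z)); last first.
    by rewrite yE addrK scalerA mulVf // scale1r.
  apply: lspanZ; apply: lspanB.
    by apply: sub_lspan; left.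
  apply: lspan_min zP => [|_ [k /= kn <-]]; first exact: subspace_lspan.
  have [Nk|Nk] := pselect (new k); last by rewrite e'0 //; exact: lspan0.
  by rewrite e'N //; apply: sub_lspan; right; exists k.
split=> [|| u].
- exact: val_inj.
- apply/seteqP; split=> [_ [[x _ <-] Sx]|_ ->] /=; last first.
    by split; [exists 0; rewrite ?linear0|exact: subspace0].
  have Kx := subspace_typeP x.
  have [n [c xE]] := lspan_nat Kx.
  apply: (KcapS n) => //; rewrite xE.
  apply: lspan_sum => i _.
  apply: lspanZ.
  by apply: sub_lspan; exists i => /=.
- have [x [Kx [s Ss ->]]] := KS u.
  have [x' x'E] := subspace_type_ex Ksub Kx.
  by exists x', s => //=; rewrite x'E.
Qed.

(** Project a spanning sequence of [U] onto [S] along a complement; in a vector of [S] the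
    complement components add up to 0. *)
Lemma subspace_countable U (S : set U) : countable_dim U -> subspace S ->
  exists a : nat -> U, (forall n, S (a n)) /\ S = lspan (range a).
Proof.
move=> cU Ssub; have [X [j [cX [_ jS jT]]]] := complement_ex cU Ssub.
case: cU => e eT.
have /choice[s sP] n : exists s, S s /\ exists x, e n = j x + s.
  by have [x [s Ss ->]] := jT (e n); exists s; split=> //; exists x.
exists s; split=> [n|]; first exact: (sP n).1.
have sS : lspan (range s) `<=` S.
  by apply: lspan_min => // _ [n _ <-]; exact: (sP n).1.
apply/seteqP; split=> // u Su.
pose Q := [set u | exists2 z, lspan (range s) z & exists x, u = j x + z].
have Qsub : subspace Q.
  split=> [|a u1 u2 [z zP [x ->]] [z' z'P [x' ->]]].
    by exists 0; [exact: lspan0|exists 0; rewrite linear0 addr0].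
  exists (a *: z + z'); first exact: lspanP.
  by exists (a *: x + x'); rewrite linearP scalerDr addrACA.
have : Q u.
  have : lspan (range e) u by rewrite eT.
  apply: lspan_min => // _ [n _ <-]; have [_ [x ->]] := sP n.
  by exists (s n); [apply: sub_lspan; exists n|exists x].
move=> [z zP [x uE]].
have : (range j `&` S) (j x).
  split; first by exists x.
  rewrite (_ : j x = u - z); last by rewrite uE addrK.
  by apply: subspaceB => //; exact: sS.
by rewrite jS => jx0; rewrite uE jx0 add0r.
Qed.

Lemma countable_dim_prod U V :
  countable_dim U -> countable_dim V -> countable_dim (U * V)%type.
Proof.
move=> [e eT] [f fT].
exists (fun n => if odd n then (0, f n./2) else (e n./2, 0)).
set g := fun n => _; apply/seteqP; split=> // -[u v] _.
have -> : (u, v) = inl_lin U V u + inr_lin U V v.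
  by congr pair => /=; rewrite ?addr0 ?add0r.
apply: lspanD.
  have : (inl_lin U V @` lspan (range e)) (inl_lin U V u).
    by exists u; rewrite ?eT.
  rewrite lspan_image; apply: lspan_mono => _ [_ [n _ <-] <-].
  by exists n.*2; rewrite // /g odd_double doubleK.
have : (inr_lin U V @` lspan (range f)) (inr_lin U V v).
  by exists v; rewrite ?fT.
rewrite lspan_image; apply: lspan_mono => _ [_ [n _ <-] <-].
by exists n.*2.+1; rewrite // /g /= odd_double uphalf_double.
Qed.

Lemma countable_dim_poly : countable_dim {poly C}.
Proof.
exists (fun n => 'X^n); apply/seteqP; split=> // q _.
rewrite -[q]coefK poly_def.
apply: lspan_sum => i _.
apply: lspanZ.
by apply: sub_lspan; exists (i : nat).
Qed.

End CountableDimension.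

(** * Infinite sequences built in finite stages *)

Section Recursion.
Variables (A : Type) (good : seq A -> Prop) (Q : nat -> seq A -> Prop).

(** Stage [k] extends the current list so as to meet requirement [k]. Each extension is nonempty, so
    the stages are initial segments of one infinite sequence and exhaust it. *)
Lemma sequence_by_stages :
  good [::] ->
  (forall k s, good s ->
     exists s', [/\ (0 < size s')%N, good (s ++ s') & Q k (s ++ s')]) ->
  exists u : nat -> A,
    forall k, exists n, [/\ (k < n)%N, good (mkseq u n) & Q k (mkseq u n)].
Proof.
move=> good0 step.
(* Choice needs a total statement, whereas extensions are given for good lists only; hence the
   implication. *)
have /choice[next nextP] (ks : nat * seq A) : exists s', good ks.2 ->
    [/\ (0 < size s')%N, good (ks.2 ++ s') & Q ks.1 (ks.2 ++ s')].
  have [/(step ks.1)[s' s'P]|ng] := pselect (good ks.2); first by exists s'.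
  by exists [::].
pose S := fix S k := if k is k'.+1 then S k' ++ next (k', S k') else [::].
have Sgood k : good (S k).
  by elim: k => // k IH /=; have [] := nextP (k, S k) IH.
have Ssize k : (k <= size (S k))%N.
  elim: k => // k IH /=; have [s0 _ _] := nextP (k, S k) (Sgood k).
  by rewrite size_cat -addn1 leq_add.
have x0 : A by have := Ssize 1; case: (S 1).
have Snth k l i : (k <= l)%N -> (i < size (S k))%N ->
    nth x0 (S l) i = nth x0 (S k) i.
  move=> /subnK <-; elim: (l - k)%N => //= d IH ik.
  rewrite nth_cat; have -> : (i < size (S (d + k)))%N; last exact: IH.
  apply: leq_trans ik _; elim: d {IH} => //= d IH.
  by rewrite size_cat; apply: leq_trans IH _; exact: leq_addr.
(* Stage [i.+1] has more than [i] entries, and later stages do not change them. *)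
exists (fun i => nth x0 (S i.+1) i) => k; exists (size (S k.+1)).
have -> : mkseq (fun i => nth x0 (S i.+1) i) (size (S k.+1)) = S k.+1.
  apply: (eq_from_nth (x0 := x0)); rewrite size_mkseq // => i ik.
  rewrite nth_mkseq //.
  have [ki|ik'] := leqP k.+1 i.+1; first exact: Snth.
  by rewrite (Snth i.+1 k.+1) // ltnW.
split=> //; have [s0 _ //] := nextP (k, S k) (Sgood k).
Qed.

End Recursion.

(** * Dual and hyperbolic bases *)

Section PairingTheory.
Variables (C : fieldType) (V W : lmodType C) (p : pairing V W).

Lemma pZl a u w : p (a *: u) w = a * p u w. Proof. exact: linearZl_LR. Qed.
Lemma pZr a u w : p u (a *: w) = a * p u w. Proof. exact: linearZr_LR. Qed.
Lemma pDl u v w : p (u + v) w = p u w + p v w. Proof. exact: linearDl. Qed.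
Lemma pDr u v w : p u (v + w) = p u v + p u w. Proof. exact: linearDr. Qed.
Lemma pBl u v w : p (u - v) w = p u w - p v w. Proof. exact: linearBl. Qed.
Lemma pBr u v w : p u (v - w) = p u v - p u w. Proof. exact: linearBr. Qed.
Lemma pNl u w : p (- u) w = - p u w. Proof. exact: linearNl. Qed.
Lemma pNr u w : p u (- w) = - p u w. Proof. exact: linearNr. Qed.
Lemma p0l w : p 0 w = 0. Proof. exact: linear0l. Qed.
Lemma p0r u : p u 0 = 0. Proof. exact: linear0r. Qed.
Lemma p_suml I (r : seq I) (P : pred I) (F : I -> V) w :
  p (\sum_(i <- r | P i) F i) w = \sum_(i <- r | P i) p (F i) w.
Proof. exact: linear_sumlz. Qed.
Lemma p_sumr I (r : seq I) (P : pred I) (F : I -> W) u :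
  p u (\sum_(i <- r | P i) F i) = \sum_(i <- r | P i) p u (F i).
Proof. exact: linear_sumr. Qed.

Definition pE := (pZl, pZr, pDl, pDr, pBl, pBr, pNl, pNr, p0l, p0r).

End PairingTheory.

Section DualFamilies.
Variables (C : numClosedFieldType) (V W : lmodType C) (p : pairing V W).

Definition dual_family (K : eqType) (v : K -> V) (w : K -> W) :=
  forall i j, p (v i) (w j) = (i == j)%:R.

Definition independent (e : nat -> V) := forall n (c : 'I_n -> C),
  \sum_(i < n) c i *: e i = 0 -> forall i, c i = 0.

(** For [n + 1] independent vectors and [n] functionals, the matrix of values has a nonzero left
    kernel. *)
Lemma orthogonal_vector (e : nat -> V) (ws : seq W) : independent e ->
  exists2 v, v <> 0 & forall w, w \in ws -> p v w = 0.
Proof.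
move=> e_ind; pose n := size ws.
pose M : 'M[C]_(n.+1, n) := \matrix_(i, j) p (e i) (ws`_j).
have : kermx M != 0.
  rewrite -mxrank_eq0 mxrank_ker -lt0n subn_gt0 ltnS.
  exact: rank_leq_col.
move=> /rowV0Pn[c /sub_kermxP cM c0].
exists (\sum_i c 0 i *: e i) => [/e_ind c_eq0|w /(nthP 0)[j jn <-]].
  by case/eqP: c0; apply/rowP => i; rewrite c_eq0 mxE.
rewrite p_suml; have := congr1 (fun A : 'rV_n => A 0 (Ordinal jn)) cM.
by rewrite !mxE => {2}<-; apply: eq_bigr => i _; rewrite pZl mxE.
Qed.

Definition dual_pair (x : V * W) := p x.1 x.2 == 1.
Definition orthogonal_pairs (x y : V * W) :=
  (p x.1 y.2 == 0) && (p y.1 x.2 == 0).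
Definition dual_seq (s : seq (V * W)) :=
  all dual_pair s && pairwise orthogonal_pairs s.

Lemma dual_seq_cat s s' : dual_seq (s ++ s') =
  [&& dual_seq s, dual_seq s' & allrel orthogonal_pairs s s'].
Proof.
rewrite /dual_seq all_cat pairwise_cat.
by case: (all _ s); case: (all _ s'); case: (allrel _ _ _);
  rewrite /= ?andbT ?andbF.
Qed.

Lemma dual_seq_rcons s x : dual_seq (rcons s x) =
  [&& dual_seq s, dual_pair x & all (orthogonal_pairs^~ x) s].
Proof.
rewrite -cats1 dual_seq_cat allrel1r; congr [&& _, _ & _].
by rewrite /dual_seq /= !andbT.
Qed.

Lemma dual_seq_nth x0 s i j : dual_seq s -> (i < size s)%N -> (j < size s)%N ->
  p (nth x0 s i).1 (nth x0 s j).2 = (i == j)%:R.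
Proof.
move=> /andP[/all_nthP s1 /(pairwiseP x0) s0] si sj.
have [->|/eqP] := eqVneq i j; first exact/eqP/s1.
move/eqP; rewrite neq_ltn => /orP[ij|ji].
  by have /andP[/eqP ->] := s0 _ _ si sj ij.
by have /andP[_ /eqP ->] := s0 _ _ sj si ji.
Qed.

Lemma dual_seq_mem s x y : dual_seq s -> x \in s -> y \in s ->
  p x.1 y.2 = (x == y)%:R.
Proof.
move=> ds /(nthP x)[i si <-] /(nthP x)[j sj <-].
rewrite dual_seq_nth // nth_uniq //; apply/(uniqP x) => {si sj} i' j' si' sj' ij.
have := dual_seq_nth x ds si' sj'; rewrite {1}ij dual_seq_nth // eqxx.
by case: eqVneq => // _ /eqP; rewrite oner_eq0.
Qed.

Lemma dual_seq_uniq s : dual_seq s -> uniq s.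
Proof.
case: s => // x s ds; apply/(uniqP x) => i j si sj ij.
have := dual_seq_nth x ds si sj; rewrite {1}ij dual_seq_nth // eqxx.
by case: eqVneq => // _ /eqP; rewrite oner_eq0.
Qed.

Lemma dual_seq_limit (u : nat -> V * W) :
  (forall k, exists2 n, (k < n)%N & dual_seq (mkseq u n)) ->
  dual_family (fun i => (u i).1) (fun i => (u i).2).
Proof.
move=> ud i j; have [n ijn dn] := ud (maxn i j).
have := @dual_seq_nth (0, 0) _ i j dn; rewrite size_mkseq.
have [li lj] : (i < n)%N /\ (j < n)%N.
  by split; apply: leq_ltn_trans ijn; rewrite ?leq_maxl ?leq_maxr.
by rewrite !nth_mkseq //; exact.
Qed.

Section Projection.
Variable s : seq (V * W).
Hypothesis s_dual : dual_seq s.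

(** The component of [v] annihilated by the right members of [s]; the subtracted sum is the
    component in the span of the left members. *)
Definition projl v : V := v - \sum_(x <- s) p v x.2 *: x.1.
Definition projr w : W := w - \sum_(x <- s) p x.1 w *: x.2.

Lemma projl_orth v x : x \in s -> p (projl v) x.2 = 0.
Proof.
move=> xs; rewrite pBl p_suml.
rewrite (bigD1_seq x) ?(dual_seq_uniq s_dual) //= big1_seq ?addr0 => [|y /andP[yx ys]].
  by rewrite pZl (dual_seq_mem s_dual) // eqxx mulr1 subrr.
by rewrite pZl (dual_seq_mem s_dual) // (negbTE yx) mulr0.
Qed.

Lemma projr_orth w x : x \in s -> p x.1 (projr w) = 0.
Proof.
move=> xs; rewrite pBr p_sumr.
rewrite (bigD1_seq x) ?(dual_seq_uniq s_dual) //= big1_seq ?addr0 => [|y /andP[yx ys]].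
  by rewrite pZr (dual_seq_mem s_dual) // eqxx mulr1 subrr.
by rewrite pZr (dual_seq_mem s_dual) // eq_sym (negbTE yx) mulr0.
Qed.

Lemma pairing_projr v w : (forall x, x \in s -> p v x.2 = 0) ->
  p v (projr w) = p v w.
Proof.
move=> vs; rewrite pBr p_sumr big1_seq ?subr0 // => x /vs vx.
by rewrite pZr vx mulr0.
Qed.

Lemma pairing_projl v w : (forall x, x \in s -> p x.1 w = 0) ->
  p (projl v) w = p v w.
Proof.
move=> vs; rewrite pBl p_suml big1_seq ?subr0 // => x /vs vx.
by rewrite pZl vx mulr0.
Qed.

Lemma dual_seq_extend v w : (forall x, x \in s -> p v x.2 = 0) ->
  p v w = 1 -> dual_seq (rcons s (v, projr w)).
Proof.
move=> vs vw; rewrite dual_seq_rcons s_dual /dual_pair /= pairing_projr // vw.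
rewrite eqxx /=; apply/allP => x xs.
by rewrite /orthogonal_pairs /= vs // projr_orth // eqxx.
Qed.

End Projection.

(** That [w'] is a multiple of [w] is recorded so that orthogonality relations carry over. *)
Lemma pairing_normalize v w : p v w <> 0 -> exists2 w', p v w' = 1 &
  exists a, w' = a *: w.
Proof.
move=> /eqP vw; exists ((p v w)^-1 *: w); last by eexists.
by rewrite pZr mulVf.
Qed.

End DualFamilies.

Section DualBasis.
Variables (C : numClosedFieldType) (V W : lmodType C) (p : pairing V W).
Hypothesis p_nondeg : nondegenerate_pairing p.

Lemma nondegl v : v <> 0 -> exists w, p v w <> 0.
Proof.
move=> v0; apply: contrapT => /forallNP vN; apply: v0; apply: p_nondeg.1 => w.
by have /contrapT := vN w.
Qed.

Lemma nondegr w : w <> 0 -> exists v, p v w <> 0.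
Proof.
move=> w0; apply: contrapT => /forallNP wN; apply: w0; apply: p_nondeg.2 => v.
by have /contrapT := wN v.
Qed.

Lemma nondegr_eq w w' : (forall v, p v w = p v w') -> w = w'.
Proof.
by move=> ww'; apply/subr0_eq/p_nondeg.2 => v; rewrite pBr ww' subrr.
Qed.

Definition lefts (s : seq (V * W)) := lspan [set v | exists2 x, x \in s & v = x.1].
Definition rights (s : seq (V * W)) := lspan [set w | exists2 x, x \in s & w = x.2].

Lemma lefts_sub s s' : {subset s <= s'} -> lefts s `<=` lefts s'.
Proof. by move=> ss'; apply: lspan_mono => _ [x /ss' xs ->]; exists x. Qed.

Lemma rights_sub s s' : {subset s <= s'} -> rights s `<=` rights s'.
Proof. by move=> ss'; apply: lspan_mono => _ [x /ss' xs ->]; exists x. Qed.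

Lemma lefts_sum s (F : V * W -> C) : lefts s (\sum_(x <- s) F x *: x.1).
Proof.
apply: (subspace_sum_seq (subspace_lspan _)) => x xs; apply: lspanZ.
by apply: sub_lspan; exists x.
Qed.

Lemma rights_sum s (F : V * W -> C) : rights s (\sum_(x <- s) F x *: x.2).
Proof.
apply: (subspace_sum_seq (subspace_lspan _)) => x xs; apply: lspanZ.
by apply: sub_lspan; exists x.
Qed.

(** If [v] is already in the span, its projection is 0 and cannot start a new pair. A nonzero vector
    orthogonal to [s], which exists in infinite dimension, is used instead, so that the sequence
    always grows. *)
Lemma dual_seq_extend_left (i : nat -> V) s v : independent i -> dual_seq p s ->
  exists x, dual_seq p (rcons s x) /\ lefts (rcons s x) v.
Proof.
move=> i_ind sd.
have [v0 [v0N0 v0s vs]] : exists v0, [/\ v0 <> 0,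
    forall x, x \in s -> p v0 x.2 = 0 &
    forall x, x.1 = v0 -> lefts (rcons s x) v].
  have vE : v = projl p s v + \sum_(x <- s) p v x.2 *: x.1 by rewrite subrK.
  have sub x : {subset s <= rcons s x}.
    by move=> y ys; rewrite mem_rcons in_cons ys orbT.
  have [v'0|/eqP v'0] := eqVneq (projl p s v) 0; last first.
    exists (projl p s v); split=> // [x|x xE]; first exact: projl_orth.
    rewrite vE; apply: lspanD.
      by apply: sub_lspan; exists x; rewrite ?xE // mem_rcons in_cons eqxx.
    apply: (lefts_sub (sub x)); exact: lefts_sum.
  have [v0 v0N0 v0s] := orthogonal_vector p [seq x.2 | x <- s] i_ind.
  exists v0; split=> // [x xs|x _]; first exact/v0s/map_f.
  by rewrite vE v'0 add0r; apply: (lefts_sub (sub x)); exact: lefts_sum.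
have [w /pairing_normalize[w' v0w' _]] := nondegl v0N0.
exists (v0, projr p s w'); split; last exact: vs.
exact: dual_seq_extend.
Qed.

(** Here the projection of [w] itself must enter the new pair, so its partner is projected as well;
    this does not change the pairing with a vector orthogonal to [s]. *)
Lemma dual_seq_extend_right (i : nat -> V) s w : independent i -> dual_seq p s ->
  exists x, dual_seq p (rcons s x) /\ rights (rcons s x) w.
Proof.
move=> i_ind sd.
have wE : w = projr p s w + \sum_(x <- s) p x.1 w *: x.2 by rewrite subrK.
have sub x : {subset s <= rcons s x}.
  by move=> y ys; rewrite mem_rcons in_cons ys orbT.
have [w'0|/eqP w'0] := eqVneq (projr p s w) 0.
  have [x [xd _]] := dual_seq_extend_left 0 i_ind sd.
  exists x; split=> //; rewrite wE w'0 add0r.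
  by apply: (rights_sub (sub x)); exact: rights_sum.
have [v vw] := nondegr w'0.
pose v' := (p v (projr p s w))^-1 *: v.
have v'w : p v' (projr p s w) = 1 by rewrite pZl mulVf //; apply/eqP.
have oS : forall x, x \in s -> p x.1 (projr p s w) = 0.
  by move=> x xs; exact: projr_orth.
exists (projl p s v', projr p s w); split.
  rewrite dual_seq_rcons sd /dual_pair /= pairing_projl // v'w eqxx /=.
  apply/allP => x xs.
  by rewrite /orthogonal_pairs /= projl_orth // oS // eqxx.
set x := (_, _); suff: rights (rcons s x) (projr p s w + \sum_(x <- s) p x.1 w *: x.2).
  by rewrite -wE.
apply: lspanD; last first.
  by apply: (rights_sub (sub _)); exact: rights_sum.
apply: sub_lspan; exists x => //.
by rewrite mem_rcons in_cons eqxx.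
Qed.

Definition dual_basis (e : nat -> V) (f : nat -> W) :=
  [/\ dual_family p e f, lspan (range e) = setT & lspan (range f) = setT].

(* Mackey: extend a finite dual sequence alternately by the next vector of [V]
   and of [W]. *)
Lemma dual_basis_ex (i : nat -> V) : independent i ->
  countable_dim V -> countable_dim W -> exists e f, dual_basis e f.
Proof.
move=> i_ind [a aT] [b bT].
have [] := @sequence_by_stages _ (dual_seq p)
  (fun k s => lefts s (a k) /\ rights s (b k)) => //.
  move=> k s sd.
  have [x [xd xa]] := dual_seq_extend_left (a k) i_ind sd.
  have [y [yd yb]] := dual_seq_extend_right (b k) i_ind xd.
  exists [:: x; y]; rewrite -cat_rcons cats1; split=> //; split=> //.
  by apply: lefts_sub xa => z zs; rewrite mem_rcons in_cons zs orbT.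
move=> u uP; exists (fun i => (u i).1), (fun i => (u i).2); split.
- by apply: dual_seq_limit => k; have [n []] := uP k; exists n.
- apply/seteqP; split=> // v _; have: lspan (range a) v by rewrite aT.
  apply: lspan_min; first exact: subspace_lspan.
  move=> _ [k _ <-]; have [n [_ _ [ak _]]] := uP k.
  by apply: lspan_mono ak => _ [_ /mapP[j _ ->] ->]; exists j.
- apply/seteqP; split=> // v _; have: lspan (range b) v by rewrite bT.
  apply: lspan_min; first exact: subspace_lspan.
  move=> _ [k _ <-]; have [n [_ _ [_ bk]]] := uP k.
  by apply: lspan_mono bk => _ [_ /mapP[j _ ->] ->]; exists j.
Qed.

End DualBasis.

(** * Hyperbolic bases for symmetric and antisymmetric forms *)

Section HyperbolicBasis.
Variables (C : numClosedFieldType) (k : form_kind).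
Variables (V : lmodType C) (p : pairing V V).
Hypothesis p_sym : form_symmetric k p.
Local Notation eps := (Defs.form_sign C k).

Lemma form_sign_sqr : eps * eps = 1.
Proof. by case: k; rewrite /= ?mulr1 // mulrNN mulr1. Qed.

Lemma form_sign_neq0 : eps != 0.
Proof. by case: k; rewrite /= ?oner_neq0 // oppr_eq0 oner_neq0. Qed.

Lemma p_eq0C x y : p x y = 0 -> p y x = 0.
Proof. by move=> xy; rewrite p_sym xy mulr0. Qed.

Lemma symplectic_isotropic x : k = Symplectic -> p x x = 0.
Proof.
move=> kS; have := p_sym x x; rewrite kS /= mulN1r => /eqP.
by rewrite -addr_eq0 -mulr2n mulrn_eq0 /= => /eqP.
Qed.

Lemma orthogonal_sym x y : k = Orthogonal -> p x y = p y x.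
Proof. by move=> kO; rewrite p_sym kO /= mul1r. Qed.

Definition hyperbolic_pair (a b : V) :=
  [/\ p a b = 1, p a a = 0 & p b b = 0].

Section InSubspace.
Variables (S : set V) (Ssub : subspace S).

(** Subtracting [(<y,y> / 2) x] makes [y] isotropic without changing [<x,y>]; in the symplectic case
    every vector is isotropic already. *)
Lemma hyperbolic_pair_isotropic x y : S x -> S y -> p x x = 0 -> p x y = 1 ->
  exists b, [/\ S b, hyperbolic_pair x b & exists c, b = y - c *: x].
Proof.
move=> Sx Sy xx xy; case: k p_sym => pS.
  exists (y - (p y y / 2) *: x); split; last by eexists.
    by apply: subspaceB => //; exact: subspaceZ.
  split=> //; rewrite !pE xx xy ?mulr0 ?subr0 //.
  by rewrite (pS y x) /= xy; field.
have iso z : p z z = 0.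
  have := pS z z; rewrite /= mulN1r => /eqP.
  by rewrite -addr_eq0 -mulr2n mulrn_eq0 /= => /eqP.
by exists y; split=> //; exists 0; rewrite scale0r subr0.
Qed.

(** Two orthogonal anisotropic vectors span a hyperbolic plane: [x + c z] and [x - c z] are
    isotropic when [c^2 <z,z> = - <x,x>], which calls for a square root. They pair to [2 <x,x>],
    whence the normalization, and half their sum is [x]. *)
Lemma hyperbolic_pair_anisotropic x z : k = Orthogonal -> S x -> S z ->
  p x x <> 0 -> p z z <> 0 -> p x z = 0 ->
  exists a b, [/\ S a, S b, hyperbolic_pair a b &
    exists c d, x = c *: a + d *: b].
Proof.
move=> kO Sx Sz /eqP xx /eqP zz xz.
pose c := sqrtC (- p x x / p z z).
have cE : c * (c * p z z) = - p x x by rewrite mulrA -expr2 sqrtCK mulfVK.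
have two0 : 2 != 0 :> C by rewrite pnatr_eq0.
have zx : p z x = 0 by exact: p_eq0C.
exists (x + c *: z), ((2 * p x x)^-1 *: (x - c *: z)); split.
- by apply: subspaceD => //; exact: subspaceZ.
- by apply: subspaceZ => //; apply: subspaceB => //; exact: subspaceZ.
- split; rewrite !pE xz zx ?mulr0 ?subr0 ?sub0r ?add0r ?addr0.
  + by rewrite mulrN cE opprK; field.
  + by rewrite cE subrr.
  + by rewrite oppr0 sub0r !mulrN opprK cE subrr !mulr0.
- exists (1 / 2), (p x x); rewrite scalerA.
  have -> : p x x * (2 * p x x)^-1 = 1 / 2 by field.
  rewrite -scalerDr addrACA subrr addr0 -mulr2n -scaler_nat scalerA.
  by rewrite mulfVK ?scale1r.
Qed.

End InSubspace.

Definition hyp_pair (x : V * V) :=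
  [&& p x.1 x.2 == 1, p x.1 x.1 == 0 & p x.2 x.2 == 0].
Definition hyp_orth (x y : V * V) :=
  [&& p x.1 y.1 == 0, p x.1 y.2 == 0, p x.2 y.1 == 0 & p x.2 y.2 == 0].
Definition hyp_seq s := all hyp_pair s && pairwise hyp_orth s.

(** The sign makes the flip of a hyperbolic pair a dual pair, because
    [<b, eps a> = eps^2 <a,b> = 1]. Adjoining all flips turns a hyperbolic sequence into a dual one,
    and the projections of dual sequences become available. *)
Definition hyp_flip (x : V * V) : V * V := (x.2, eps *: x.1).
Definition hyp_double s := s ++ map hyp_flip s.

Lemma hyp_orthC x y : hyp_orth x y = hyp_orth y x.
Proof.
suff sub u v : hyp_orth u v -> hyp_orth v u by apply/idP/idP; exact: sub.
by move=> /and4P[/eqP h1 /eqP h2 /eqP h3 /eqP h4]; apply/and4P;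
  split; apply/eqP; exact: p_eq0C.
Qed.

Lemma hyp_seq_cat s s' : hyp_seq (s ++ s') =
  [&& hyp_seq s, hyp_seq s' & allrel hyp_orth s s'].
Proof.
rewrite /hyp_seq all_cat pairwise_cat.
by case: (all _ s); case: (all _ s'); case: (allrel _ _ _);
  rewrite /= ?andbT ?andbF.
Qed.

Lemma hyp_seq_rcons s x : hyp_seq (rcons s x) =
  [&& hyp_seq s, hyp_pair x & all (hyp_orth^~ x) s].
Proof.
rewrite -cats1 hyp_seq_cat allrel1r; congr [&& _, _ & _].
by rewrite /hyp_seq /= !andbT.
Qed.

Lemma hyp_seq_double s : hyp_seq s -> dual_seq p (hyp_double s).
Proof.
elim/last_ind: s => // s x IH; rewrite hyp_seq_rcons => /and3P[hs hx sx].
have {IH} := IH hs; rewrite /hyp_double map_rcons !dual_seq_cat !dual_seq_rcons.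
move=> /and3P[d1 d2 d3]; rewrite d1 d2 /=.
have /and3P[/eqP x12 /eqP x11 /eqP x22] := hx.
have sx' y : y \in s -> [/\ [/\ p y.1 x.1 = 0, p y.1 x.2 = 0,
    p y.2 x.1 = 0 & p y.2 x.2 = 0], p x.1 y.1 = 0, p x.1 y.2 = 0,
    p x.2 y.1 = 0 & p x.2 y.2 = 0].
  move=> /(allP sx)/and4P[/eqP ? /eqP ? /eqP ? /eqP ?].
  by split; do ?split=> //; exact: p_eq0C.
rewrite /dual_pair /= x12 eqxx /= pZr p_sym x12 mulr1 form_sign_sqr eqxx /=.
apply/and3P; split.
- by apply/allP => y /sx'[[]]; rewrite /orthogonal_pairs => _ -> _ _ _ -> _ _;
    rewrite eqxx.
- apply/allP => _ /mapP[y /sx'[[h1 h2 h3 h4] g1 g2 g3 g4] ->].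
  by rewrite /orthogonal_pairs /hyp_flip /= !pZr h3 g3 mulr0 eqxx.
- apply/allrelP => u v; rewrite !mem_rcons !in_cons.
  have E y z : orthogonal_pairs p y (hyp_flip z) =
      (p y.1 z.1 == 0) && (p z.2 y.2 == 0).
    by rewrite /orthogonal_pairs /= pZr mulf_eq0 (negbTE form_sign_neq0).
  move=> /orP[/eqP ->|us] /orP[/eqP ->|vs].
  + by rewrite E x11 x22 eqxx.
  + have /mapP[z /sx'[[h1 h2 h3 h4] g1 _ _ _] ->] := vs.
    by rewrite E g1 h4 eqxx.
  + by rewrite E; have [[-> _ _ _] _ _ _ ->] := sx' _ us; rewrite eqxx.
  + by move/allrelP: d3; apply.
Qed.

Definition hyp_span (s : seq (V * V)) :=
  lspan [set v | exists2 x, x \in s & v = x.1 \/ v = x.2].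

Lemma hyp_span_sub s s' : {subset s <= s'} -> hyp_span s `<=` hyp_span s'.
Proof. by move=> ss'; apply: lspan_mono => v [x /ss' xs ?]; exists x. Qed.

Definition hyp_family (K : eqType) (a b : K -> V) :=
  forall i j, [/\ p (a i) (b j) = (i == j)%:R, p (a i) (a j) = 0
                & p (b i) (b j) = 0].

Lemma hyp_seq_nth x0 s i j : hyp_seq s -> (i < size s)%N -> (j < size s)%N ->
  let x := nth x0 s i in let y := nth x0 s j in
  [/\ p x.1 y.2 = (i == j)%:R, p x.1 y.1 = 0 & p x.2 y.2 = 0].
Proof.
move=> /andP[/all_nthP s1 /(pairwiseP x0) s0] si sj /=.
have [->|/eqP] := eqVneq i j.
  by have /and3P[/eqP -> /eqP -> /eqP ->] := s1 x0 j sj.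
move/eqP; rewrite neq_ltn => /orP[ij|ji].
  by have /and4P[/eqP -> /eqP -> _ /eqP ->] := s0 _ _ si sj ij.
have := s0 _ _ sj si ji; rewrite hyp_orthC.
by move=> /and4P[/eqP -> /eqP -> _ /eqP ->].
Qed.

Lemma hyp_seq_limit (u : nat -> V * V) :
  (forall k, exists2 n, (k < n)%N & hyp_seq (mkseq u n)) ->
  hyp_family (fun i => (u i).1) (fun i => (u i).2).
Proof.
move=> ud i j; have [n ijn dn] := ud (maxn i j).
have := @hyp_seq_nth (0, 0) _ i j dn; rewrite size_mkseq.
have [li lj] : (i < n)%N /\ (j < n)%N.
  by split; apply: leq_ltn_trans ijn; rewrite ?leq_maxl ?leq_maxr.
by rewrite !nth_mkseq //; exact.
Qed.

Hypothesis p_nondeg : nondegenerate_pairing p.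

(** The projection [v'] of [v] to the orthogonal complement [S] of the sequence (or any nonzero
    vector of [S] if it vanishes) is put into a hyperbolic plane inside [S]. If [v'] is isotropic,
    any partner can be corrected. Otherwise the form is symmetric, and a second anisotropic vector
    of [S] orthogonal to [v'] is needed, which infinite dimension provides. *)
Lemma hyp_seq_extend (i : nat -> V) s v : independent i -> hyp_seq s ->
  exists x, hyp_seq (rcons s x) /\ hyp_span (rcons s x) v.
Proof.
move=> i_ind hs; have ds := hyp_seq_double hs.
pose S := [set y | forall x, x \in s -> p y x.1 = 0 /\ p y x.2 = 0].
have Ssub : subspace S.
  split=> [x _|a y z yS zS x xs]; first by rewrite !pE.
  by rewrite !pE (yS _ xs).1 (yS _ xs).2 (zS _ xs).1 (zS _ xs).2 !mulr0 !addr0.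
have Sproj y : S (projl p (hyp_double s) y).
  move=> x xs; split; last first.
    by apply: (projl_orth ds); rewrite mem_cat xs.
  have : p (projl p (hyp_double s) y) (hyp_flip x).2 = 0.
    by apply: (projl_orth ds); rewrite mem_cat map_f ?orbT.
  by rewrite pZr => /eqP; rewrite mulf_eq0 (negbTE form_sign_neq0) => /eqP.
have projS y z : S y -> p y (projl p (hyp_double s) z) = p y z.
  move=> Sy; rewrite p_sym pairing_projl -?p_sym // => x.
  rewrite mem_cat => /orP[xs|/mapP[u us ->]]; apply: p_eq0C.
    by case: (Sy _ xs).
  by case: (Sy _ us).
have projE y : hyp_span s (y - projl p (hyp_double s) y).
  rewrite opprB addrC subrK; apply: (subspace_sum_seq (subspace_lspan _)) => x.
  rewrite mem_cat => xs; apply: lspanZ; apply: sub_lspan.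
  by case/orP: xs => [xs|/mapP[u us ->]]; [exists x|exists u]; auto.
have finish a b : S a -> S b -> hyperbolic_pair a b ->
    hyp_seq (rcons s (a, b)).
  move=> Sa Sb [ab aa bb]; rewrite hyp_seq_rcons hs /hyp_pair /= ab aa bb.
  rewrite !eqxx /=; apply/allP => x xs; rewrite hyp_orthC /hyp_orth /=.
  by have [-> ->] := Sa _ xs; have [-> ->] := Sb _ xs; rewrite eqxx.
have sub x : {subset s <= rcons s x}.
  by move=> y ys; rewrite mem_rcons in_cons ys orbT.
have spanab a b c d : hyp_span (rcons s (a, b)) (c *: a + d *: b).
  have ab : (a, b) \in rcons s (a, b) by rewrite mem_rcons in_cons eqxx.
  by apply: lspanD; apply: lspanZ; apply: sub_lspan; exists (a, b); auto.
have partner y : S y -> y <> 0 -> exists2 z, S z & p y z = 1.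
  move=> Sy /(nondegl p_nondeg)[w /pairing_normalize[z yz _]].
  by exists (projl p (hyp_double s) z) => //; rewrite projS.
suff [v' [Sv' v'0 vv']] : exists v', [/\ S v', v' <> 0 &
    forall x, hyp_span (rcons s x) v' -> hyp_span (rcons s x) v].
  have [iso|/eqP aniso] := eqVneq (p v' v') 0.
    have [y Sy v'y] := partner _ Sv' v'0.
    have [b [Sb hb _]] := hyperbolic_pair_isotropic Ssub Sv' Sy iso v'y.
    exists (v', b); split; first exact: finish.
    by apply: vv'; have := spanab v' b 1 0; rewrite scale1r scale0r addr0.
  have kO : k = Orthogonal.
    by case: k symplectic_isotropic => // H; case: aniso; exact: H.
  have [z0 z0N0 z0s] := orthogonal_vector p
    (v' :: [seq x.1 | x <- s] ++ [seq x.2 | x <- s]) i_ind.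
  have Sz0 : S z0.
    by move=> x xs; split; apply: z0s; rewrite in_cons mem_cat map_f ?orbT.
  have z0v' : p z0 v' = 0 by apply: z0s; rewrite in_cons eqxx.
  have [y Sy z0y] := partner _ Sz0 z0N0.
  (* Since [z0] is orthogonal to [v'], making [y] orthogonal to [v'] keeps [<z0, y'> = 1]. *)
  pose y' := y - (p y v' / p v' v') *: v'.
  have Sy' : S y' := subspaceB Ssub Sy (subspaceZ Ssub _ Sv').
  have z0y' : p z0 y' = 1 by rewrite !pE z0v' mulr0 subr0.
  have y'v' : p y' v' = 0 by rewrite !pE mulfVK ?subrr //; apply/eqP.
  clearbody y'.
  (* If [z0] and [y'] are both isotropic, then [z0 + y'] has square 2. *)
  have [z [Sz v'z zz]] : exists z, [/\ S z, p v' z = 0 & p z z <> 0].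
    have [zz|/eqP ?] := eqVneq (p z0 z0) 0; last first.
      by exists z0; split=> //; exact: p_eq0C.
    have [yy|/eqP ?] := eqVneq (p y' y') 0; last first.
      by exists y'; split=> //; exact: p_eq0C.
    exists (z0 + y'); split; first exact: (subspaceD Ssub).
      by rewrite pDr (p_eq0C z0v') (p_eq0C y'v') addr0.
    rewrite pDl !pDr zz yy z0y' (orthogonal_sym y' z0 kO) z0y' addr0 add0r.
    by apply/eqP; rewrite -mulr2n pnatr_eq0.
  have [a [b [Sa Sb hab [c [d v'E]]]]] :=
    hyperbolic_pair_anisotropic Ssub kO Sv' Sz aniso zz v'z.
  exists (a, b); split; first exact: finish.
  by apply: vv'; rewrite v'E; exact: spanab.
have [v'0|/eqP v'0] := eqVneq (projl p (hyp_double s) v) 0; last first.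
  exists (projl p (hyp_double s) v); split=> // x xv'.
  rewrite -[v](subrK (projl p (hyp_double s) v)); apply: lspanD => //.
  by apply: (hyp_span_sub (sub x)); exact: projE.
have [v0 v0N0 v0s] := orthogonal_vector p
  ([seq x.1 | x <- s] ++ [seq x.2 | x <- s]) i_ind.
exists v0; split=> // [x xs|x _].
  by split; apply: v0s; rewrite mem_cat map_f ?orbT.
by apply: (hyp_span_sub (sub x)); have := projE v; rewrite v'0 subr0.
Qed.

Lemma hyp_basis_ex (i : nat -> V) : independent i -> countable_dim V ->
  exists a b : nat -> V, hyp_family a b /\ lspan (range a `|` range b) = setT.
Proof.
move=> i_ind [e eT].
have [] := @sequence_by_stages _ hyp_seq (fun n s => hyp_span s (e n)) => //.
  move=> n s hs; have [x [hx xe]] := hyp_seq_extend (e n) i_ind hs.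
  by exists [:: x]; rewrite cats1.
move=> u uP; exists (fun i => (u i).1), (fun i => (u i).2); split.
  by apply: hyp_seq_limit => n; have [m []] := uP n; exists m.
apply/seteqP; split=> // v _; have: lspan (range e) v by rewrite eT.
apply: lspan_min; first exact: subspace_lspan.
move=> _ [n _ <-]; have [m [_ _]] := uP n.
by apply: lspan_mono => _ [_ /mapP[j _ ->] [|] ->]; [left|right]; exists j.
Qed.

End HyperbolicBasis.

(** * Toral subalgebras are simultaneously diagonalizable *)

Section Tensors.
Variables (C : numClosedFieldType) (V W : lmodType C) (p : pairing V W).
Variable T : tensor_product V W.

Lemma tensZl a v w : tens T (a *: v) w = a *: tens T v w.
Proof. exact: linearZl_LR. Qed.
Lemma tensZr a v w : tens T v (a *: w) = a *: tens T v w.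
Proof. exact: linearZr_LR. Qed.
Lemma tensDl u v w : tens T (u + v) w = tens T u w + tens T v w.
Proof. exact: linearDl. Qed.
Lemma tensDr v u w : tens T v (u + w) = tens T v u + tens T v w.
Proof. exact: linearDr. Qed.
Lemma tens_suml I (r : seq I) (P : pred I) (F : I -> V) w :
  tens T (\sum_(i <- r | P i) F i) w = \sum_(i <- r | P i) tens T (F i) w.
Proof. exact: linear_sumlz. Qed.
Lemma tens_sumr I (r : seq I) (P : pred I) (F : I -> W) v :
  tens T v (\sum_(i <- r | P i) F i) = \sum_(i <- r | P i) tens T v (F i).
Proof. exact: linear_sumr. Qed.

(* Lift the tensor map to the span of its values: the composite with the
   inclusion agrees with the identity on pure tensors. *)
Lemma tens_span : lspan [set tens T v w | v in setT & w in setT] = setT.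
Proof.
set A := [set _ | _ in _ & _ in _]; apply/seteqP; split=> // a _.
have Ssub : subspace (lspan A) := subspace_lspan _.
have SA v w : lspan A (tens T v w) by apply: sub_lspan; exists v => //; exists w.
pose b v w : subspace_type Ssub := Sub (tens T v w) (mem_set (SA v w)).
have b_lin : bilinear_for *:%R *:%R b.
  by split=> [w|v] c x y; apply: val_inj;
    rewrite linearP /= ?(tensDl, tensZl, tensDr, tensZr).
pose g : {linear T -> T} :=
  (val : {linear subspace_type Ssub -> T}) \o tlift T (bilinear_of b_lin).
have <- : g a = a.
  by apply: (tlift_unique g idfun) => v w; rewrite /g /= tliftE.
exact: subspace_typeP.
Qed.

Lemma tens_ind (S : set T) : subspace S -> (forall v w, S (tens T v w)) ->
  forall a, S a.
Proof.
move=> Ssub StT a; have: [set: T] a by []; rewrite -tens_span.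
by apply: lspan_min => // _ [v _ [w _ <-]].
Qed.

Lemma tactP c (a b : T) x : tact p (c *: a + b) x = c *: tact p a x + tact p b x.
Proof. exact: linearP. Qed.
Lemma tact0 x : tact p (0 : T) x = 0. Proof. exact: linear0. Qed.
Lemma tactZ c (a : T) x : tact p (c *: a) x = c *: tact p a x.
Proof. exact: linearZ. Qed.
Lemma tactB (a b : T) x : tact p (a - b) x = tact p a x - tact p b x.
Proof. exact: linearB. Qed.
Lemma tact_sum I (r : seq I) (P : pred I) (F : I -> T) x :
  tact p (\sum_(i <- r | P i) F i) x = \sum_(i <- r | P i) tact p (F i) x.
Proof. exact: linear_sum. Qed.

Lemma tact_mul (a b : T) x : tact p (tmul p a b) x = tact p a (tact p b x).
Proof.
apply: (tens_ind (S := [set b | tact p (tmul p a b) x =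
  tact p a (tact p b x)])) => [|v w] /=.
  split=> [|c b1 b2 /= h1 h2] /=; first by rewrite /tmul linear0 !tact0 linear0.
  by rewrite /tmul linearP !tactP -/(tmul p a b1) -/(tmul p a b2) h1 h2 linearP.
by rewrite /tmul tmapE !tactE linearZ.
Qed.

Lemma tact_bracket (a b : T) x :
  tact p (bracket p a b) x = tact p a (tact p b x) - tact p b (tact p a x).
Proof. by rewrite tactB !tact_mul. Qed.

(** Commutation is stated on the natural representation, which is faithful once a dual basis is at
    hand ([tact_inj]). *)
Definition commuting (a b : T) :=
  forall x, tact p a (tact p b x) = tact p b (tact p a x).

Lemma eigenvector_semisimple (a : T) (S : set V) :
  lspan S = setT -> (forall x, S x -> exists c, tact p a x = c *: x) ->
  semisimple p a.
Proof.
move=> ST SE; apply/seteqP; split=> // x _; have: [set: V] x by [].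
by rewrite -ST; apply: lspan_mono.
Qed.

Lemma semisimple_ind (a : T) (S : set V) : semisimple p a -> subspace S ->
  (forall c x, tact p a x = c *: x -> S x) -> forall x, S x.
Proof.
move=> ss Ssub SE x; have: [set: V] x by []; rewrite -ss.
by apply: lspan_min => // y [c]; exact: SE.
Qed.

End Tensors.

(** * Operators diagonal in a dual family *)

Section DualFamilyOperators.
Variables (C : numClosedFieldType) (V W : lmodType C) (p : pairing V W).
Variable T : tensor_product V W.

Section Family.
Variables (K : choiceType) (v : K -> V) (w : K -> W).
Hypothesis vw : dual_family p v w.

(** The index type is left open: besides [nat] it will be ['I_n], [option nat], [nzint] and a
    product with [bool]. *)
Definition diag_set : set T := lspan (range (fun k => tens T (v k) (w k))).

Lemma diag_setP a : diag_set a ->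
  exists r : seq K, exists2 c : K -> C, uniq r &
    a = \sum_(k <- r) c k *: tens T (v k) (w k).
Proof.
apply: (lspan_min (S := [set a | exists r : seq K, exists2 c : K -> C, uniq r &
  a = \sum_(k <- r) c k *: tens T (v k) (w k)])) => [|_ [k _ <-]]; last first.
  by exists [:: k], (fun=> 1); rewrite // big_seq1 scale1r.
split=> [|c _ _ [r [d ur ->]] [r' [d' ur' ->]]].
  by exists [::], (fun=> 0); rewrite ?big_nil.
pose g (s : seq K) (b : K -> C) k := if k \in s then b k else 0.
exists (undup (r ++ r')), (fun k => c * g r d k + g r' d' k).
  exact: undup_uniq.
have gE s b s' : uniq s -> uniq s' -> {subset s <= s'} ->
    \sum_(k <- s) b k *: tens T (v k) (w k) =
    \sum_(k <- s') g s b k *: tens T (v k) (w k).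
  move=> us us' ss'; rewrite [RHS](bigID (mem s)) /=.
  rewrite [X in _ = _ + X]big1 ?addr0 => [|k /negbTE ks]; last first.
    by rewrite /g ks scale0r.
  rewrite -[RHS]big_filter (perm_big (filter (mem s) s')) /=; last first.
    apply: uniq_perm => //; first exact: filter_uniq.
    move=> k; rewrite mem_filter /=; case: (boolP (k \in s)) => //= ks.
    by rewrite ss'.
  by rewrite !big_seq; apply: eq_bigr => k; rewrite mem_filter /g => /andP[/= ->].
rewrite (gE r d (undup (r ++ r'))) ?undup_uniq //; last first.
  by move=> k kr; rewrite mem_undup mem_cat kr.
rewrite (gE r' d' (undup (r ++ r'))) ?undup_uniq //; last first.
  by move=> k kr; rewrite mem_undup mem_cat kr orbT.
rewrite scaler_sumr -big_split; apply: eq_bigr => k _ /=.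
by rewrite scalerDl scalerA.
Qed.

Lemma tact_diag r (c : K -> C) x :
  tact p (\sum_(k <- r) c k *: tens T (v k) (w k)) x =
  \sum_(k <- r) (c k * p x (w k)) *: v k.
Proof.
by rewrite tact_sum; apply: eq_bigr => k _; rewrite tactZ tactE scalerA.
Qed.

(** A diagonal matrix coefficient, defined for every [a]; it is the eigenvalue at [v k] when [a] is
    in [diag_set]. *)
Definition weight (a : T) k := p (tact p a (v k)) (w k).

Lemma weight_diag r (c : K -> C) k : uniq r ->
  weight (\sum_(k <- r) c k *: tens T (v k) (w k)) k =
  if k \in r then c k else 0.
Proof.
move=> ur; rewrite /weight tact_diag p_suml; case: ifP => kr.
  rewrite (bigD1_seq k) //= big1 => [|j jk]; last first.
    by rewrite pZl vw eq_sym (negbTE jk) mulr0 mul0r.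
  by rewrite pZl vw eqxx !mulr1 addr0.
rewrite big_seq big1 // => j jr; rewrite pZl vw.
by have /negbTE -> : k != j; [apply: contraFneq kr => ->|rewrite mulr0 mul0r].
Qed.

Lemma diag_tact a : diag_set a -> exists2 r, uniq r & forall x,
  tact p a x = \sum_(k <- r) (weight a k * p x (w k)) *: v k.
Proof.
move=> /diag_setP[r [c ur aE]]; exists r => // x; rewrite {1}aE tact_diag.
by rewrite big_seq [RHS]big_seq; apply: eq_bigr => k kr; rewrite aE weight_diag ?kr.
Qed.

Lemma diag_eigenl a k : diag_set a -> tact p a (v k) = weight a k *: v k.
Proof.
move=> da; have [r ur aE] := diag_tact da.
have aw j : j != k -> p (v k) (w j) = 0.
  by move=> jk; rewrite vw eq_sym (negbTE jk).
case: (boolP (k \in r)) => kr.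
  rewrite aE (bigD1_seq k) //= big1 => [|j jk]; last by rewrite aw // mulr0 scale0r.
  by rewrite vw eqxx mulr1 addr0.
have E0 : tact p a (v k) = 0.
  rewrite aE big_seq big1 // => j jr; rewrite aw ?mulr0 ?scale0r //.
  by apply: contraNneq kr => <-.
by rewrite /weight E0 p0l scale0r.
Qed.

Lemma diag_eigenr a k x : diag_set a ->
  p (tact p a x) (w k) = weight a k * p x (w k).
Proof.
move=> da; have [r ur aE] := diag_tact da.
have aw j : j != k -> p (v j) (w k) = 0.
  by move=> jk; rewrite vw (negbTE jk).
case: (boolP (k \in r)) => kr.
  rewrite aE p_suml (bigD1_seq k) //= big1 => [|j jk].
    by rewrite pZl vw eqxx mulr1 addr0.
  by rewrite pZl aw // mulr0.
have E0 y : p (tact p a y) (w k) = 0.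
  rewrite aE p_suml big_seq big1 // => j jr; rewrite pZl aw ?mulr0 //.
  by apply: contraNneq kr => <-.
by rewrite /weight !E0 mul0r.
Qed.

Lemma diag_commuting a b : diag_set a -> diag_set b -> commuting p a b.
Proof.
move=> da db x; have [r _ ra] := diag_tact da.
have E (a1 b1 : T) r1 : diag_set b1 ->
    (forall x, tact p a1 x = \sum_(k <- r1) (weight a1 k * p x (w k)) *: v k) ->
    tact p a1 (tact p b1 x) =
    \sum_(k <- r1) (weight a1 k * weight b1 k * p x (w k)) *: v k.
  by move=> db1 ->; apply: eq_bigr => k _; rewrite diag_eigenr // mulrA.
have F (a1 b1 : T) r1 : diag_set b1 ->
    (forall x, tact p a1 x = \sum_(k <- r1) (weight a1 k * p x (w k)) *: v k) ->
    tact p b1 (tact p a1 x) =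
    \sum_(k <- r1) (weight a1 k * weight b1 k * p x (w k)) *: v k.
  move=> db1 ->; rewrite linear_sum; apply: eq_bigr => k _ /=.
  by rewrite linearZ /= diag_eigenl // scalerA mulrAC.
by rewrite (E a b r db ra) (F a b r db ra).
Qed.

(** Subtracting from [x] its components along the finitely many [v k] that occur in [a] leaves a
    vector killed by [a], that is, an eigenvector for 0. *)
Lemma diag_semisimple a : diag_set a -> semisimple p a.
Proof.
move=> da; have [r ur aE] := diag_tact da.
apply: (@eigenvector_semisimple _ _ _ _ _ _
  (range v `|` [set x | tact p a x = 0])) => [|x [[k _ <-]|/= ->]].
- apply/seteqP; split=> // x _.
  rewrite -(subrK (\sum_(k <- r) p x (w k) *: v k) x); apply: lspanD.
    apply: sub_lspan; right; rewrite /= linearB /= linear_sum /= aE.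
    rewrite -sumrB big1 // => k _.
    by rewrite linearZ /= diag_eigenl // scalerA mulrC subrr.
  by apply: lspan_sum => k _; apply: lspanZ; apply: sub_lspan; left; exists k.
- by exists (weight a k); rewrite diag_eigenl.
- by exists 0; rewrite scale0r.
Qed.

End Family.
Lemma diag_tact_ord n (v : 'I_n -> V) (w : 'I_n -> W) a x :
  dual_family p v w -> lspan (range (fun k => tens T (v k) (w k))) a ->
  tact p a x = \sum_(k < n) (weight v w a k * p x (w k)) *: v k.
Proof.
move=> vw /diag_setP[r [c ur aE]]; rewrite {1}aE tact_diag big_uniq //.
rewrite [RHS](bigID (mem r)) /= [X in _ = _ + X]big1 ?addr0 => [|k kr].
  by apply: eq_bigr => k kr; rewrite aE weight_diag // kr.
by rewrite aE weight_diag // (negbTE kr) mul0r scale0r.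
Qed.

End DualFamilyOperators.
Arguments diag_set {C V W} T {K} v w.

(** * Finite-rank operators as matrices, and their simultaneous diagonalization *)

Section Codiagonalization.
Variables (C : numClosedFieldType) (V W : lmodType C) (p : pairing V W).
Variable T : tensor_product V W.
Variables (e : nat -> V) (f : nat -> W).
Hypothesis ef : dual_basis p e f.

(** Stated for all large [n], so that finitely many expansions can be cut off at a common [n]. *)
Lemma basis_expandl v :
  exists N, forall n, (N <= n)%N -> v = \sum_(i < n) p v (f i) *: e i.
Proof.
have [ef_dual eT fT] := ef; have: lspan (range e) v by rewrite eT.
apply: (lspan_min (S := [set v | exists N, forall n, (N <= n)%N ->
  v = \sum_(i < n) p v (f i) *: e i])).
  split=> [|a x y [N xN] [M yM]].
    by exists 0 => n _; rewrite big1 // => i _; rewrite p0l scale0r.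
  exists (maxn N M) => n; rewrite geq_max => /andP[Nn Mn].
  rewrite {1}(xN n Nn) {1}(yM n Mn) scaler_sumr -big_split.
  by apply: eq_bigr => i _; rewrite /= !pE scalerDl scalerA.
move=> _ [k _ <-]; exists k.+1 => n kn.
rewrite (bigD1 (Ordinal kn)) //= ef_dual eqxx scale1r big1 ?addr0 // => i ik.
rewrite ef_dual (_ : k == i = false) ?scale0r //.
by apply: contraNF ik => /eqP ki; apply/eqP/val_inj.
Qed.

Lemma basis_expandr w :
  exists N, forall n, (N <= n)%N -> w = \sum_(i < n) p (e i) w *: f i.
Proof.
have [ef_dual eT fT] := ef; have: lspan (range f) w by rewrite fT.
apply: (lspan_min (S := [set w | exists N, forall n, (N <= n)%N ->
  w = \sum_(i < n) p (e i) w *: f i])).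
  split=> [|a x y [N xN] [M yM]].
    by exists 0 => n _; rewrite big1 // => i _; rewrite p0r scale0r.
  exists (maxn N M) => n; rewrite geq_max => /andP[Nn Mn].
  rewrite {1}(xN n Nn) {1}(yM n Mn) scaler_sumr -big_split.
  by apply: eq_bigr => i _; rewrite /= !pE scalerDl scalerA.
move=> _ [k _ <-]; exists k.+1 => n kn.
rewrite (bigD1 (Ordinal kn)) //= ef_dual eqxx scale1r big1 ?addr0 // => i ik.
rewrite ef_dual (_ : (i : nat) == k = false) ?scale0r //.
by apply: contraNF ik => /eqP ki; apply/eqP/val_inj.
Qed.

(** The transposed indices follow the row-vector convention: [B i j] is the coefficient of [e j] in
    the image of [e i], and coordinates are multiplied by [B] on the right. *)
Definition corner n (B : 'M[C]_n) : T :=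
  \sum_(i < n) \sum_(j < n) B i j *: tens T (e j) (f i).
Definition mxof n (a : T) : 'M[C]_n :=
  \matrix_(i < n, j < n) p (tact p a (e i)) (f j).

Lemma corner_ex a :
  exists N, forall n, (N <= n)%N -> a = corner (mxof n a).
Proof.
apply: (tens_ind (S := [set a | exists N, forall n, (N <= n)%N ->
  a = corner (mxof n a)])) => [|v w].
  split=> [|c a1 a2 [N aN] [M aM]].
    exists 0 => n _; rewrite /corner big1 // => i _; rewrite big1 // => j _.
    by rewrite mxE tact0 p0l scale0r.
  exists (maxn N M) => n; rewrite geq_max => /andP[Nn Mn].
  rewrite {1}(aN n Nn) {1}(aM n Mn) /corner scaler_sumr -big_split.
  apply: eq_bigr => i _ /=; rewrite scaler_sumr -big_split.
  apply: eq_bigr => j _ /=.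
  by rewrite !mxE tactP !pE scalerDl scalerA.
have [N vN] := basis_expandl v; have [M wM] := basis_expandr w.
exists (maxn N M) => n; rewrite geq_max => /andP[Nn Mn].
rewrite {1}(wM n Mn) tens_sumr; apply: eq_bigr => i _.
rewrite {1}(vN n Nn) tens_suml; apply: eq_bigr => j _.
by rewrite tensZl tensZr scalerA mxE tactE pZl mulrC.
Qed.

Definition coords n x : 'rV[C]_n := \row_(i < n) p x (f i).
Definition comb n (u : 'rV[C]_n) : V := \sum_(i < n) u 0 i *: e i.

Lemma tact_corner n (B : 'M_n) x : tact p (corner B) x = comb (coords n x *m B).
Proof.
rewrite /corner tact_sum; under eq_bigr do rewrite tact_sum.
rewrite exchange_big /comb; apply: eq_bigr => j _ /=.
rewrite mxE scaler_suml; apply: eq_bigr => i _.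
by rewrite tactZ tactE scalerA mxE mulrC.
Qed.

Lemma coords_comb n (u : 'rV_n) : coords n (comb u) = u.
Proof.
have [ef_dual _ _] := ef; apply/rowP => i; rewrite mxE p_suml (bigD1 i) //=.
rewrite pZl ef_dual eqxx mulr1 big1 ?addr0 // => j ji.
rewrite pZl ef_dual (_ : (j : nat) == i = false) ?mulr0 //.
by apply: contraNF ji => /eqP ij; apply/eqP/val_inj.
Qed.

Lemma coords_basis n (i : 'I_n) : coords n (e i) = delta_mx 0 i.
Proof.
by have [ef_dual _ _] := ef; apply/rowP => j; rewrite !mxE ef_dual eqxx eq_sym.
Qed.

(** Both tensors live in one finite corner, whose entries are read off from the action. *)
Lemma tact_inj (a b : T) : (forall x, tact p a x = tact p b x) -> a = b.
Proof.
move=> ab; have [N aN] := corner_ex a; have [M bM] := corner_ex b.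
rewrite (aN (maxn N M)) ?leq_maxl // (bM (maxn N M)) ?leq_maxr //.
by congr corner; apply/matrixP => i j; rewrite !mxE ab.
Qed.

Lemma corner_seq (s : seq T) :
  exists n, {in s, forall a, a = corner (mxof n a)}.
Proof.
suff [N sN] : exists N, forall n, (N <= n)%N ->
    {in s, forall a, a = corner (mxof n a)}.
  by exists N; exact: sN.
elim: s => [|a s [N sN]]; first by exists 0.
have [M aM] := corner_ex a; exists (maxn N M) => n.
rewrite geq_max => /andP[Nn Mn] b; rewrite in_cons => /predU1P[->|].
  exact: aM.
exact: sN.
Qed.

Lemma mxof_comm n a b : a = corner (mxof n a) -> b = corner (mxof n b) ->
  commuting p a b -> comm_mx (mxof n a) (mxof n b).
Proof.
move=> aE bE ab; apply/row_matrixP => i.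
have := ab (e i); rewrite {1}aE {1}bE {2}aE {2}bE !tact_corner !coords_comb.
move=> /(congr1 (coords n)); rewrite !coords_comb coords_basis -!rowE.
by rewrite -!row_mul => ->.
Qed.

Lemma coordsZ n c x : coords n (c *: x) = c *: coords n x.
Proof. by apply/rowP => i; rewrite !mxE pZl. Qed.

Lemma coordsP n c x y : coords n (c *: x + y) = c *: coords n x + coords n y.
Proof. by apply/rowP => i; rewrite !mxE pDl pZl. Qed.

(** Truncated coordinates of an eigenvector of [a] are 0 or an eigenvector of the matrix for the
    same eigenvalue. As the eigenvectors span [V], the eigenspaces at the roots of the
    characteristic polynomial exhaust the row space. *)
Lemma mxof_diagonalizable n a : a = corner (mxof n a) -> semisimple p a ->
  diagonalizable (mxof n a).
Proof.
move=> aE ass; set A := mxof n a; apply/diagonalizablePeigen.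
have [rs rsP] := closed_field_poly_normal (char_poly A).
exists (undup rs); first exact: undup_uniq.
set E := (\sum_(r <- _) _)%MS; apply/eqmxP; rewrite submx1 /=.
have xE x : (coords n x <= E)%MS.
  apply: (semisimple_ind (S := [set x | (coords n x <= E)%MS]) ass) => /= [|c y].
    split=> [|c y z /= yE zE] /=.
      rewrite (_ : coords n 0 = 0) ?sub0mx //.
      by apply/rowP => i; rewrite !mxE p0l.
    by rewrite coordsP addmx_sub // scalemx_sub.
  move=> /(congr1 (coords n)); rewrite {1}aE tact_corner coords_comb coordsZ -/A.
  move=> yA; have [->|y0] := eqVneq (coords n y) 0; first exact: sub0mx.
  have cA : eigenvalue A c by apply/eigenvalueP; exists (coords n y).
  have crs : c \in undup rs.
    move: cA; rewrite mem_undup eigenvalue_root_char rsP.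
    by rewrite (monicP (char_poly_monic A)) scale1r root_prod_XsubC.
  rewrite /E (bigD1_seq c) ?undup_uniq //=.
  apply: submx_trans (addsmxSl _ _); exact/eigenspaceP.
apply/row_subP => i; rewrite rowE mulmx1 -coords_basis; exact: xE.
Qed.

(** Finitely many tensors fit in one corner, where the statement is simultaneous diagonalization of
    commuting diagonalizable matrices. *)
Lemma codiag (s : seq T) : {in s, forall a, semisimple p a} ->
  {in s &, forall a b, commuting p a b} ->
  exists n (v : 'I_n -> V) (w : 'I_n -> W),
    dual_family p v w /\ {in s, forall a, diag_set T v w a}.
Proof.
move=> ss sc; have [n sE] := corner_seq s.
have : codiagonalizable [seq mxof n a | a <- s].
  apply/codiagonalizableP; split=> [A B|A] /mapP[a a_s ->].
    by move=> /mapP[b b_s ->]; apply: mxof_comm; auto.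
  by apply: mxof_diagonalizable; auto.
move=> [P Pu /allP Pdiag].
(* The rows of [P] are the common eigenvectors, and the columns of its inverse are the dual
   functionals. *)
pose v i := comb (row i P); pose w i := \sum_(j < n) (invmx P) j i *: f j.
have [ef_dual _ _] := ef.
have vw : dual_family p v w.
  move=> i j; rewrite p_sumr.
  transitivity ((P *m invmx P) i j); last by rewrite mulmxV // mxE.
  rewrite mxE; apply: eq_bigr => k _; rewrite pZr mulrC; congr (_ * _).
  have /rowP/(_ k) := coords_comb (row i P).
  by rewrite !mxE.
exists n, v, w; split=> // a a_s.
have /(diagonalizable_forLR Pu)[d aP] := Pdiag _ (map_f (mxof n) a_s).
rewrite mxpoly.conjVmx // in aP.
suff -> : a = \sum_(k < n) d 0 k *: tens T (v k) (w k).
  by apply: lspan_sum => k _; apply: lspanZ; apply: sub_lspan; exists k.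
rewrite {1}(sE _ a_s) /corner; apply/esym.
under eq_bigr => k _ do rewrite tens_sumr scaler_sumr.
rewrite exchange_big; apply: eq_bigr => i _ /=.
under eq_bigr => k _ do rewrite tens_suml scaler_sumr.
rewrite exchange_big; apply: eq_bigr => j _ /=.
rewrite aP mxE scaler_suml; apply: eq_bigr => k _.
rewrite tensZr tensZl !scalerA mul_mx_diag !mxE mulrA; congr (_ * _ *: _).
exact: mulrC.
Qed.

Lemma semisimpleP c (a b : T) : semisimple p a -> semisimple p b ->
  commuting p a b -> semisimple p (c *: a + b).
Proof.
move=> ass bss ab.
have [] := @codiag [:: a; b].
- by move=> x; rewrite !inE => /orP[]/eqP ->.
- by move=> x y; rewrite !inE => /orP[]/eqP -> /orP[]/eqP -> //= z; rewrite ab.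
move=> n [v [w [vw sd]]]; apply: (diag_semisimple vw).
by apply: lspanP; apply: sd; rewrite !inE eqxx ?orbT.
Qed.

End Codiagonalization.

(** * Commutativity of toral subalgebras and joint eigenvectors *)

Section Toral.
Variables (C : numClosedFieldType) (V W : lmodType C) (p : pairing V W).
Variable T : tensor_product V W.
Variables (e : nat -> V) (f : nat -> W).
Hypothesis ef : dual_basis p e f.
Implicit Types a b : T.

Lemma semisimple_diag a : semisimple p a ->
  exists n (v : 'I_n -> V) (w : 'I_n -> W),
    dual_family p v w /\ diag_set T v w a.
Proof.
move=> ass; have [] := @codiag _ _ _ _ T _ _ ef [:: a].
- by move=> x; rewrite inE => /eqP ->.
- by move=> x y; rewrite !inE => /eqP -> /eqP -> z.
move=> n [v [w [vw ad]]]; exists n, v, w; split=> //.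
by apply: ad; rewrite inE eqxx.
Qed.

(** There is no Jordan block: [(a - c)^2 u = 0] forces [(a - c) u = 0]. As [c] is nonzero, [z] lies
    in the image of [a] and vanishes with its coordinates [p z (w k)]. *)
Lemma semisimple_eigen_sqr a c u : semisimple p a -> c != 0 ->
  let z := tact p a u - c *: u in tact p a z = c *: z -> z = 0.
Proof.
move=> /semisimple_diag[n [v [w [vw da]]]] c0 z zE.
have [r ur aE] := diag_tact vw da.
have zw k : p z (w k) = 0.
  have zwE : p z (w k) = (weight p v w a k - c) * p u (w k).
    by rewrite /z !pE (diag_eigenr vw) // mulrBl.
  have := diag_eigenr vw k z da; rewrite zE pZl => /eqP.
  rewrite eq_sym -subr_eq0 -mulrBl zwE mulrA mulf_eq0 => /orP[|/eqP ->].
    by rewrite mulf_eq0 orbb => /eqP ->; rewrite mul0r.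
  by rewrite mulr0.
apply/eqP; have /eqP := zE; rewrite aE big1 => [|k _]; last first.
  by rewrite zw mulr0 scale0r.
by rewrite eq_sym scaler_eq0 (negbTE c0).
Qed.

(** Let [y z = c z] with [c] nonzero. The relation gives [(y - c)(a z) = - d c z], which is killed
    by [y - c]; semisimplicity of [y] makes it 0, so [z = 0]. *)
Lemma ad_eigen_semisimple a (y : T) d : semisimple p y -> d != 0 ->
  (forall x, tact p a (tact p y x) - tact p y (tact p a x) = d *: tact p y x) ->
  y = 0.
Proof.
move=> yss d0 ay; apply: (tact_inj ef) => x; rewrite tact0.
apply: (semisimple_ind (S := [set x | tact p y x = 0]) yss) => [|c z /= zE].
  by split=> [|b u u' /= uE u'E] /=; rewrite ?linear0 // linearP /= uE u'E scaler0 addr0.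
have [c00|c0] := eqVneq c 0; first by rewrite zE c00 scale0r.
have E : tact p y (tact p a z) - c *: tact p a z = (- (d * c)) *: z.
  rewrite scaleNr -scalerA -zE -ay opprB; congr (_ - _).
  by rewrite zE linearZ.
have := semisimple_eigen_sqr (u := tact p a z) yss c0; rewrite /= E.
rewrite linearZ /= zE !scalerA mulrC => /(_ erefl)/eqP.
by rewrite scaler_eq0 oppr_eq0 mulf_eq0 (negbTE d0) (negbTE c0) => /eqP ->;
  rewrite scaler0.
Qed.

Lemma semisimple_spectrum a : semisimple p a ->
  exists s : seq C, forall c u, tact p a u = c *: u -> u = 0 \/ c \in s.
Proof.
move=> /semisimple_diag[n [v [w [vw da]]]].
exists (0 :: [seq weight p v w a k | k <- enum 'I_n]) => c u uE.
have [|cs] := boolP (c \in _); [by right|left].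
move: cs; rewrite in_cons negb_or => /andP[c0 cs].
have [r ur aE] := diag_tact vw da; apply/eqP.
have /eqP := uE; rewrite aE big1 => [|k _].
  by rewrite eq_sym scaler_eq0 (negbTE c0).
have := diag_eigenr vw k u da; rewrite uE pZl => /eqP.
rewrite -subr_eq0 -mulrBl mulf_eq0 subr_eq0 => /orP[/eqP cE|/eqP ->].
  by case/negP: cs; rewrite cE map_f // mem_enum.
by rewrite mulr0 scale0r.
Qed.

(* On [t], the operator [ad a] is diagonalizable with eigenvalues among the
   differences of eigenvalues of [a], and has no nonzero eigenvalue. *)
Lemma toral_commuting g t a b : toral p g t -> t a -> t b -> commuting p a b.
Proof.
move=> [[tsub _ tbr] tss] ta tb.
have [s sP] := semisimple_spectrum (tss _ ta).
pose l := [seq d <- [seq q - r | q <- s, r <- s] | d != 0].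
(* [adp d] is [ad a - d]. Evaluated at an [r]-eigenvector of [a], it acts on the value of [y] as
   [op r d], that is, as [a - r - d]. *)
pose adp d (y : T) := bracket p a y - d *: y.
pose op r d z := tact p a z - (r + d) *: z.
have adpE r d y z : tact p a z = r *: z ->
    tact p (adp d y) z = op r d (tact p y z).
  move=> zE; rewrite tactB tactZ tact_bracket zE linearZ /=.
  by rewrite /op scalerDl opprD addrA.
have foldE r m y z : tact p a z = r *: z ->
    tact p (foldr adp y m) z = foldr (op r) (tact p y z) m.
  by move=> zE; elim: m => //= d m IH; rewrite (adpE r) // IH.
have fold_lin r m c z z' : foldr (op r) (c *: z + z') m =
    c *: foldr (op r) z m + foldr (op r) z' m.
  elim: m => //= d m ->; rewrite /op linearP /= !scalerBr !scalerDr !scalerA.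
  by rewrite opprD addrACA [in RHS]mulrC.
have fold0 r m : foldr (op r) 0 m = 0.
  by have := fold_lin r m 1 0 0; rewrite !scale1r !addr0 => /eqP;
    rewrite eq_sym -subr_eq0 addrK => /eqP.
have fold_eigen r m z q : tact p a z = q *: z -> q - r \in m ->
    foldr (op r) z m = 0.
  move=> zE; elim: m => //= d m IH; rewrite in_cons => /orP[/eqP <-|/IH ->].
    have -> : foldr (op r) z m = \prod_(c <- m) (q - r - c) *: z.
      elim: m {IH} => [|c m IH] /=; first by rewrite big_nil scale1r.
      rewrite IH big_cons /op linearZ /= zE !scalerA -scalerBl; congr (_ *: _).
      by ring.
    rewrite /op linearZ /= zE !scalerA -scalerBl.
    rewrite (_ : _ - _ = 0) ?scale0r //.
    by ring.
  by rewrite /op linear0 scaler0 subrr.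
(* At an [r]-eigenvector [z] of [a] the bracket takes the value [(a - r)(b z)]. Split [b z] into
   eigenvectors: a [q]-component dies under [a - r] if [q = r], and otherwise under the factor with
   [d = q - r]. *)
have main : foldr adp (bracket p a b) l = 0.
  apply: (tact_inj ef) => x; rewrite tact0.
  apply: (semisimple_ind (S := [set x |
    tact p (foldr adp (bracket p a b) l) x = 0]) (tss _ ta)) => [|r z zE] /=.
    by split=> [|c u u' /= uE u'E] /=;
      rewrite ?linear0 // linearP /= uE u'E scaler0 addr0.
  rewrite (foldE r) // tact_bracket zE [tact p b (r *: z)]linearZ /=.
  have [->|rs] := sP _ _ zE.
    by rewrite !(linear0, scaler0, subr0, addr0) fold0.
  move: (tact p b z).
  apply: (semisimple_ind (S := [set y |
    foldr (op r) (tact p a y - r *: y) l = 0]) (tss _ ta)) => [|q y yE] /=.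
    split=> [|c u u' /= uE u'E] /=.
      by rewrite !(linear0, scaler0, subr0, addr0) fold0.
    rewrite linearP /= (_ : _ - _ = c *: (tact p a u - r *: u) +
      (tact p a u' - r *: u')); first by rewrite fold_lin uE u'E scaler0 addr0.
    by rewrite scalerDr scalerBr !scalerA opprD addrACA [r * c]mulrC.
  have [->|qs] := sP _ _ yE; first by rewrite !(linear0, scaler0, subr0, addr0) fold0.
  rewrite yE -scalerBl -[_ *: y]addr0 fold_lin fold0 addr0.
  have [->|qr] := eqVneq q r; first by rewrite subrr scale0r.
  rewrite (fold_eigen r l y q) ?scaler0 // mem_filter subr_eq0 qr /=.
  by apply/allpairsP; exists (q, r).
have tad d y : t y -> t (adp d y).
  by move=> ty; apply: (subspaceB tsub); [exact: tbr|exact: subspaceZ].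
have tfold m y : t y -> t (foldr adp y m).
  by move=> ty; elim: m => //= d m; exact: tad.
(* The factors can be stripped off one by one: an element of [t] killed by [ad a - d] with [d]
   nonzero is 0 by [ad_eigen_semisimple]. *)
have fold_inj m y : {in m, forall d, d != 0} -> t y -> foldr adp y m = 0 -> y = 0.
  move=> + ty; elim: m => //= d m IH dm /eqP; rewrite subr_eq0 => /eqP E.
  apply: IH => [c cm|]; first by apply: dm; rewrite in_cons cm orbT.
  apply: (ad_eigen_semisimple (a := a) (d := d)).
  - exact/tss/tfold.
  - by apply: dm; rewrite in_cons eqxx.
  - by move=> x; rewrite -tact_bracket E tactZ.
have ab0 : bracket p a b = 0.
  apply: fold_inj main; last exact: tbr.
  by move=> d; rewrite mem_filter => /andP[].
by move=> x; apply/eqP; rewrite -subr_eq0 -tact_bracket ab0 tact0.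
Qed.

(** Otherwise vectors outside the current span could be adjoined forever, against the dimension of
    [U]. The generators are kept as elements of [I]: below, operators are needed and not only their
    matrices. *)
Lemma finite_span (U : vectType C) (I : Type) (P : I -> Prop) (g : I -> U) :
  exists s : seq I, (forall n, (n < size s)%N -> forall x0, P (nth x0 s n)) /\
    forall x x0, P x -> exists c : nat -> C,
      g x = \sum_(i < size s) c i *: g (nth x0 s i).
Proof.
suff [s [sP sE]] : exists s : seq I,
    (forall n, (n < size s)%N -> forall x0, P (nth x0 s n)) /\
    forall x, P x -> g x \in <<[seq g y | y <- s]>>%VS.
  exists s; split=> // x x0 /sE gx.
  pose X := in_tuple [seq g y | y <- s].
  pose c j := if insub j is Some i then coord X i (g x) else 0.
  exists c.
  rewrite {1}(coord_span (X := X) gx) /=.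
  rewrite -(big_mkord xpredT (fun i => c i *: g (nth x0 s i))) -(size_map g s).
  rewrite big_mkord; apply: eq_bigr => i _; rewrite /c valK; congr (_ *: _).
  by rewrite (nth_map x0) // -(size_map g s).
apply: contrapT => /forallNP no.
have step n : exists s : seq I,
    (forall n, (n < size s)%N -> forall x0, P (nth x0 s n)) /\
    (n <= \dim <<[seq g y | y <- s]>>)%N.
  elim: n => [|n [s [sP sn]]]; first by exists [::].
  have /not_andP[//|/existsNP[x /not_implyP[Px /negP gx]]] := no s.
  exists (x :: s); split=> [[|i] //= /sP //|].
  rewrite /= span_cons; apply: leq_ltn_trans sn _.
  rewrite ltn_neqAle dimvS ?addvSr // andbT.
  apply: contra gx => /eqP E.
  have <- : (<[g x]> + <<[seq g y | y <- s]>> = <<[seq g y | y <- s]>>)%VS.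
    by apply/esym/eqP; rewrite eqEdim addvSr E leqnn.
  by apply: (subvP (addvSl _ _)); exact: memv_line.
have [s [_]] := step (\dim {:U}).+1.
by rewrite ltnNge dimvS // subvf.
Qed.

(** [t] may be infinite-dimensional, but its compressions to a finite dual family diagonalizing [a]
    span a finite-dimensional space. Diagonalizing [a] together with finitely many elements that
    span these compressions is enough: every [b] in [t] agrees with a combination of them on the
    image of [a]. *)
Lemma joint_eigenvectors (t : set T) a :
  (forall b, t b -> semisimple p b) ->
  (forall b b', t b -> t b' -> commuting p b b') ->
  semisimple p a -> (forall b, t b -> commuting p a b) ->
  exists n (v : 'I_n -> V) (w : 'I_n -> W),
    [/\ dual_family p v w, diag_set T v w a &
      forall k, weight p v w a k != 0 -> forall b, t b -> exists c,
        tact p b (v k) = c *: v k /\ forall x, p (tact p b x) (w k) = c * p x (w k)].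
Proof.
move=> tss tc ass ac.
have [n0 [v0 [w0 [vw0 da0]]]] := semisimple_diag ass.
pose beta b : 'M[C]_n0 := \matrix_(i, j) p (tact p b (v0 i)) (w0 j).
have [bs [bst bsP]] := finite_span t beta.
have {}bst b : b \in bs -> t b by move=> /(nthP b)[i ib <-]; exact: bst.
have [] := @codiag _ _ _ _ T _ _ ef (a :: bs).
- by move=> b; rewrite in_cons => /orP[/eqP ->|/bst/tss].
- move=> b b'; rewrite !in_cons => /orP[/eqP ->|bb] /orP[/eqP ->|bb'] //=.
  + exact/ac/bst.
  + by move=> x; rewrite (ac _ (bst _ bb)).
  + by apply: tc; exact: bst.
move=> n [v [w [vw sd]]]; exists n, v, w.
have da : diag_set T v w a by apply: sd; rewrite in_cons eqxx.
split=> // k wk b tb.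
have [x xE] := bsP b 0 tb.
pose B := \sum_(i < size bs) x i *: bs`_i.
have dB : diag_set T v w B.
  apply: lspan_sum => i _; apply: lspanZ; apply: sd.
  by rewrite in_cons mem_nth ?orbT.
have aB : commuting p a B.
  exact: diag_commuting vw _ _ da dB.
pose d := b - B.
have ad : commuting p a d.
  by move=> y; rewrite !tactB linearB /= ac // aB.
have d0 i j : p (tact p d (v0 i)) (w0 j) = 0.
  have /matrixP/(_ i j) := xE; rewrite !mxE summxE => E.
  rewrite tactB pBl E tact_sum p_suml -sumrB big1 // => l _.
  by rewrite !mxE tactZ pZl subrr.
have [r ur aE] := diag_tact vw0 da0.
(* [d] has zero compression and commutes with [a], hence [a d = 0]: so [b] and [B] agree on
   eigenvectors of [a] with nonzero eigenvalue, and likewise for the functionals. *)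
have ad0 y : tact p a (tact p d y) = 0.
  rewrite aE big1 // => i _.
  have [->|wi] := eqVneq (weight p v0 w0 a i) 0; first by rewrite mul0r scale0r.
  rewrite -(diag_eigenr vw0) // ad aE linear_sum p_suml big1 ?scale0r // => j _.
  by rewrite linearZ /= pZl d0 mulr0.
have dE y : tact p b y = tact p B y + tact p d y by rewrite tactB addrC subrK.
exists (weight p v w B k); split=> [|y].
  have vE : v k = (weight p v w a k)^-1 *: tact p a (v k).
    by rewrite (diag_eigenl vw) // scalerA mulVf // scale1r.
  by rewrite dE (diag_eigenl vw) // {2}vE linearZ /= -ad ad0 scaler0 addr0.
apply: (mulfI wk); rewrite -(diag_eigenr vw) // dE linearD /= ad0 addr0.
by rewrite (diag_eigenr vw) // (diag_eigenr vw).
Qed.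

End Toral.

Section SubtractDiagonal.
Variables (C : numClosedFieldType) (V W : lmodType C) (p : pairing V W).
Variable T : tensor_product V W.

Lemma subspace_commuting (a : T) : subspace [set b | commuting p a b].
Proof.
split=> [x|c b b' ab ab' x]; first by rewrite !tact0 linear0.
by rewrite !tactP linearP /= ab ab'.
Qed.

Lemma commuting_sym (a b : T) : commuting p a b -> commuting p b a.
Proof. by move=> ab x; rewrite ab. Qed.

Lemma commuting_tens (b : T) v w c : tact p b v = c *: v ->
  (forall x, p (tact p b x) w = c * p x w) -> commuting p b (tens T v w).
Proof.
by move=> bv bw x; rewrite !tactE linearZ /= bv bw !scalerA mulrC.
Qed.

Lemma dual_seq_diag (s : seq (V * W)) : dual_seq p s ->
  exists (v : 'I_(size s) -> V) (w : 'I_(size s) -> W), dual_family p v w /\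
    forall x, x \in s -> diag_set T v w (tens T x.1 x.2).
Proof.
move=> ds; exists (fun i => (nth 0 s i).1), (fun i => (nth 0 s i).2).
split=> [i j|x /(nthP 0)[i si <-]]; first by rewrite (dual_seq_nth _ ds).
by apply: sub_lspan; exists (Ordinal si).
Qed.

Definition tens_lspan (s : seq (V * W)) : set T :=
  lspan [set a | exists2 x, x \in s & a = tens T x.1 x.2].

Lemma tens_lspan_sub s s' : {subset s <= s'} -> tens_lspan s `<=` tens_lspan s'.
Proof. by move=> ss'; apply: lspan_mono => _ [x /ss' xs ->]; exists x. Qed.

Lemma tens_lspan_semisimple s a : dual_seq p s -> tens_lspan s a -> semisimple p a.
Proof.
move=> /dual_seq_diag[v [w [vw sd]]] sa; apply: (diag_semisimple vw).
apply: lspan_min sa; first exact: subspace_lspan.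
by move=> _ [x xs ->]; exact: sd.
Qed.

End SubtractDiagonal.
Arguments tens_lspan {C V W} T s.

(** * Absorbing a commuting space of semisimple elements into one torus *)

Section ToralInDiagonal.
Variables (C : numClosedFieldType) (V W : lmodType C) (p : pairing V W).
Variable T : tensor_product V W.
Hypothesis p_nondeg : nondegenerate_pairing p.
Variables (e : nat -> V) (f : nat -> W).
Hypothesis ef : dual_basis p e f.

Lemma dual_basis_independent : independent e.
Proof.
have [ef_dual _ _] := ef; move=> n c c0 i.
have := congr1 (fun x => p x (f i)) c0; rewrite p0l p_suml (bigD1 i) //=.
rewrite pZl ef_dual eqxx mulr1 big1 ?addr0 // => j ji.
rewrite pZl ef_dual (_ : (j : nat) == i = false) ?mulr0 //.
by apply: contraNF ji => /eqP ij; apply/eqP/val_inj.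
Qed.

Lemma tensor_countable : countable_dim T.
Proof.
exists (fun n => if unpickle n is Some ij then tens T (e ij.1) (f ij.2) else 0).
apply/seteqP; split=> // a _.
have [N aN] := corner_ex ef a; rewrite (aN N) //.
apply: lspan_sum => i _; apply: lspan_sum => j _; apply: lspanZ.
by apply: sub_lspan; exists (pickle (val j, val i)); rewrite // pickleK.
Qed.

Variable t : set T.
Hypotheses (tsub : subspace t) (tss : forall b, t b -> semisimple p b).
Hypothesis tc : forall b b', t b -> t b' -> commuting p b b'.

(** The second condition makes [x.2] an eigenvector of the transpose of [b], for the same
    eigenvalue. *)
Definition joint_pair (x : V * W) := forall b, t b -> exists c,
  tact p b x.1 = c *: x.1 /\ forall y, p (tact p b y) x.2 = c * p y x.2.

Definition joint_seq (s : seq (V * W)) :=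
  dual_seq p s /\ forall x, x \in s -> joint_pair x.

(** Subtract from [a] its diagonal part [b] along [s]. The remainder [d] is semisimple, commutes
    with [t] and vanishes on the pairs of [s] from both sides. Its joint eigenvectors of nonzero
    weight are therefore orthogonal to [s] and can be appended. *)
Lemma joint_seq_absorb s a : joint_seq s -> t a ->
  exists s', joint_seq (s ++ s') /\ tens_lspan T (s ++ s') a.
Proof.
move=> [ds js] ta.
pose b := \sum_(x <- s) p (tact p a x.1) x.2 *: tens T x.1 x.2.
have bs : tens_lspan T s b.
  apply: (subspace_sum_seq (subspace_lspan _)) => x xs; apply: lspanZ.
  by apply: sub_lspan; exists x.
have bc b' : t b' -> commuting p b' b.
  move=> tb'; apply: (subspace_sum_seq (subspace_commuting p b')) => x xs.
  apply: (subspaceZ (subspace_commuting p b')).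
  have [c [h1 h2]] := js x xs b' tb'; exact: (commuting_tens h1 h2).
have bss := tens_lspan_semisimple ds bs.
pose d := a - b.
have dss : semisimple p d.
  rewrite /d addrC -scaleN1r; apply: (semisimpleP ef) => //; first exact: tss.
  by apply: commuting_sym; exact: bc.
have dc b' : t b' -> commuting p d b'.
  move=> tb'; apply: commuting_sym; apply: (subspaceB (subspace_commuting p b')).
    exact: tc.
  exact: bc.
have sd x : x \in s -> tact p d x.1 = 0 /\ forall y, p (tact p d y) x.2 = 0.
  move=> xs; have [c [ax1 ax2]] := js x xs a ta.
  have x12 : p x.1 x.2 = 1 by rewrite (dual_seq_mem ds) // eqxx.
  have cE : p (tact p a x.1) x.2 = c by rewrite ax1 pZl x12 mulr1.
  split=> [|y]; rewrite tactB tact_sum.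
    rewrite (bigD1_seq x) ?(dual_seq_uniq ds) //= big1_seq ?addr0.
      by rewrite tactZ tactE x12 scale1r cE ax1 subrr.
    move=> y /andP[yx ys]; rewrite tactZ tactE (dual_seq_mem ds) // eq_sym.
    by rewrite (negbTE yx) scale0r scaler0.
  rewrite pBl p_suml (bigD1_seq x) ?(dual_seq_uniq ds) //= big1_seq ?addr0.
    by rewrite tactZ tactE !pZl x12 mulr1 cE ax2 subrr.
  move=> z /andP[zx zs]; rewrite tactZ tactE !pZl (dual_seq_mem ds zs xs).
  by rewrite (negbTE zx) !mulr0.
have [n [v [w [vw dd jd]]]] := joint_eigenvectors ef tss tc dss dc.
pose nz k := weight p v w d k != 0.
exists [seq (v k, w k) | k <- enum 'I_n & nz k]; split; first split.
- rewrite dual_seq_cat ds /=; apply/andP; split.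
    rewrite /dual_seq all_map pairwise_map; apply/andP; split.
      by apply/allP => k _; rewrite /= /dual_pair vw eqxx.
    have : uniq [seq k <- enum 'I_n | nz k] by rewrite filter_uniq ?enum_uniq.
    rewrite uniq_pairwise; apply: sub_pairwise => i j /= ij.
    by rewrite /orthogonal_pairs /= !vw [j == i]eq_sym (negbTE ij) eqxx.
  apply/allrelP => x y xs /mapP[k]; rewrite mem_filter => /andP[wk _] ->.
  rewrite /orthogonal_pairs /=; have [dx1 dx2] := sd x xs; apply/andP; split.
    have := diag_eigenr vw k x.1 dd; rewrite dx1 p0l => /esym/eqP.
    by rewrite mulf_eq0 (negbTE wk).
  have := dx2 (v k); rewrite (diag_eigenl vw) // pZl => /eqP.
  by rewrite mulf_eq0 (negbTE wk).
- move=> x; rewrite mem_cat => /orP[/js //|/mapP[k]].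
  by rewrite mem_filter => /andP[wk _] -> b' tb'; exact: jd.
- rewrite -[a](subrK b); apply: lspanD; last first.
    by apply: tens_lspan_sub bs => x xs; rewrite mem_cat xs.
  have [r [c ur dE]] := diag_setP dd; rewrite -/d dE.
  apply: (subspace_sum_seq (subspace_lspan _)) => k kr.
  have [wk0|wk] := eqVneq (weight p v w d k) 0.
    move: wk0; rewrite dE (weight_diag T vw) // kr => ->.
    by rewrite scale0r; exact: lspan0.
  apply: lspanZ; apply: sub_lspan; exists (v k, w k) => //.
  by rewrite mem_cat map_f ?orbT // mem_filter /nz wk mem_enum.
Qed.

(** The family must become infinite even when [t] is finite-dimensional. Once [t] is contained in
    the span of the tensors of [s], any dual pair orthogonal to [s] is killed by [t]; before that,
    absorbing an element outside the span adds a pair. *)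
Lemma joint_seq_grow s : joint_seq s -> exists x, joint_seq (rcons s x).
Proof.
move=> jss; have [ds js] := jss.
have [ts|/existsNP[a /not_implyP[ta na]]] := pselect (t `<=` tens_lspan T s).
  have [x [dx _]] := dual_seq_extend_left p_nondeg 0 dual_basis_independent ds.
  exists x; split=> // y; rewrite mem_rcons in_cons => /orP[/eqP ->|/js //].
  move=> b /ts sb; exists 0; rewrite scale0r.
  move: dx; rewrite dual_seq_rcons => /and3P[_ _ /allP sx].
  have : tact p b x.1 = 0 /\ forall y, p (tact p b y) x.2 = 0.
    apply: (lspan_min (S := [set b | tact p b x.1 = 0 /\
        forall y, p (tact p b y) x.2 = 0])) sb => [|_ [z zs ->]].
      split=> [|c b1 b2 [h1 h1'] [h2 h2']].
        by split=> [|y']; rewrite tact0 ?p0l.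
      split=> [|y']; rewrite tactP ?h1 ?h2 ?scaler0 ?addr0 //.
      by rewrite pDl pZl h1' h2' mulr0 addr0.
    have /andP[/eqP zx /eqP xz] := sx _ zs.
    by split=> [|y']; rewrite tactE ?xz ?scale0r // pZl zx mulr0.
  by move=> [-> h]; split=> // y'; rewrite h mul0r.
have [[|x s'] [[ds' js'] sa]] := joint_seq_absorb jss ta.
  by case: na; rewrite cats0 in sa.
exists x; split=> [|y ys].
  by move: ds'; rewrite -cat_rcons dual_seq_cat => /and3P[].
by apply: js'; rewrite -cat_rcons mem_cat ys.
Qed.

Lemma commuting_semisimple_diag :
  exists v w, dual_family p v w /\ t `<=` diag_set T (v : nat -> V) w.
Proof.
have [a [ta tE]] := subspace_countable tensor_countable tsub.
have [] := @sequence_by_stages _ joint_seq (fun k s => tens_lspan T s (a k)).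
- by split.
- move=> k s jss; have [s' [js' sa]] := joint_seq_absorb jss (ta k).
  have [x jx] := joint_seq_grow js'.
  exists (rcons s' x); rewrite size_rcons -rcons_cat; split=> //.
  by apply: tens_lspan_sub sa => y ys; rewrite mem_rcons in_cons ys orbT.
move=> u uP; exists (fun i => (u i).1), (fun i => (u i).2); split.
  by apply: dual_seq_limit => k; have [n [? []]] := uP k; exists n.
rewrite tE; apply: lspan_min; first exact: subspace_lspan.
move=> _ [k _ <-]; have [n [_ _]] := uP k.
by apply: lspan_mono => _ [_ /mapP[j _ ->] ->]; exists j.
Qed.

End ToralInDiagonal.

Section HalfSpace.
Variable C : numClosedFieldType.

(* A choice of one number in each pair of opposite nonzero numbers. *)
Definition chosen_sign (c : C) := choose (pred2 c (- c)) c == c.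

Lemma choose_opp (c : C) :
  choose (pred2 (- c) (- - c)) (- c) = choose (pred2 c (- c)) c.
Proof.
rewrite [RHS](choose_id (y0 := - c)) /= ?eqxx ?orbT //.
by apply: eq_choose => x; rewrite /= opprK orbC.
Qed.

Lemma chosen_signP (c : C) : chosen_sign c || chosen_sign (- c).
Proof.
have := chooseP (P := pred2 c (- c)) (x0 := c).
rewrite /chosen_sign choose_opp /= eqxx => /(_ isT) /orP[-> //|->].
by rewrite orbT.
Qed.

Lemma chosen_sign_opp (c : C) : c != 0 -> chosen_sign c -> ~~ chosen_sign (- c).
Proof.
move=> c0 /eqP cc; rewrite /chosen_sign choose_opp cc -addr_eq0 -mulr2n.
by rewrite mulrn_eq0.
Qed.

Lemma chosen_sign_add (c d : C) : c != 0 -> chosen_sign c -> chosen_sign d ->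
  c + d != 0.
Proof.
move=> c0 cc dd; rewrite addrC addr_eq0; apply: contraL dd => /eqP ->.
exact: chosen_sign_opp.
Qed.

End HalfSpace.

(** * Tori of skew operators and hyperbolic families *)

Section FormToral.
Variables (C : numClosedFieldType) (k : form_kind).
Variables (V : lmodType C) (p : pairing V V) (T : tensor_product V V).
Hypotheses (p_nondeg : nondegenerate_pairing p) (p_sym : form_symmetric k p).
Variables (e f : nat -> V).
Hypothesis ef : dual_basis p e f.
Local Notation eps := (Defs.form_sign C k).

Definition skew_op (a : T) := forall x y, p (tact p a x) y = - p x (tact p a y).

Lemma subspace_skew : subspace skew_op.
Proof.
split=> [x y|c a b sa sb x y]; first by rewrite !tact0 !pE oppr0.
by rewrite !tactP !pE sa sb; ring.
Qed.

Lemma tact_form_tens v w x :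
  tact p (form_tens k T v w) x = p x w *: v - (eps * p x v) *: w.
Proof. by rewrite tactB tactZ !tactE scalerA. Qed.

Lemma form_algebra_skew a : form_algebra k T a -> skew_op a.
Proof.
apply: (lspan_min subspace_skew) => _ [v _ [w _ <-]] x y.
rewrite !tact_form_tens !pE (p_sym y w) (p_sym y v).
by rewrite !mulrA (form_sign_sqr C k) mul1r; ring.
Qed.

Definition form_lspan (s : seq (V * V)) : set T :=
  lspan [set a | exists2 x, x \in s & a = form_tens k T x.1 x.2].

Lemma form_lspan_sub s s' : {subset s <= s'} -> form_lspan s `<=` form_lspan s'.
Proof. by move=> ss'; apply: lspan_mono => _ [x /ss' xs ->]; exists x. Qed.

Lemma form_lspan_algebra s : form_lspan s `<=` form_algebra k T.
Proof.
by apply: lspan_mono => _ [x _ ->]; exists x.1 => //; exists x.2.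
Qed.

Lemma form_lspan_semisimple s a : hyp_seq p s -> form_lspan s a ->
  semisimple p a.
Proof.
move=> hs sa; apply: (tens_lspan_semisimple (hyp_seq_double p_sym hs)).
apply: lspan_min sa => [|_ [x xs ->]]; first exact: subspace_lspan.
apply: lspanB.
  by apply: sub_lspan; exists x; rewrite // mem_cat xs.
apply: sub_lspan; exists (hyp_flip k x); first by rewrite mem_cat map_f ?orbT.
by rewrite /= tensZr.
Qed.

Variable t : set T.
Hypotheses (tsub : subspace t) (tss : forall b, t b -> semisimple p b).
Hypothesis tc : forall b b', t b -> t b' -> commuting p b b'.
Hypothesis tg : t `<=` form_algebra k T.

(** For skew operators the functional of eigenvalue [c] is, through the form, a vector of eigenvalue
    [- c]. *)
Definition form_joint_pair (x : V * V) := forall b, t b -> exists c,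
  tact p b x.1 = c *: x.1 /\ tact p b x.2 = (- c) *: x.2.

Definition form_joint_seq (s : seq (V * V)) :=
  hyp_seq p s /\ forall x, x \in s -> form_joint_pair x.

Lemma commuting_form_tens b v w c : skew_op b -> tact p b v = c *: v ->
  tact p b w = (- c) *: w -> commuting p b (form_tens k T v w).
Proof.
move=> sb bv bw x; rewrite !tact_form_tens linearB /=.
rewrite [tact p b (_ *: v)]linearZ [tact p b (_ *: w)]linearZ /= bv bw !sb.
rewrite bv bw !pZr !scalerA; congr (_ *: _ - _ *: _); ring.
Qed.

(** Skewness gives [(c + d) <u,v> = <a u, v> + <u, a v> = 0]. *)
Lemma skew_eigen_isotropic a c d u v : skew_op a -> tact p a u = c *: u ->
  tact p a v = d *: v -> c + d != 0 -> p u v = 0.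
Proof.
move=> sa au av cd; apply/eqP; rewrite -(mulrI_eq0 _ (mulfI cd)) mulrDl.
by rewrite -!pZl -au pZl -pZr -av sa addNr.
Qed.

(** The argument of [joint_seq_absorb], except that the eigenpairs of [d] must be made hyperbolic.
    Weights come in opposite pairs and [form_tens] covers both of a pair, so only one sign is kept;
    it remains to see that the kept half recovers [d]. *)
Lemma form_joint_seq_absorb s a : form_joint_seq s -> t a ->
  exists s', form_joint_seq (s ++ s') /\ form_lspan (s ++ s') a.
Proof.
move=> [hs js] ta; have ds := hyp_seq_double p_sym hs.
pose b := \sum_(x <- s) p (tact p a x.1) x.2 *: form_tens k T x.1 x.2.
have bs : form_lspan s b.
  apply: (subspace_sum_seq (subspace_lspan _)) => x xs; apply: lspanZ.
  by apply: sub_lspan; exists x.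
have bc b' : t b' -> commuting p b' b.
  move=> tb'; apply: (subspace_sum_seq (subspace_commuting p b')) => x xs.
  apply: (subspaceZ (subspace_commuting p b')).
  have [c [h1 h2]] := js x xs b' tb'.
  exact: (commuting_form_tens (form_algebra_skew (tg tb')) h1 h2).
have bss := form_lspan_semisimple hs bs.
pose d := a - b.
have dg : form_algebra k T d.
  apply: lspanB; first exact: tg.
  exact: form_lspan_algebra bs.
have dsk := form_algebra_skew dg.
have dss : semisimple p d.
  rewrite /d addrC -scaleN1r; apply: (semisimpleP ef) => //; first exact: tss.
  by apply: commuting_sym; exact: bc.
have dc b' : t b' -> commuting p d b'.
  move=> tb'; apply: commuting_sym; apply: (subspaceB (subspace_commuting p b')).
    exact: tc.
  exact: bc.
have hyps x y : x \in s -> y \in s ->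
    [/\ p x.1 y.2 = (x == y)%:R, p x.1 y.1 = 0 & p x.2 y.2 = 0].
  move=> xs ys; have us := dual_seq_uniq ds.
  move: us; rewrite cat_uniq => /and3P[us _ _].
  move: xs ys => /(nthP x)[i si <-] /(nthP x)[j sj <-].
  by have := hyp_seq_nth p_sym x hs si sj; rewrite /= nth_uniq.
have sd x : x \in s -> tact p d x.1 = 0 /\ tact p d x.2 = 0.
  move=> xs; have [c [ax1 ax2]] := js x xs a ta.
  have us := dual_seq_uniq ds; move: us; rewrite cat_uniq => /and3P[us _ _].
  have x12 : p x.1 x.2 = 1 by have [-> _ _] := hyps _ _ xs xs; rewrite eqxx.
  have cE : p (tact p a x.1) x.2 = c by rewrite ax1 pZl x12 mulr1.
  split; rewrite tactB tact_sum.
    rewrite (bigD1_seq x) //= big1_seq ?addr0 => [|y /andP[yx ys]].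
      have [_ x11 _] := hyps _ _ xs xs.
      by rewrite tactZ tact_form_tens x12 x11 mulr0 scale0r subr0 scale1r cE ax1 subrr.
    have [h1 h2 h3] := hyps _ _ xs ys.
    rewrite tactZ tact_form_tens h1 h2 eq_sym (negbTE yx).
    by rewrite mulr0 !scale0r subr0 scaler0.
  rewrite (bigD1_seq x) //= big1_seq ?addr0 => [|y /andP[yx ys]].
    have [_ _ x22] := hyps _ _ xs xs.
    rewrite tactZ tact_form_tens x22 (p_sym x.2) x12 mulr1 form_sign_sqr.
    by rewrite scale0r sub0r scale1r cE ax2 scaleNr scalerN subrr.
  have [h1 h2 h3] := hyps _ _ ys xs.
  rewrite tactZ tact_form_tens (p_sym x.2 y.1) h1 (p_eq0C p_sym h3) (negbTE yx).
  by rewrite !mulr0 !scale0r subr0 scaler0.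
have [n [v [w [vw dd jd]]]] := joint_eigenvectors ef tss tc dss dc.
pose c (i : 'I_n) : C := weight p v w d i.
have dv i : tact p d (v i) = c i *: v i by rewrite (diag_eigenl vw).
have dw i : tact p d (w i) = (- c i) *: w i.
  apply: (nondegr_eq p_nondeg) => x; rewrite pZr -(opprK (p x _)) -dsk.
  by rewrite (diag_eigenr vw) // mulNr.
(* Two chosen weights never add up to 0, so the kept [v i] are mutually orthogonal and isotropic,
   and so are the kept [w i]. *)
pose nz (i : 'I_n) := (c i != 0) && chosen_sign (c i).
have cc i j : nz i -> nz j -> c i + c j != 0.
  by move=> /andP[? ?] /andP[? ?]; exact: chosen_sign_add.
have vv i j : nz i -> nz j -> p (v i) (v j) = 0.
  by move=> ni nj; apply: (skew_eigen_isotropic dsk (dv i) (dv j)); exact: cc.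
have ww i j : nz i -> nz j -> p (w i) (w j) = 0.
  move=> ni nj; apply: (skew_eigen_isotropic dsk (dw i) (dw j)).
  by rewrite -opprD oppr_eq0 cc.
exists [seq (v i, w i) | i <- enum 'I_n & nz i]; split; first split.
- rewrite hyp_seq_cat hs /=; apply/andP; split.
    rewrite /hyp_seq all_map pairwise_map; apply/andP; split.
      apply/allP => i; rewrite mem_filter => /andP[ni _].
      by rewrite /= /hyp_pair /= vw vv // ww // !eqxx.
    have : uniq [seq i <- enum 'I_n | nz i] by rewrite filter_uniq ?enum_uniq.
    rewrite uniq_pairwise; apply: (sub_in_pairwise (P := nz)); last first.
      by apply/allP => i; rewrite mem_filter => /andP[].
    move=> i j ni nj /= ij.
    rewrite /hyp_orth /= vv // ww // vw (p_sym (w i)) vw.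
    by rewrite [j == i]eq_sym (negbTE ij) mulr0 eqxx.
  apply/allrelP => x y xs ys.
  case/mapP: ys => i; rewrite mem_filter => /andP[/andP[ci _] _] ->.
  have [dx1 dx2] := sd x xs; rewrite -(scale0r x.1) in dx1; rewrite -(scale0r x.2) in dx2.
  have nci : 0 + - c i != 0 by rewrite add0r oppr_eq0.
  have ci' : 0 + c i != 0 by rewrite add0r.
  rewrite /hyp_orth /= (skew_eigen_isotropic dsk dx1 (dv i)) //.
  rewrite (skew_eigen_isotropic dsk dx1 (dw i)) //.
  rewrite (skew_eigen_isotropic dsk dx2 (dv i)) //.
  by rewrite (skew_eigen_isotropic dsk dx2 (dw i)) // eqxx.
- move=> x; rewrite mem_cat => /orP[/js //|xs].
  case/mapP: xs => i; rewrite mem_filter => /andP[/andP[ci _] _] -> b' tb'.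
  have [r [bv bw]] := jd i ci b' tb'; exists r; split=> //=.
  apply: (nondegr_eq p_nondeg) => x'; rewrite pZr.
  by rewrite -(opprK (p x' _)) -(form_algebra_skew (tg tb')) bw mulNr.
- rewrite -[a](subrK b); apply: lspanD; last first.
    by apply: form_lspan_sub bs => x xs; rewrite mem_cat xs.
  have dE z := diag_tact_ord z vw dd.
  rewrite -/d; pose d' := \sum_(i < n | nz i) c i *: form_tens k T (v i) (w i).
  suff -> : d = d'.
    apply: lspan_sum => i ni; apply: lspanZ; apply: sub_lspan.
    by exists (v i, w i); rewrite // mem_cat map_f ?orbT // mem_filter ni mem_enum.
  apply: (tact_inj ef) => x; apply/eqP; rewrite -subr_eq0; apply/eqP.
  (* The difference lies in the image of [d], since [v i] and [w i] are eigenvectors of [d]; it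
     vanishes once it pairs to 0 with every [w j] of nonzero weight, chosen or not. *)
  set y := _ - _.
  have dwE j z : p (tact p d z) (w j) = c j * p z (w j) by rewrite (diag_eigenr vw).
  have im z z' : z = tact p d z' -> (forall j, c j != 0 -> p z (w j) = 0) -> z = 0.
    move=> -> zw; rewrite dE big1 // => j _.
    have [|cj] := eqVneq (c j) 0; first by rewrite /c => ->; rewrite mul0r scale0r.
    by rewrite -/(c j) -dwE zw // scale0r.
  have d'E z : tact p d' z = \sum_(i < n | nz i)
      (c i *: (p z (w i) *: v i - (eps * p z (v i)) *: w i)).
    by rewrite tact_sum; apply: eq_bigr => i _; rewrite tactZ tact_form_tens.
  have [z' yE] : exists z', y = tact p d z'.
    exists (x - \sum_(i < n | nz i)
      (p x (w i) *: v i + (eps * p x (v i)) *: w i)).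
    rewrite /y d'E [tact p d (x - _)]linearB /=.
    rewrite [tact p d (\sum_(_ < _ | _) _)]linear_sum; congr (_ - _).
    apply: eq_bigr => i _.
    rewrite [RHS]linearD /= [tact p d (_ *: v i)]linearZ /= [tact p d (_ *: w i)]linearZ.
    rewrite /= dv dw scalerBr !scalerA mulrN scaleNr.
    by congr (_ *: _ - _ *: _); ring.
  apply: (im _ _ yE) => j cj; rewrite /y pBl dwE d'E p_suml; apply/eqP.
  rewrite subr_eq0; apply/eqP.
  have [nj|nj] := boolP (nz j).
    rewrite (bigD1 j) //= big1 ?addr0.
      by rewrite !pE vw eqxx mulr1 ww // mulr0 subr0.
    by move=> i /andP[ni ij]; rewrite !pE vw (negbTE ij) ww // !mulr0 subrr mulr0.
  (* For an unchosen [j], the eigenvector [w j] of [d] is expanded in the [v i]. Only chosen [i]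
     survive: if both weights are nonzero and unchosen, their opposites are chosen and
     [<w j, w i> = 0]. *)
  have wjE : c j *: w j = - \sum_(i < n) (c i * p (w j) (w i)) *: v i.
    by rewrite -dE dw scaleNr opprK.
  rewrite -pZr wjE pNr p_sumr (bigID nz) /= [X in _ + X]big1 ?addr0.
    rewrite -sumrN; apply: eq_bigr => i ni.
    have /negbTE ij : i != j by apply: contraNneq nj => <-.
    by rewrite !pE vw ij (p_sym (w j)) /=; ring.
  move=> i; rewrite negb_and => ni.
  have [ci|ci] := eqVneq (c i) 0; first by rewrite ci mul0r scale0r p0r.
  have neg l : c l != 0 -> ~~ nz l -> chosen_sign (- c l).
    by move=> cl; rewrite /nz cl /=; have /orP[->|] := chosen_signP (c l).
  rewrite (skew_eigen_isotropic dsk (dw j) (dw i)) ?mulr0 ?scale0r ?p0r //.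
  apply: chosen_sign_add; rewrite ?oppr_eq0 //; apply: neg => //.
  by rewrite negb_and.
Qed.

Lemma form_joint_seq_grow s : form_joint_seq s ->
  exists x, form_joint_seq (rcons s x).
Proof.
move=> jss; have [hs js] := jss.
have [ts|/existsNP[a /not_implyP[ta na]]] := pselect (t `<=` form_lspan s).
  have [x [hx _]] := hyp_seq_extend p_sym p_nondeg 0 (dual_basis_independent ef) hs.
  exists x; split=> // y; rewrite mem_rcons in_cons => /orP[/eqP ->|/js //].
  move=> b /ts sb; exists 0; rewrite oppr0 !scale0r.
  move: hx; rewrite hyp_seq_rcons => /and3P[_ _ /allP sx].
  apply: (lspan_min (S := [set b | tact p b x.1 = 0 /\ tact p b x.2 = 0])) sb.
    split=> [|c b1 b2 [h1 h1'] [h2 h2']]; first by rewrite /= !tact0.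
    by rewrite /= !tactP h1 h1' h2 h2' !scaler0 !addr0.
  move=> _ [z zs ->]; have := sx _ zs; rewrite (hyp_orthC p_sym).
  move=> /and4P[/eqP h1 /eqP h2 /eqP h3 /eqP h4].
  by rewrite /= !tact_form_tens h1 h2 h3 h4 mulr0 !scale0r subr0.
have [[|x s'] [[hs' js'] sa]] := form_joint_seq_absorb jss ta.
  by case: na; rewrite cats0 in sa.
exists x; split=> [|y ys].
  by move: hs'; rewrite -cat_rcons hyp_seq_cat => /and3P[].
by apply: js'; rewrite -cat_rcons mem_cat ys.
Qed.

Lemma commuting_semisimple_form_diag : exists a b : nat -> V,
  hyp_family p a b /\
  t `<=` lspan (range (fun i => form_tens k T (a i) (b i))).
Proof.
have [a [ta tE]] := subspace_countable (tensor_countable T ef) tsub.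
have [] := @sequence_by_stages _ form_joint_seq (fun k s => form_lspan s (a k)).
- by split.
- move=> i s jss; have [s' [js' sa]] := form_joint_seq_absorb jss (ta i).
  have [x jx] := form_joint_seq_grow js'.
  exists (rcons s' x); rewrite size_rcons -rcons_cat; split=> //.
  by apply: form_lspan_sub sa => y ys; rewrite mem_rcons in_cons ys orbT.
move=> u uP; exists (fun i => (u i).1), (fun i => (u i).2); split.
  by apply: (hyp_seq_limit p_sym) => j; have [n [? []]] := uP j; exists n.
rewrite tE; apply: lspan_min; first exact: subspace_lspan.
move=> _ [j _ <-]; have [n [_ _]] := uP j.
by apply: lspan_mono => _ [_ /mapP[i _ ->] ->]; exists i.
Qed.

End FormToral.

(** * Recovering a family from its torus, and the centralizer of a torus *)

Section Separating.
Variables (C : numClosedFieldType) (V W : lmodType C) (p : pairing V W).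
Variable T : tensor_product V W.
Hypothesis p_nondeg : nondegenerate_pairing p.
Variables (e : nat -> V) (f : nat -> W).
Hypothesis ef : dual_basis p e f.

(** Distinct and nonzero weights: exactly what makes the lines of the [v k] the joint eigenlines of
    [t] not killed by [t]. *)
Definition separating (K : choiceType) (v : K -> V) (w : K -> W) (t : set T) :=
  (forall j k, j <> k -> exists2 h, t h & weight p v w h j <> weight p v w h k) /\
  (forall j, exists2 h, t h & weight p v w h j <> 0).

(** An [h] that does not kill [u] shows that [u] is a finite combination of the [v k]; two nonzero
    coordinates would force equal weights for all of [t]. *)
Lemma separating_eigenvector (K : choiceType) (v : K -> V) (w : K -> W) t u :
  dual_family p v w -> t `<=` diag_set T v w -> separating v w t -> u <> 0 ->
  (forall h, t h -> exists c, tact p h u = c *: u) ->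
  (exists2 h, t h & tact p h u <> 0) ->
  exists k c, u = c *: v k.
Proof.
move=> vw td [tsep _] u0 uE [h th hu].
have [c hE] := uE h th; have [r ur hr] := diag_tact vw (td _ th).
have c0 : c != 0 by apply/eqP => c0; apply: hu; rewrite hE c0 scale0r.
have [k kr uk] : exists2 k, k \in r & p u (w k) != 0.
  apply: contrapT => no; apply: hu; rewrite hr big_seq big1 // => k kr.
  have [->|uk] := eqVneq (p u (w k)) 0; first by rewrite mulr0 scale0r.
  by case: no; exists k.
exists k, (c^-1 * (weight p v w h k * p u (w k))).
apply: (scalerI c0); rewrite -hE scalerA mulrA mulfV // mul1r hr.
rewrite (bigD1_seq k) //= big1 ?addr0 // => j jk.
have [->|uj] := eqVneq (p u (w j)) 0; first by rewrite mulr0 scale0r.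
have [h' th' hjk] := tsep j k (elimN eqP jk); case: hjk.
have [d h'E] := uE h' th'.
have wE l : p u (w l) != 0 -> weight p v w h' l = d.
  move=> ul; have := diag_eigenr vw l u (td _ th'); rewrite h'E pZl.
  by move=> /esym/(mulIf ul).
by rewrite !wE.
Qed.

(** Each [v i] is a joint eigenvector not killed by [t], hence a multiple of some [v' (s i)], and
    symmetrically. The functionals are compared on the image of an [h] with nonzero weight at [i],
    which lies in the span of the [v j]. *)
Lemma diag_set_unique (K K' : choiceType) (v : K -> V) (w : K -> W)
    (v' : K' -> V) (w' : K' -> W) t :
  dual_family p v w -> t `<=` diag_set T v w -> separating v w t ->
  dual_family p v' w' -> t `<=` diag_set T v' w' -> separating v' w' t ->
  exists (s : K -> K') (b : K -> C), bijective s /\ forall i,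
    [/\ b i != 0, v i = b i *: v' (s i) & w i = (b i)^-1 *: w' (s i)].
Proof.
move=> vw td tsep vw' td' tsep'.
have half (K1 K2 : choiceType) (v1 : K1 -> V) w1 (v2 : K2 -> V) w2 :
    dual_family p v1 w1 -> t `<=` diag_set T v1 w1 -> separating v1 w1 t ->
    dual_family p v2 w2 -> t `<=` diag_set T v2 w2 -> separating v2 w2 t ->
    exists sb : K1 -> K2 * C, forall i,
      (sb i).2 != 0 /\ v1 i = (sb i).2 *: v2 (sb i).1.
  move=> d1 t1 s1 d2 t2 s2.
  suff /choice[sb sbP] : forall i, exists kc : K2 * C,
      kc.2 != 0 /\ v1 i = kc.2 *: v2 kc.1 by exists sb.
  move=> i.
  have vi0 : v1 i <> 0.
    move=> E; have := d1 i i; rewrite eqxx E p0l => /eqP.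
    by rewrite eq_sym oner_eq0.
  have [||k [c vE]] := separating_eigenvector d2 t2 s2 vi0.
  - by move=> h /t1 dh; exists (weight p v1 w1 h i); rewrite (diag_eigenl d1).
  - have [h th wh] := s1.2 i; exists h => //.
    rewrite (diag_eigenl d1); last exact: t1.
    by move=> /eqP; rewrite scaler_eq0 => /orP[] /eqP.
  exists (k, c); split=> //=; apply: contra_notN vi0 => /eqP c0.
  by rewrite vE c0 scale0r.
have [sb sbP] := half _ _ _ _ _ _ vw td tsep vw' td' tsep'.
have [sb' sbP'] := half _ _ _ _ _ _ vw' td' tsep' vw td tsep.
pose s i := (sb i).1; pose b i := (sb i).2.
have b0 i : b i != 0 by case: (sbP i).
have vE i : v i = b i *: v' (s i) by case: (sbP i).
have line_inj (K1 : choiceType) (v1 : K1 -> V) w1 i j c : dual_family p v1 w1 ->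
    v1 i = c *: v1 j -> i = j.
  move=> d1 E; have := d1 i i; rewrite E pZl d1 !eqxx => /eqP.
  by case: (eqVneq j i) => [->//|_]; rewrite mulr0 eq_sym oner_eq0.
exists s, b; split.
  exists (fun j => (sb' j).1) => [i|j].
    have [c0 E] := sbP' (s i); have := vE i; rewrite E scalerA => /line_inj E'.
    by apply/esym; apply: E'; exact: vw.
  have [c0 E] := sbP' j; have := vE (sb' j).1 => E'.
  move: E; rewrite E' scalerA => /line_inj E.
  by apply/esym; apply: E; exact: vw'.
move=> i; split=> //.
have [h th wh] := tsep.2 i; move/eqP: wh => wh.
(* With [m] and [m'] the two weights, it solves [m' <x, w' (s i)> = b i m <x, w i>] for [w i]. That
   [c] is the inverse of [b i] comes out at the end from [<v i, w i> = 1]. *)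
pose c := weight p v' w' h (s i) / weight p v w h i / b i.
have wE : w i = c *: w' (s i).
  apply: (nondegr_eq p_nondeg) => x; rewrite pZr.
  have [r ur hr] := diag_tact vw (td _ th).
  have := diag_eigenr vw' (s i) x (td' _ th).
  have -> : p (tact p h x) (w' (s i)) = b i * (p (tact p h x) (w i)).
    have vw's j : p (v j) (w' (s i)) = b i * (i == j)%:R.
      rewrite vE pZl vw'; have [->|ij] := eqVneq i j; first by rewrite eqxx.
      have [E|] := eqVneq (s j) (s i); last by rewrite !mulr0.
      have := vE i; rewrite -E => vi.
      have vj : v' (s j) = (b j)^-1 *: v j.
        by rewrite vE scalerA mulVf // scale1r.
      move: vi; rewrite vj scalerA => /line_inj => /(_ _ vw) ij'.
      by rewrite ij' eqxx in ij.
    rewrite hr !p_suml mulr_sumr; apply: eq_bigr => j _.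
    by rewrite !pZl vw's vw eq_sym mulrCA.
  rewrite (diag_eigenr vw); last exact: td.
  move=> E.
  apply: (mulfI (b0 i)); apply: (mulfI wh); rewrite mulrCA E /c.
  by field; rewrite b0 wh.
have := vw i i; rewrite eqxx vE wE pZl pZr vw' eqxx mulr1 => bc.
by congr (_ *: _); apply: (mulfI (b0 i)); rewrite bc mulfV.
Qed.

(** [a] has rank at most [n]; with more than [n] nonzero weights, an identity matrix of size above
    [n] would factor through dimension [n]. *)
Lemma finite_nonzero_weights (K : choiceType) (v : K -> V) (w : K -> W) (a : T) c :
  dual_family p v w -> semisimple p a -> (forall k, tact p a (v k) = c k *: v k) ->
  finite_set [set k | c k != 0].
Proof.
move=> vw /(semisimple_diag ef)[n [x [y [xy da]]]] ac.
apply: contrapT => /(infinite_set_fset n.+1)[A Ac nA].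
pose r := finmap.enum_fset A.
have ru : uniq r by exact: finmap.fset_uniq.
have sr : (n < size r)%N by [].
have k0 : K by case: r sr {ru}.
pose P : 'M[C]_(size r, n) := \matrix_(l, i)
  ((c (nth k0 r l))^-1 * weight p x y a i * p (v (nth k0 r l)) (y i)).
pose Q : 'M[C]_(n, size r) := \matrix_(i, l) p (x i) (w (nth k0 r l)).
have PQ : P *m Q = 1%:M.
  apply/matrixP => l m; rewrite !mxE.
  have cl : c (nth k0 r l) != 0 by apply: Ac => /=; rewrite mem_nth.
  have := congr1 (fun z => p z (w (nth k0 r m))) (ac (nth k0 r l)).
  rewrite (diag_tact_ord _ xy da) p_suml pZl vw nth_uniq // => E.
  apply: (mulfI cl); rewrite mulr_sumr -[RHS]E; apply: eq_bigr => i _.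
  by rewrite !mxE pZl !mulrA mulfV // mul1r.
have := mulmx_max_rank P Q; rewrite PQ mxrank1 leqNgt.
by rewrite sr.
Qed.

(** [a] maps the line of [v k] into itself, because the other eigenlines carry different weights.
    The claim on [w k] is tested on the image of an [h] with nonzero weight at [k]. *)
Lemma commuting_separating (K : choiceType) (v : K -> V) (w : K -> W) (t : set T) a :
  dual_family p v w -> t `<=` diag_set T v w -> separating v w t ->
  (forall h, t h -> commuting p a h) -> forall k,
    tact p a (v k) = weight p v w a k *: v k /\
    forall x, p (tact p a x) (w k) = weight p v w a k * p x (w k).
Proof.
move=> vw td tsep ac.
have av k : tact p a (v k) = weight p v w a k *: v k.
  have hav h : t h -> tact p h (tact p a (v k)) =
      weight p v w h k *: tact p a (v k).
    by move=> th; rewrite -ac // (diag_eigenl vw) ?linearZ //; exact: td.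
  have [av0|/eqP av0] := eqVneq (tact p a (v k)) 0.
    by rewrite /weight av0 p0l scale0r.
  have [||j [c avE]] := separating_eigenvector vw td tsep av0.
  - by move=> h th; exists (weight p v w h k); exact: hav.
  - have [h th /eqP wh] := tsep.2 k; exists h => //; rewrite hav // => /eqP.
    by rewrite scaler_eq0 (negbTE wh) => /eqP.
  have [jk|/eqP jk] := eqVneq j k.
    by rewrite /weight avE jk pZl vw eqxx mulr1.
  have [h th hjk] := tsep.1 j k jk; case: hjk.
  have c0 : c != 0 by apply: contra_notN av0 => /eqP c0; rewrite avE c0 scale0r.
  have dh := td _ th.
  have := hav h th; rewrite avE linearZ /= (diag_eigenl vw) //.
  move=> /(congr1 (fun x => p x (w j))); rewrite !pZl vw eqxx !mulr1 mulrC.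
  by move/(mulIf c0).
move=> k; split=> // x.
have [h th /eqP wh] := tsep.2 k; have [r ur hr] := diag_tact vw (td _ th).
have dh := td _ th.
apply: (mulfI wh); rewrite -(diag_eigenr vw k (tact p a x) dh) -ac //.
rewrite mulrCA -(diag_eigenr vw k x dh) hr linear_sum /= !p_suml mulr_sumr.
apply: eq_bigr => j _; rewrite [tact p a (_ *: _)]linearZ /= av !pZl vw.
by have [->|] := eqVneq j k; rewrite ?mulr0 // ?mulr1 mulrC.
Qed.

(** The diagonal part [b] of [a] is a finite sum because only finitely many weights are nonzero. If
    [d = a - b] is not 0, it has an eigenpair of nonzero weight; as [d] vanishes on the family from
    both sides, the pair is orthogonal to the family, and [a] acts on it as [d] does. *)
Lemma centralizer_dichotomy (K : choiceType) (v : K -> V) (w : K -> W) (t : set T) a :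
  dual_family p v w -> t `<=` diag_set T v w -> separating v w t ->
  semisimple p a -> (forall h, t h -> commuting p a h) ->
  diag_set T v w a \/ exists u z c,
    [/\ c != 0, p u z = 1, forall k, p u (w k) = 0 /\ p (v k) z = 0,
        tact p a u = c *: u & forall x, p (tact p a x) z = c * p x z].
Proof.
move=> vw td tsep ass ac.
have aE := commuting_separating vw td tsep ac.
have /finite_set_enum[r ur rP] :=
  finite_nonzero_weights vw ass (fun k => (aE k).1).
pose b := \sum_(k <- r) weight p v w a k *: tens T (v k) (w k).
have db : diag_set T v w b.
  by apply: lspan_sum => k _; apply: lspanZ; apply: sub_lspan; exists k.
pose d := a - b.
have [d0|d0] := eqVneq d 0.
  by left; move/eqP: d0; rewrite subr_eq0 => /eqP ->.
right.
have wb k : weight p v w b k = weight p v w a k.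
  rewrite weight_diag //; case: ifP => // /negbT kr.
  by apply/esym/eqP; apply: contraNT kr => ?; exact: rP.
have dv k : tact p d (v k) = 0.
  by rewrite tactB (aE k).1 (diag_eigenl vw) // wb subrr.
have dw k x : p (tact p d x) (w k) = 0.
  by rewrite tactB pBl (aE k).2 (diag_eigenr vw) // wb subrr.
have ab : commuting p b a.
  apply: commuting_sym; apply: (subspace_sum (subspace_commuting p a)) => k _.
  apply: (subspaceZ (subspace_commuting p a)).
  exact: (commuting_tens (aE k).1 (aE k).2).
have dss : semisimple p d.
  rewrite /d addrC -scaleN1r; apply: (semisimpleP ef) => //.
  exact: (diag_semisimple vw).
have [n [x [y [xy dd]]]] := semisimple_diag ef dss.
have [i wi] : exists i, weight p x y d i != 0.
  apply: contrapT => no; case/eqP: d0; apply: (tact_inj ef) => z.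
  rewrite tact0 (diag_tact_ord _ xy dd) big1 // => i _.
  have [->|wi] := eqVneq (weight p x y d i) 0; first by rewrite mul0r scale0r.
  by case: no; exists i.
exists (x i), (y i), (weight p x y d i).
have xw k : p (x i) (w k) = 0.
  have := dw k (x i); rewrite (diag_eigenl xy) // pZl => /eqP.
  by rewrite mulf_eq0 (negbTE wi) => /eqP.
have vy k : p (v k) (y i) = 0.
  have := diag_eigenr xy i (v k) dd; rewrite dv p0l => /esym/eqP.
  by rewrite mulf_eq0 (negbTE wi) => /eqP.
have aE' z : tact p a z = tact p d z + tact p b z by rewrite tactB subrK.
split=> //.
- by rewrite xy eqxx.
- rewrite aE' (diag_eigenl xy) // (tact_diag p T v w) big1 ?addr0 // => k _.
  by rewrite xw mulr0 scale0r.
- move=> z; rewrite aE' pDl (diag_eigenr xy) // (tact_diag p T v w) p_suml.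
  by rewrite big1 ?addr0 // => k _; rewrite pZl vy mulr0.
Qed.

End Separating.

(** * Isometries between frames *)

Section FamilySpan.
Variables (C : numClosedFieldType) (V W : lmodType C) (p : pairing V W).

(** Exchanging the sides lets statements about [V] be applied to [W]. *)
Definition flip_pairing_fun (w : W) (v : V) := p v w.
Fact flip_pairing_bilinear : bilinear_for *%R *%R flip_pairing_fun.
Proof. by split=> [v|w] a x y; rewrite /flip_pairing_fun !pE. Qed.
Definition flip_pairing : pairing W V := pairing_of flip_pairing_bilinear.

Variables (I : choiceType) (v : I -> V) (w : I -> W).
Hypothesis vw : dual_family p v w.

Lemma dual_family_flip : dual_family flip_pairing w v.
Proof. by move=> i j; rewrite /= /flip_pairing_fun vw eq_sym. Qed.

(** The expansion holds over every larger index list, so that two vectors can share one. *)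
Lemma family_span_coords s : lspan (range v) s ->
  exists2 r : seq I, uniq r & forall r', uniq r' -> {subset r <= r'} ->
    s = \sum_(i <- r') p s (w i) *: v i /\
    forall i, i \notin r' -> p s (w i) = 0.
Proof.
apply: (lspan_min (S := [set s | exists2 r : seq I, uniq r & forall r', uniq r' ->
  {subset r <= r'} -> s = \sum_(i <- r') p s (w i) *: v i /\
    forall i, i \notin r' -> p s (w i) = 0])).
  split=> [|a x y [r ur xr] [r' ur' yr']].
    exists [::] => // r _ _; split=> [|i _]; last exact: p0l.
    by rewrite big1 // => i _; rewrite p0l scale0r.
  exists (undup (r ++ r')) => [|q uq qr]; first exact: undup_uniq.
  have [|xE x0] := xr q uq; first by move=> i ir; apply: qr; rewrite mem_undup mem_cat ir.
  have [|yE y0] := yr' q uq.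
    by move=> i ir; apply: qr; rewrite mem_undup mem_cat ir orbT.
  split=> [|i iq]; last by rewrite !pE x0 // y0 // mulr0 addr0.
  rewrite {1}xE {1}yE scaler_sumr -big_split; apply: eq_bigr => i _.
  by rewrite !pE scalerDl scalerA.
move=> _ [k _ <-]; exists [:: k] => // r ur kr; split=> [|i ir].
  rewrite (bigD1_seq k) ?kr ?mem_head //= vw eqxx scale1r big1 ?addr0 // => i ik.
  by rewrite vw eq_sym (negbTE ik) scale0r.
have -> : p (v k) (w i) = (k == i)%:R by exact: vw.
by have [ki|] := eqVneq k i; rewrite // -ki kr ?mem_head in ir.
Qed.

Lemma family_span_eq0 s : lspan (range v) s -> (forall i, p s (w i) = 0) -> s = 0.
Proof.
move=> /family_span_coords[r ur /(_ r ur)[] // sE _ s0].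
by rewrite sE big1 // => i _; rewrite s0 scale0r.
Qed.

Lemma family_span_finite s : lspan (range v) s ->
  finite_set [set i | p s (w i) <> 0].
Proof.
move=> /family_span_coords[r ur /(_ r ur)[] // _ s0].
by apply: (sub_seq_finite (r := r)) => i /= /eqP; apply: contraNT => /s0 ->.
Qed.

Lemma finite_family_span (c : I -> C) : finite_set [set i | c i <> 0] ->
  exists2 s, lspan (range v) s & forall i, p s (w i) = c i.
Proof.
move=> /finite_set_enum[r ur rP]; exists (\sum_(i <- r) c i *: v i).
  by apply: lspan_sum => i _; apply: lspanZ; apply: sub_lspan; exists i.
move=> i; rewrite p_suml; have [ir|ir] := boolP (i \in r).
  rewrite (bigD1_seq i) //= pZl vw eqxx mulr1 big1 ?addr0 // => j ji.
  by rewrite pZl vw (negbTE ji) mulr0.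
rewrite big_seq big1 => [|j jr].
  by apply/esym/eqP; apply: contraNT ir => /eqP; exact: rP.
rewrite pZl vw; have [ji|_] := eqVneq j i; last by rewrite mulr0.
by rewrite -ji jr in ir.
Qed.

End FamilySpan.

Section PairingChange.
Variables (C : numClosedFieldType) (V W : lmodType C) (p : pairing V W).
Variables (I : choiceType) (v : I -> V) (w : I -> W).
Hypothesis vw : dual_family p v w.

Definition defect (u g : V) (z h : W) (i : I) : C :=
  p u (w i) * p (v i) z - p g (w i) * p (v i) h.

(** Expand [u - g] and [z - h] in [<u,z> - <g,h> = <u - g, z> + <g, z - h>]: the mixed terms cancel
    and differences of [<u,w_i><v_i,z>] and [<g,w_i><v_i,h>] remain. Each of the two sums may be
    infinite on its own. *)
Lemma pairing_defect u g z h :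
  lspan (range v) (u - g) -> lspan (range w) (z - h) ->
  finite_set [set i | defect u g z h i <> 0] /\
  p u z - p g h = \sum_(i \in [set: I]) defect u g z h i.
Proof.
move=> ug zh.
have [r ur rP] := family_span_coords vw ug.
have [r' ur' rP'] := family_span_coords (dual_family_flip vw) zh.
pose q := undup (r ++ r'); have uq : uniq q := undup_uniq _.
have [|aE a0] := rP q uq; first by move=> i ir; rewrite mem_undup mem_cat ir.
have [|bE b0] := rP' q uq; first by move=> i ir; rewrite mem_undup mem_cat ir orbT.
have q0 i : i \notin q -> defect u g z h i = 0.
  move=> iq; have := a0 i iq; have := b0 i iq; rewrite /= /flip_pairing_fun !pE.
  move=> /subr0_eq E1 /subr0_eq E2.
  by rewrite /defect E1 E2 subrr.
split; first by apply: (sub_seq_finite (r := q)) => i /= /eqP; apply: contraNT => /q0 ->.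
have -> : \sum_(i \in [set: I]) defect u g z h i = \sum_(i <- q) defect u g z h i.
  rewrite (fsbigE q) //; last by move=> i _; exact: q0.
  by apply: eq_bigl => i; rewrite in_setT.
have -> : p u z - p g h = p (u - g) z + p g (z - h) by rewrite !pE; ring.
rewrite aE bE p_suml p_sumr -big_split; apply: eq_bigr => i _ /=.
by rewrite /flip_pairing_fun /defect !pE; ring.
Qed.

End PairingChange.

Section Complements.
Variable C : numClosedFieldType.

Lemma complement_unique (V X : lmodType C) (S : set V) (j : {linear X -> V})
    x x' s s' : subspace S -> complement_of S j -> S s -> S s' ->
  j x + s = j x' + s' -> x = x' /\ s = s'.
Proof.
move=> Ssub [j_inj jS _] Ss Ss' E.
have jx : j (x - x') = s' - s.
  rewrite linearB /=; apply/eqP; rewrite subr_eq; apply/eqP/(addIr s).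
  by rewrite E addrAC subrK addrC.
have : (range j `&` S) (j (x - x')).
  by split; [exists (x - x')|rewrite jx; apply: subspaceB].
rewrite jS => /= jx0; have xx' : x = x'.
  by apply/subr0_eq/j_inj; rewrite jx0 linear0.
by split=> //; apply/esym/subr0_eq; rewrite -jx jx0.
Qed.

Lemma complement_projection (V X V' X' : lmodType C) (S' : set V')
    (j : {linear X -> V}) (j' : {linear X' -> V'}) (f : {linear V -> V'}) :
  subspace S' -> complement_of S' j' ->
  exists q : {linear X -> X'}, forall x, S' (f (j x) - j' (q x)).
Proof.
move=> S'sub cj'; have [_ _ j'T] := cj'.
apply: (linear_graph (r := fun x x' => S' (f (j x) - j' x'))).
- move=> x; have [x' [s' S's' ->]] := j'T (f (j x)).
  by exists x'; rewrite addrC addKr.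
- move=> x x1 x2 S1 S2.
  have := @complement_unique _ _ S' j' x1 x2 _ _ S'sub cj' S1 S2.
  by rewrite !(addrC (j' _)) !subrK => /(_ erefl)[].
- move=> a x1 x2 y1 y2 h1 h2.
  have := S'sub.2 a _ _ h1 h2.
  by rewrite (linearP j) (linearP f) (linearP j') /= scalerBr opprD addrACA.
Qed.

(** The projections of [f] and of its inverse are mutually inverse, because complement components
    are unique. *)
Lemma complement_projection_bij (V X V' X' : lmodType C) (S : set V) (S' : set V')
    (j : {linear X -> V}) (j' : {linear X' -> V'}) (f : {linear V -> V'})
    (f' : {linear V' -> V}) (q : {linear X -> X'}) :
  subspace S -> subspace S' -> complement_of S j -> complement_of S' j' ->
  cancel f f' -> cancel f' f -> f @` S `<=` S' -> f' @` S' `<=` S ->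
  (forall x, S' (f (j x) - j' (q x))) -> bijective q.
Proof.
move=> Ssub S'sub cj cj' fK fK' fS fS' qP.
have [q' q'P] := complement_projection j' f' Ssub cj.
have key (V1 X1 V2 X2 : lmodType C) (S1 : set V1) (S2 : set V2)
    (j1 : {linear X1 -> V1}) (j2 : {linear X2 -> V2}) (g1 : {linear V1 -> V2})
    (g2 : {linear V2 -> V1}) (q1 : {linear X1 -> X2}) (q2 : {linear X2 -> X1}) :
    subspace S1 -> complement_of S1 j1 -> cancel g1 g2 -> g2 @` S2 `<=` S1 ->
    (forall x, S2 (g1 (j1 x) - j2 (q1 x))) ->
    (forall x, S1 (g2 (j2 x) - j1 (q2 x))) -> cancel q1 q2.
  move=> S1sub c1 gK gS h1 h2 x.
  have S1x : S1 (g2 (g1 (j1 x) - j2 (q1 x))) by apply: gS; exists (g1 (j1 x) - j2 (q1 x)).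
  have := subspaceD S1sub S1x (h2 (q1 x)).
  rewrite linearB /= gK addrA subrK => S1d.
  have := @complement_unique _ _ S1 j1 x (q2 (q1 x)) 0 _ S1sub c1 (subspace0 S1sub) S1d.
  by rewrite addr0 (addrC (j1 (q2 _))) subrK => /(_ erefl)[].
exists q'; first exact: (key _ _ _ _ S S' j j' f f').
exact: (key _ _ _ _ S' S j' j f' f).
Qed.

(* The map is pinned down by its coordinates and by its value modulo the span
   of the family. *)
Lemma frame_lift (V W X V' W' X' : lmodType C) (p : pairing V W)
    (p' : pairing V' W') (I : choiceType) (v : I -> V) (w : I -> W)
    (v' : I -> V') (w' : I -> W') (j : {linear X -> V}) (j' : {linear X' -> V'})
    (q : {linear X -> X'}) :
  dual_family p v w -> dual_family p' v' w' ->
  complement_of (lspan (range v)) j -> complement_of (lspan (range v')) j' ->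
  (forall x, (fun i => p (j x) (w i)) ≈ (fun i => p' (j' (q x)) (w' i))) ->
  exists f : {linear V -> V'},
    [/\ forall u i, p' (f u) (w' i) = p u (w i),
        forall x, lspan (range v') (f (j x) - j' (q x)) &
        forall i, f (v i) = v' i].
Proof.
move=> vw vw' cj cj' qE.
set S := lspan (range v); set S' := lspan (range v').
have Ssub : subspace S := subspace_lspan _.
have S'sub : subspace S' := subspace_lspan _.
pose r u u' := (forall i, p' u' (w' i) = p u (w i)) /\
  exists x s, [/\ S s, u = j x + s & S' (u' - j' (q x))].
have r_fun u u1 u2 : r u u1 -> r u u2 -> u1 = u2.
  move=> [c1 [x1 [s1 [Ss1 E1 h1]]]] [c2 [x2 [s2 [Ss2 E2 h2]]]].
  have [xx _] := complement_unique Ssub cj Ss1 Ss2 (etrans (esym E1) E2).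
  apply/subr0_eq/(family_span_eq0 vw') => [|i]; last by rewrite pBl c1 c2 subrr.
  have := subspaceB S'sub h1 h2; rewrite xx opprB addrA subrK.
  by [].
have [f fP] : exists f : {linear V -> V'}, forall u, r u (f u).
  apply: linear_graph => //.
  - move=> u; have [_ _ /(_ u)[x [s Ss uE]]] := cj.
    (* Almost all coordinates already agree: by [qE] on the complement part, and by finite support
       on [s]. The finite discrepancy is made up inside [S']. *)
    have fin : finite_set [set i | p u (w i) - p' (j' (q x)) (w' i) <> 0].
      have := family_span_finite vw Ss.
      move=> /(conj (qE x)); rewrite -finite_setU; apply: sub_finite_set => i /= ui.
      apply: contrapT => /not_orP[/contrapT h1 /contrapT h2]; apply: ui.
      by rewrite uE pDl h2 addr0 h1 subrr.
    have [a S'a aE] := finite_family_span vw' fin.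
    exists (j' (q x) + a); split=> [i|]; first by rewrite pDl aE addrC subrK.
    by exists x, s; split=> //; rewrite addrC addKr.
  - move=> a u1 u2 u1' u2' [c1 [x1 [s1 [Ss1 E1 h1]]]] [c2 [x2 [s2 [Ss2 E2 h2]]]].
    split=> [i|]; first by rewrite !pE c1 c2.
    exists (a *: x1 + x2), (a *: s1 + s2); split.
    + exact: Ssub.2.
    + by rewrite E1 E2 linearP scalerDr addrACA.
    + have := S'sub.2 a _ _ h1 h2.
      by rewrite (linearP q) (linearP j') /= scalerBr opprD addrACA.
exists f; split=> [u i|x|i].
- by have [] := fP u.
- have [_ [x' [s [Ss E h]]]] := fP (j x).
  have := @complement_unique _ _ S j x x' 0 s Ssub cj (subspace0 Ssub) Ss.
  by rewrite addr0 => /(_ E)[xx _]; rewrite -xx in h.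
- apply: (r_fun (v i)); first exact: fP.
  split=> [l|]; first by rewrite vw vw'.
  exists 0, (v i); rewrite !linear0 add0r ?subr0 ?addr0; split=> //; apply: sub_lspan.
    by exists i.
  by exists i.
Qed.

(** Used to see that the lifts of [q] and of its inverse are inverse to each other. *)
Lemma frame_map_id (V W X : lmodType C) (p : pairing V W) (I : choiceType)
    (v : I -> V) (w : I -> W) (j : {linear X -> V}) (f : {linear V -> V}) :
  dual_family p v w -> complement_of (lspan (range v)) j ->
  (forall u i, p (f u) (w i) = p u (w i)) ->
  (forall x, lspan (range v) (f (j x) - j x)) -> (forall i, f (v i) = v i) ->
  f =1 id.
Proof.
move=> vw [_ _ jT] fc fj fv u; have [x [s Ss ->]] := jT u.
apply/subr0_eq/(family_span_eq0 vw) => [|i]; last by rewrite pBl fc subrr.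
have fs : f s = s.
  by apply: (linear_eq_lspan (g := idfun)) (mem_set Ss) => _ /set_mem[i _ <-].
rewrite linearD /= fs opprD addrACA subrr addr0; exact: fj.
Qed.

End Complements.

Section Frames.
Variable C : numClosedFieldType.

Lemma linear_inverse (U V : lmodType C) (f : {linear U -> V}) : bijective f ->
  exists g : {linear V -> U}, cancel f g /\ cancel g f.
Proof.
move=> [g fK gK].
have g_lin : linear g.
  by move=> a x y; apply: (can_inj fK); rewrite linearP !gK.
by exists (linear_of g_lin).
Qed.

Lemma image_lspan_family (U V : lmodType C) (I : Type) (f : {linear U -> V})
    (v : I -> U) (v' : I -> V) : (forall i, f (v i) = v' i) ->
  f @` lspan (range v) = lspan (range v').
Proof.
move=> fv; rewrite lspan_image; congr lspan; apply/seteqP; split.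
  by move=> _ [_ [i _ <-] <-]; exists i.
by move=> _ [i _ <-]; exists (v i); [exists i|].
Qed.

Lemma frame_lift_bij (V W X V' W' X' : lmodType C) (p : pairing V W)
    (p' : pairing V' W') (I : choiceType) (v : I -> V) (w : I -> W)
    (v' : I -> V') (w' : I -> W') (j : {linear X -> V}) (j' : {linear X' -> V'})
    (q : {linear X -> X'}) :
  dual_family p v w -> dual_family p' v' w' ->
  complement_of (lspan (range v)) j -> complement_of (lspan (range v')) j' ->
  bijective q ->
  (forall x, (fun i => p (j x) (w i)) ≈ (fun i => p' (j' (q x)) (w' i))) ->
  exists f : {linear V -> V'},
    [/\ bijective f, forall u i, p' (f u) (w' i) = p u (w i),
        forall x, lspan (range v') (f (j x) - j' (q x)) &
        forall i, f (v i) = v' i].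
Proof.
move=> vw vw' cj cj' /linear_inverse[q' [qK q'K]] qE.
have [f [fc fj fv]] := frame_lift vw vw' cj cj' qE.
have q'E x' : (fun i => p' (j' x') (w' i)) ≈ (fun i => p (j (q' x')) (w i)).
  by apply: sub_finite_set (qE (q' x')) => i /=; rewrite q'K => h E; exact: h.
have [g [gc gj gv]] := frame_lift vw' vw cj' cj q'E.
exists f; split=> //; exists g.
  apply: (frame_map_id (f := g \o f) vw cj) => [u i|x|i] /=.
  - by rewrite gc fc.
  - have gS : lspan (range v) (g (f (j x) - j' (q x))).
      by rewrite -(image_lspan_family gv); exists (f (j x) - j' (q x)).
    have := lspanD gS (gj (q x)); rewrite qK linearB /= addrA subrK.
    by [].
  - by rewrite fv gv.
apply: (frame_map_id (f := f \o g) vw' cj') => [u i|x|i] /=.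
- by rewrite fc gc.
- have fS : lspan (range v') (f (g (j' x) - j (q' x))).
    by rewrite -(image_lspan_family fv); exists (g (j' x) - j (q' x)).
  have := lspanD fS (fj (q' x)); rewrite q'K linearB /= addrA subrK.
  by [].
- by rewrite gv fv.
Qed.

Lemma frame_projection (U U' Z Z' : lmodType C) (I : Type)
    (h : {linear U -> U'}) (u : I -> U) (u' : I -> U') (j : {linear Z -> U})
    (j' : {linear Z' -> U'}) :
  bijective h -> (forall i, h (u i) = u' i) ->
  complement_of (lspan (range u)) j -> complement_of (lspan (range u')) j' ->
  exists2 q : {linear Z -> Z'}, bijective q &
    forall x, lspan (range u') (h (j x) - j' (q x)).
Proof.
move=> /linear_inverse[h' [hK hK']] hu cj cj'.
have [q qP] := complement_projection j h (subspace_lspan _) cj'.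
have hu' i : h' (u' i) = u i by rewrite -hu hK.
exists q => //; apply: complement_projection_bij cj cj' hK hK' _ _ qP.
- exact: subspace_lspan.
- exact: subspace_lspan.
- by rewrite (image_lspan_family hu).
- by rewrite (image_lspan_family hu').
Qed.

Section TwoFrames.
Variables (V W X Y V' W' X' Y' : lmodType C).
Variables (p : pairing V W) (p' : pairing V' W') (I : choiceType).
Variables (v : I -> V) (w : I -> W) (v' : I -> V') (w' : I -> W').
Variables (jX : {linear X -> V}) (jY : {linear Y -> W}).
Variables (jX' : {linear X' -> V'}) (jY' : {linear Y' -> W'}).
Hypotheses (vw : dual_family p v w) (vw' : dual_family p' v' w').
Hypotheses (cX : complement_of (lspan (range v)) jX)
  (cY : complement_of (lspan (range w)) jY).
Variables (f : {linear V -> V'}) (g : {linear W -> W'}).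
Variables (qX : {linear X -> X'}) (qY : {linear Y -> Y'}).
Hypotheses (fj : forall x, lspan (range v') (f (jX x) - jX' (qX x)))
  (gj : forall y, lspan (range w') (g (jY y) - jY' (qY y))).
Hypotheses (fv : forall i, f (v i) = v' i) (gw : forall i, g (w i) = w' i).

Definition frame_defect x y i :=
  p (jX x) (w i) * p (v i) (jY y)
  - p' (jX' (qX x)) (w' i) * p' (v' i) (jY' (qY y)).

(** [f (jX x)] and [jX' (qX x)] differ by a vector of the span, so their coordinates differ at
    finitely many indices; the last identity is [pairing_defect] for these two vectors and their
    analogues on the other side. *)
Lemma isometry_frame_data : (forall u z, p' (f u) (g z) = p u z) ->
  [/\ forall x, (fun i => p (jX x) (w i)) ≈ (fun i => p' (jX' (qX x)) (w' i)),
      forall y, (fun i => p (v i) (jY y)) ≈ (fun i => p' (v' i) (jY' (qY y))),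
      forall x y, finite_set [set i | frame_defect x y i <> 0] &
      forall x y, p (jX x) (jY y) - p' (jX' (qX x)) (jY' (qY y))
        - \sum_(i \in [set: I]) frame_defect x y i = 0].
Proof.
move=> iso.
have E x y i : frame_defect x y i = defect p' v' w' (f (jX x)) (jX' (qX x))
    (g (jY y)) (jY' (qY y)) i.
  by rewrite /frame_defect /defect -!iso fv gw.
split=> [x|y|x y|x y].
- apply: sub_finite_set (family_span_finite vw' (fj x)) => i /= h.
  by rewrite pBl => /subr0_eq E'; apply: h; rewrite -E' -gw iso.
- apply: sub_finite_set (family_span_finite (dual_family_flip vw') (gj y)) => i.
  move=> /= h; rewrite /flip_pairing_fun pBr => /subr0_eq E'; apply: h.
  by rewrite -E' -fv iso.
- have [fin _] := pairing_defect vw' (fj x) (gj y).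
  by apply: sub_finite_set fin => i /=; rewrite E.
- have [_] := pairing_defect vw' (fj x) (gj y); rewrite iso => ->.
  apply/eqP; rewrite subr_eq0; apply/eqP; apply: eq_fsbigr => i _.
  by rewrite E.
Qed.

Lemma frame_defectE :
  (forall u i, p' (f u) (w' i) = p u (w i)) ->
  (forall z i, p' (v' i) (g z) = p (v i) z) -> forall x y i,
  frame_defect x y i =
    defect p' v' w' (f (jX x)) (jX' (qX x)) (g (jY y)) (jY' (qY y)) i.
Proof. by move=> fc gc x y i; rewrite /frame_defect /defect fc gc. Qed.

Lemma frame_defect_finite :
  (forall u i, p' (f u) (w' i) = p u (w i)) ->
  (forall z i, p' (v' i) (g z) = p (v i) z) -> forall x y,
  finite_set [set i | frame_defect x y i <> 0].
Proof.
move=> fc gc x y; have [fin _] := pairing_defect vw' (fj x) (gj y).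
by apply: sub_finite_set fin => i /=; rewrite frame_defectE.
Qed.

(** When one argument lies in the span of its family, preservation of coordinates suffices. Between
    complement vectors the pairing changes by the sum of the defects, and the last hypothesis says
    that this is the change from [p] to [p']. *)
Lemma frame_data_isometry :
  (forall u i, p' (f u) (w' i) = p u (w i)) ->
  (forall z i, p' (v' i) (g z) = p (v i) z) ->
  (forall x y, p (jX x) (jY y) - p' (jX' (qX x)) (jY' (qY y))
        - \sum_(i \in [set: I]) frame_defect x y i = 0) ->
  forall u z, p' (f u) (g z) = p u z.
Proof.
move=> fc gc om.
have isoS u s : lspan (range w) s -> p' (f u) (g s) = p u s.
  apply: (lspan_min (S := [set s | p' (f u) (g s) = p u s])) => [|_ [i _ <-]].
    split=> [|a x y /= hx hy] /=; first by rewrite linear0 !p0r.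
    by rewrite linearP /= !pE hx hy.
  by rewrite /= gw fc.
have isoS' s z : lspan (range v) s -> p' (f s) (g z) = p s z.
  apply: (lspan_min (S := [set s | p' (f s) (g z) = p s z])) => [|_ [i _ <-]].
    split=> [|a x y /= hx hy] /=; first by rewrite linear0 !p0l.
    by rewrite linearP /= !pE hx hy.
  by rewrite /= fv gc.
move=> u z; have [_ _ /(_ u)[x [s Ss ->]]] := cX.
have [_ _ /(_ z)[y [r Sr ->]]] := cY.
rewrite (linearD g) pDr (isoS _ _ Sr) (linearD f) pDl (isoS' _ _ Ss).
suff -> : p' (f (jX x)) (g (jY y)) = p (jX x) (jY y).
  by rewrite [RHS]pDr [in RHS]pDl.
have [_] := pairing_defect vw' (fj x) (gj y).
rewrite (eq_fsbigr (frame_defect x y)) => [|i _]; last first.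
  by rewrite /frame_defect /defect fc gc.
have := om x y => /subr0_eq <- /eqP; rewrite subr_eq subrK => /eqP ->.
by [].
Qed.

End TwoFrames.
End Frames.

(** * The orthogonal complement of a family and the form [ω~] *)

Section OrthogonalComplement.
Variables (C : numClosedFieldType) (V W X Y : lmodType C) (p : pairing V W).
Variables (I : choiceType) (v : I -> V) (w : I -> W).
Variables (jX : {linear X -> V}) (jY : {linear Y -> W}).
Hypothesis vw : dual_family p v w.
Hypothesis cX : complement_of (lspan (range v)) jX.
Hypothesis cY : complement_of (lspan (range w)) jY.

Definition frame_tomega x y := p (jX x) (jY y)
  - \sum_(i \in [set: I]) p (jX x) (w i) * p (v i) (jY y).

Lemma orth_lift x : (fun i => p (jX x) (w i)) ≈ (fun=> 0) ->
  exists2 u, lspan (range v) (u - jX x) & forall i, p u (w i) = 0.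
Proof.
move=> /(finite_family_span vw)[s Ss sE]; exists (jX x - s).
  by rewrite addrAC subrr add0r -scaleN1r; exact: lspanZ.
by move=> i; rewrite pBl sE subrr.
Qed.

Lemma orth_project u : (forall i, p u (w i) = 0) -> exists2 x,
  (fun i => p (jX x) (w i)) ≈ (fun=> 0) & lspan (range v) (u - jX x).
Proof.
move=> uw; have [_ _ /(_ u)[x [s Ss uE]]] := cX.
exists x; last by rewrite uE addrC addKr.
apply: sub_finite_set (family_span_finite vw Ss) => i /= h s0; apply: h.
by have := uw i; rewrite uE pDl s0 addr0.
Qed.

(** [pairing_defect] with the same vector on the right: the terms of [u] vanish, those of [jX x]
    remain and are finite in number. *)
Lemma frame_tomegaE x y u : lspan (range v) (u - jX x) ->
  (forall i, p u (w i) = 0) -> frame_tomega x y = p u (jY y).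
Proof.
move=> ux uw.
have [|fin] := @pairing_defect _ _ _ p _ v w vw u (jX x) (jY y) (jY y) ux.
  by rewrite subrr; exact: lspan0.
have dE i : defect p v w u (jX x) (jY y) (jY y) i =
    - (p (jX x) (w i) * p (v i) (jY y)).
  by rewrite /defect uw mul0r sub0r.
have [r ur rP] := finite_set_enum fin.
have d0 i : i \notin r -> defect p v w u (jX x) (jY y) (jY y) i = 0.
  by move=> ir; apply/eqP; apply: contraNT ir => /eqP; exact: rP.
rewrite (fsbigE r) //; last by move=> i _; exact: d0.
rewrite /frame_tomega (fsbigE r) //; last first.
  by move=> i _ /d0; rewrite dE => /eqP; rewrite oppr_eq0 => /eqP.
rewrite (eq_bigr (fun i => - (p (jX x) (w i) * p (v i) (jY y)))) => [|i _].
  by rewrite sumrN => /eqP; rewrite subr_eq addrC => /eqP.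
exact: dE.
Qed.

Lemma orth_pairing x u z y : lspan (range v) (u - jX x) ->
  (forall i, p u (w i) = 0) -> lspan (range w) (z - jY y) ->
  p u z = frame_tomega x y.
Proof.
move=> ux uw zy; rewrite (frame_tomegaE y ux uw).
apply/eqP; rewrite -subr_eq0 -pBr; apply/eqP.
apply: (lspan_min (S := [set z | p u z = 0])) zy => [|_ [i _ <-]]; last exact: uw.
by split=> [|a z1 z2 /= h1 h2]; rewrite /= ?p0r // pDr pZr h1 h2 mulr0 addr0.
Qed.

Lemma orth_eq0 u : lspan (range v) u -> (forall i, p u (w i) = 0) -> u = 0.
Proof. exact: family_span_eq0. Qed.

(** A vector of the left radical is orthogonal to the family, so it is the lift of some [x] in
    [X_0], and its pairings with [W] are the values of [ω~] at [x]. *)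
Lemma frame_nondegl :
  (forall u, (forall z, p u z = 0) -> u = 0) <->
  (forall x, (fun i => p (jX x) (w i)) ≈ (fun=> 0) -> x <> 0 ->
     exists y, frame_tomega x y <> 0).
Proof.
split=> [nd x x0 xN0|nd u u0].
  have [u ux uw] := orth_lift x0.
  apply: contrapT => /forallNP no; apply: xN0.
  have uE : u = 0.
    apply: nd => z; have [_ _ /(_ z)[y [r Sr zE]]] := cY.
    rewrite (orth_pairing ux uw (y := y)); first by have /contrapT := no y.
    by rewrite zE addrC addKr.
  have [j_inj jS _] := cX; apply: j_inj; rewrite linear0.
  have : (range jX `&` lspan (range v)) (jX x).
    split; first by exists x.
    by move: ux; rewrite uE sub0r => /(lspanZ (-1)); rewrite scaleN1r opprK.
  by rewrite jS.
have uw i : p u (w i) = 0 by exact: u0.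
have [x x0 ux] := orth_project uw.
have [xE|/eqP xN0] := eqVneq x 0.
  by apply: orth_eq0 => //; move: ux; rewrite xE linear0 subr0.
by have [y] := nd x x0 xN0; rewrite (frame_tomegaE y ux uw) u0.
Qed.

End OrthogonalComplement.

Section Rescaling.
Variables (C : numClosedFieldType) (I : choiceType) (s : I -> I) (b : I -> C).
Hypotheses (s_bij : bijective s) (b0 : forall i, b i != 0).

Lemma lspan_rescale (V : lmodType C) (v : I -> V) :
  lspan (range (fun i => b i *: v (s i))) = lspan (range v).
Proof.
have [s' sK s'K] := s_bij; apply: lspan_eq => _ [i _ <-].
  by apply: lspanZ; apply: sub_lspan; exists (s i).
rewrite -[v i]scale1r -(mulVf (b0 (s' i))) -scalerA; apply: lspanZ.
by apply: sub_lspan; exists (s' i); rewrite ?s'K.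
Qed.

Lemma dual_family_rescale (V W : lmodType C) (p : pairing V W) v w :
  dual_family p v w ->
  dual_family p (fun i => b i *: v (s i)) (fun i => (b i)^-1 *: w (s i)).
Proof.
move=> vw i j; rewrite pZl pZr vw (bij_eq s_bij).
by have [->|] := eqVneq i j; rewrite ?mulr0 // mulr1 mulfV.
Qed.

End Rescaling.

Section Classes.
Variables (A B : Type) (eqA : A -> A -> Prop) (eqB : B -> B -> Prop).

Definition equivalence_on (T : Type) (e : T -> T -> Prop) :=
  [/\ forall x, e x x, forall x y, e x y -> e y x
    & forall x y z, e x y -> e y z -> e x z].

Lemma class_eq (T : Type) (e : T -> T -> Prop) x y :
  equivalence_on e -> e x = e y <-> e x y.
Proof.
move=> [er es et]; split=> [->|xy]; first exact: er.
by apply/funext => z; apply/propext; split; apply: et; [exact: es|].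
Qed.

Lemma induces_bijectionI (r : A -> B -> Prop) (PA QA : A -> Prop)
    (PB QB : B -> Prop) :
  equivalence_on eqA -> equivalence_on eqB ->
  (forall a, PA a -> exists b, r a b) ->
  (forall a b, r a b -> PA a /\ PB b) ->
  (forall b, PB b -> exists a, r a b) ->
  (forall a a' b b', r a b -> r a' b' -> (eqA a a' <-> eqB b b')) ->
  (forall a, QA a -> PA a) ->
  (forall b, QB b -> PB b) ->
  (forall a b, r a b -> (QA a <-> QB b)) ->
  induces_bijection eqA eqB r PA QA PB QB.
Proof.
move=> eA eB rA rP rB rE QP QPB QE.
have cA a a' : eqA a = eqA a' <-> eqA a a' := class_eq a a' eA.
have cB b b' : eqB b = eqB b' <-> eqB b b' := class_eq b b' eB.
(* The union of the classes of all [b] related to a representative of [c]; no representative has to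
   be chosen. *)
pose phi (c : A -> Prop) (d : B) := exists a b, [/\ c = eqA a, r a b & eqB b d].
have phiE a b : r a b -> phi (eqA a) = eqB b.
  move=> rab; apply/funext => d; apply/propext; split=> [[a' [b' [E r' bd]]]|bd].
    have [_ _ et] := eB; apply: et bd.
    by apply/(rE a a' b b' rab r')/cA.
  by exists a, b.
exists phi; split; first split.
- move=> _ [a /rA[b rab] ->]; exists b; first by case: (rP _ _ rab).
  exact: phiE.
- move=> _ _ [a /rA[b rab] ->] [a' /rA[b' rab'] ->].
  by rewrite (phiE _ _ rab) (phiE _ _ rab') => /cB/(rE _ _ _ _ rab rab')/cA.
- move=> _ [b /rB[a rab] ->]; exists (eqA a); last exact: phiE.
  by exists a => //; case: (rP _ _ rab).
- move=> _ d [a /rA[b rab] ->]; rewrite (phiE _ _ rab); split.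
    move=> [a' [b' [/cA E -> rab']]].
    by apply/cB/(rE _ _ _ _ rab rab').
  by move=> <-; exists a, b.
- by move=> _ [a Qa ->]; exists a => //; exact: QP.
- move=> d; split=> [[b Qb ->]|[_ [a Qa ->] <-]].
    have [a rab] := rB b (QPB _ Qb).
    exists (eqA a); last exact: phiE.
    by exists a => //; apply/(QE _ _ rab).
  have [b rab] := rA a (QP _ Qa).
  by exists b; [apply/(QE _ _ rab)|exact: phiE].
Qed.

End Classes.

(** * The general and special linear Lie algebras *)

Section TensorMaps.
Variables (C : numClosedFieldType) (V W : lmodType C) (p : pairing V W).
Variable T : tensor_product V W.

Lemma tmap_ext (F G : {linear T -> T}) :
  (forall v w, F (tens T v w) = G (tens T v w)) -> F =1 G.
Proof. exact: tlift_unique. Qed.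

Lemma tmapK (f f' : {linear V -> V}) (g g' : {linear W -> W}) :
  cancel f f' -> cancel g g' -> cancel (tmap T f g) (tmap T f' g').
Proof.
move=> fK gK a; apply: (tmap_ext (F := tmap T f' g' \o tmap T f g) (G := idfun)).
by move=> v w; rewrite /= !tmapE fK gK.
Qed.

Lemma tmap_id_image (t : set T) : tmap T idfun idfun @` t = t.
Proof.
have idE : tmap T idfun idfun =1 id.
  by apply: (tmap_ext (G := idfun)) => v w; rewrite tmapE.
by apply/seteqP; split=> [_ [a ta <-]|a ta]; [rewrite idE|exists a].
Qed.

Lemma tmap_image_can (f f' : {linear V -> V}) (g g' : {linear W -> W}) (t : set T) :
  cancel f f' -> cancel g g' -> tmap T f' g' @` (tmap T f g @` t) = t.
Proof.
move=> fK gK; apply/seteqP; split=> [_ [_ [a ta <-] <-]|a ta].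
  by rewrite tmapK.
by exists (tmap T f g a); [exists a|rewrite tmapK].
Qed.

Lemma tmap_image_comp (f f' : {linear V -> V}) (g g' : {linear W -> W}) (t : set T) :
  tmap T f' g' @` (tmap T f g @` t) = tmap T (f' \o f) (g' \o g) @` t.
Proof.
have E : tmap T f' g' \o tmap T f g =1 tmap T (f' \o f) (g' \o g).
  apply: (tmap_ext (F := tmap T f' g' \o tmap T f g)
    (G := tmap T (f' \o f) (g' \o g))) => v w.
  by rewrite /= !tmapE.
apply/seteqP; split=> [_ [_ [a ta <-] <-]|_ [a ta <-]].
  by exists a; rewrite -?E.
by exists (tmap T f g a); [exists a|rewrite -E].
Qed.

Lemma tmap_mul (f : {linear V -> V}) (g : {linear W -> W}) (a b : T) :
  (forall v w, p (f v) (g w) = p v w) ->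
  tmap T f g (tmul p a b) = tmul p (tmap T f g a) (tmap T f g b).
Proof.
move=> iso.
have act (c : T) x : tact p (tmap T f g c) (f x) = f (tact p c x).
  apply: (tens_ind (S := [set c | tact p (tmap T f g c) (f x) = f (tact p c x)]))
      => [|v w] /=.
    split=> [|k c1 c2 /= h1 h2] /=; first by rewrite linear0 !tact0 linear0.
    by rewrite linearP !tactP linearP h1 h2.
  by rewrite tmapE !tactE iso linearZ.
apply: (tens_ind (S := [set b | tmap T f g (tmul p a b) =
  tmul p (tmap T f g a) (tmap T f g b)])) => [|v w] /=.
  split=> [|k b1 b2 /= h1 h2] /=; first by rewrite /tmul !linear0.
  by rewrite /tmul !linearP /= -/(tmul p a b1) -/(tmul p a b2) h1 h2.
by rewrite /tmul !tmapE /= act.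
Qed.

Lemma tmap_bracket (f : {linear V -> V}) (g : {linear W -> W}) (a b : T) :
  (forall v w, p (f v) (g w) = p v w) ->
  tmap T f g (bracket p a b) = bracket p (tmap T f g a) (tmap T f g b).
Proof. by move=> iso; rewrite linearB /= !tmap_mul. Qed.

(** Both algebras are treated at once through three properties: they are subspaces, contain all
    brackets and are preserved by isometries. *)
Definition gl_or_sl (g : set T) := g = gl_algebra T \/ g = sl_algebra p T.

Lemma subspace_gl_or_sl g : gl_or_sl g -> subspace g.
Proof. by move=> [->|->]; [exact: subspaceT|exact: subspace_lspan]. Qed.

Lemma gl_or_sl_bracket g a b : gl_or_sl g -> g (bracket p a b).
Proof.
by move=> [->|->] //; apply: sub_lspan; exists a => //; exists b.
Qed.

Lemma tmap_gl_or_sl g (f : {linear V -> V}) (h : {linear W -> W}) :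
  gl_or_sl g -> bijective f -> bijective h ->
  (forall v w, p (f v) (h w) = p v w) -> tmap T f h @` g = g.
Proof.
move=> gg /linear_inverse[f' [fK fK']] /linear_inverse[h' [hK hK']] iso.
have iso' v w : p (f' v) (h' w) = p v w by rewrite -iso fK' hK'.
have sub (f1 : {linear V -> V}) (h1 : {linear W -> W}) :
      (forall v w, p (f1 v) (h1 w) = p v w) -> tmap T f1 h1 @` g `<=` g.
  move=> iso1; case: gg => -> //; rewrite /sl_algebra lspan_image.
  apply: lspan_mono => _ [_ [a _ [b _ <-]] <-].
  by exists (tmap T f1 h1 a) => //; exists (tmap T f1 h1 b); rewrite // tmap_bracket.
apply/seteqP; split; first exact: sub.
move=> a ga; exists (tmap T f' h' a); last exact: tmapK.
by apply: (sub f' h' iso'); exists a.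
Qed.

Lemma tmap_diag (K : choiceType) (v : K -> V) (w : K -> W)
    (f : {linear V -> V}) (h : {linear W -> W}) :
  tmap T f h @` diag_set T v w = diag_set T (fun k => f (v k)) (fun k => h (w k)).
Proof. by apply: image_lspan_family => k; rewrite tmapE. Qed.

Lemma diag_rescale (K : choiceType) (v : K -> V) (w : K -> W) (s : K -> K)
    (b : K -> C) : bijective s -> (forall k, b k != 0) ->
  diag_set T (fun k => b k *: v (s k)) (fun k => (b k)^-1 *: w (s k)) =
  diag_set T v w.
Proof.
move=> s_bij b0; rewrite /diag_set.
rewrite (_ : (fun k => _) = (fun k => tens T (v (s k)) (w (s k)))).
  apply: lspan_eq => _ [k _ <-]; first by apply: sub_lspan; exists (s k).
  have [s' sK s'K] := s_bij; apply: sub_lspan; exists (s' k) => //.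
  by rewrite s'K.
by apply/funext => k; rewrite tensZl tensZr scalerA mulfV // scale1r.
Qed.

(** Only differences are asked for, so that the criterion also serves sl. The difference for [j] and
    [k] has weights 1 at [j], -1 at [k] and 0 elsewhere. *)
Lemma diag_separating (K : choiceType) (v : K -> V) (w : K -> W) (t : set T) :
  dual_family p v w -> (forall k : K, exists j, j <> k) ->
  (forall j k, j <> k -> t (tens T (v j) (w j) - tens T (v k) (w k))) ->
  separating p v w t.
Proof.
move=> vw K2 th.
have E j k l : weight p v w (tens T (v j) (w j) - tens T (v k) (w k)) l =
    (j == l)%:R - (k == l)%:R.
  rewrite /weight tactB !tactE pBl !pZl !vw ![l == _]eq_sym.
  by case: (j == l) (k == l) => [] []; rewrite ?mulr0 ?mulr1.
have two0 : 1 <> -1 :> C.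
  by move=> /eqP; rewrite -subr_eq0 opprK -mulr2n pnatr_eq0.
split=> [j k jk|j].
  exists (tens T (v j) (w j) - tens T (v k) (w k)); first exact: th.
  move/eqP/negbTE: jk => jk.
  by rewrite !E !eqxx [k == j]eq_sym jk subr0 sub0r.
have [k kj] := K2 j; exists (tens T (v j) (w j) - tens T (v k) (w k)).
  by apply: th => jk; case: kj.
by rewrite E eqxx; move/eqP: kj => /negbTE ->; rewrite subr0; apply/eqP/oner_neq0.
Qed.

(** It is the bracket of [v_j ⊗ w_k] and [v_k ⊗ w_j]. *)
Lemma dual_family_difference (K : choiceType) (v : K -> V) (w : K -> W) g j k :
  dual_family p v w -> gl_or_sl g ->
  g (tens T (v j) (w j) - tens T (v k) (w k)).
Proof.
move=> vw gg.
have := gl_or_sl_bracket (tens T (v j) (w k)) (tens T (v k) (w j)) gg.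
by rewrite /bracket !tmulE !vw !eqxx !scale1r.
Qed.

End TensorMaps.

(** * Linear data as frames: nondegeneracy and equivalence *)

Section GlFrames.
Variable C : numClosedFieldType.

Definition gl_frame (V W : lmodType C) (p : pairing V W) (D : gl_datum C)
    (jX : {linear glX D -> V}) (jY : {linear glY D -> W}) (v : nat -> V)
    (w : nat -> W) :=
  [/\ dual_family p v w, complement_of (lspan (range v)) jX,
      complement_of (lspan (range w)) jY &
      [/\ forall x y, gl_omega D x y = p (jX x) (jY y),
          forall i x, gl_lambda D i x = p (jX x) (w i)
        & forall i y, gl_mu D i y = p (v i) (jY y)]].

Lemma gl_tomega_frame (V W : lmodType C) (p : pairing V W) D jX jY v w x y :
  @gl_frame V W p D jX jY v w -> gl_tomega x y = frame_tomega p v w jX jY x y.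
Proof.
move=> [_ _ _ [om la mu]]; rewrite /gl_tomega /frame_tomega om; congr (_ - _).
by apply: eq_fsbigr => i _; rewrite la mu.
Qed.

Lemma glX0_frame (V W : lmodType C) (p : pairing V W) D jX jY v w :
  @gl_frame V W p D jX jY v w ->
  @glX0 _ D = [set x | (fun i => p (jX x) (w i)) ≈ (fun=> 0)].
Proof.
move=> [_ _ _ [_ la _]]; apply/seteqP; split=> x;
  apply: sub_finite_set => i /=; by rewrite la.
Qed.

Lemma glY0_frame (V W : lmodType C) (p : pairing V W) D jX jY v w :
  @gl_frame V W p D jX jY v w ->
  @glY0 _ D = [set y | (fun i => p (v i) (jY y)) ≈ (fun=> 0)].
Proof.
move=> [_ _ _ [_ _ mu]]; apply/seteqP; split=> x;
  apply: sub_finite_set => i /=; by rewrite mu.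
Qed.

Lemma frame_tomega_flip (V W X Y : lmodType C) (p : pairing V W)
    (v : nat -> V) (w : nat -> W) (jX : {linear X -> V}) (jY : {linear Y -> W}) x y :
  frame_tomega (flip_pairing p) w v jY jX y x = frame_tomega p v w jX jY x y.
Proof.
by rewrite /frame_tomega; congr (_ - _); apply: eq_fsbigr => i _; rewrite mulrC.
Qed.

Lemma gl_frame_nondegenerate (V W : lmodType C) (p : pairing V W) D jX jY v w :
  @gl_frame V W p D jX jY v w -> nondegenerate_pairing p <-> gl_nondegenerate D.
Proof.
move=> fr; have [vw cX cY _] := fr.
have L := frame_nondegl vw cX cY.
have R := frame_nondegl (dual_family_flip vw) cY cX.
rewrite /gl_nondegenerate (glX0_frame fr) (glY0_frame fr).
split=> [[pl pr]|[nl nr]]; split.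
- move=> x x0 xN0; have [y xy] := L.1 pl x x0 xN0.
  by exists y; rewrite (gl_tomega_frame _ _ fr).
- move=> y y0 yN0; have [x xy] := R.1 pr y y0 yN0.
  by exists x; rewrite (gl_tomega_frame _ _ fr) -frame_tomega_flip.
- apply/L => x x0 xN0; have [y xy] := nl x x0 xN0.
  by exists y; rewrite -(gl_tomega_frame _ _ fr).
- apply: R.2 => y y0 yN0; have [x xy] := nr y y0 yN0.
  by exists x; rewrite frame_tomega_flip -(gl_tomega_frame _ _ fr).
Qed.

(** From data to maps, [f] and [g] are lifted independently, each preserving the coordinates of its
    own side; the condition on [ω~] then makes the pair an isometry. *)
Lemma gl_equivalent_frames (V W V' W' : lmodType C) (p : pairing V W)
    (p' : pairing V' W') D D' jX jY v w jX' jY' v' w' :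
  @gl_frame V W p D jX jY v w -> @gl_frame V' W' p' D' jX' jY' v' w' ->
  gl_equivalent D D' <->
  exists (f : {linear V -> V'}) (g : {linear W -> W'}) (s : nat -> nat)
    (b : nat -> C), [/\ bijective f /\ bijective g, bijective s,
      forall u z, p' (f u) (g z) = p u z, forall i, b i != 0 &
      forall i, f (v i) = b i *: v' (s i) /\ g (w i) = (b i)^-1 *: w' (s i)].
Proof.
move=> [vw cX cY [om la mu]] [vw' cX' cY' [om' la' mu']]; split.
  move=> [s [qX [qY [al [[s_bij qXb qYb] al0 lE mE oE]]]]].
  (* [λ_i] is the pairing with [w i], which scales inversely to [v i]; hence the inverse of
     [α_i]. *)
  pose b i := (al i)^-1; have b0 i : b i != 0 by rewrite invr_eq0.
  pose v2 i := b i *: v' (s i); pose w2 i := (b i)^-1 *: w' (s i).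
  have vw2 : dual_family p' v2 w2 := dual_family_rescale s_bij b0 vw'.
  have cX2 : complement_of (lspan (range v2)) jX' by rewrite lspan_rescale.
  have cY2 : complement_of (lspan (range w2)) jY'.
    by rewrite (lspan_rescale s_bij) // => i; rewrite invr_eq0.
  have [|f [fb fc fj fv]] := frame_lift_bij vw vw2 cX cX2 qXb.
    move=> x; apply: sub_finite_set (lE x) => i /= h E; apply: h.
    by rewrite -la E pZr invrK la'.
  have [|g [gb gc gj gw]] :=
    frame_lift_bij (dual_family_flip vw) (dual_family_flip vw2) cY cY2 qYb.
    move=> y; apply: sub_finite_set (mE y) => i /= h E; apply: h.
    by rewrite /flip_pairing_fun -mu E pZl mu'.
  exists f, g, s, b; split=> //.
  apply: (frame_data_isometry vw2 cX cY fj gj fv gw fc) => [z i|x y].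
    exact: gc.
  rewrite -om -om' -{}[RHS](oE x y); congr (_ - _); apply: eq_fsbigr => i _.
  rewrite /frame_defect -la -mu pZl pZr -la' -mu'; congr (_ - _).
  by rewrite mulrACA mulVf // mul1r mulrC.
move=> [f [g [s [b [[fb gb] s_bij iso b0 fg]]]]].
pose v2 i := b i *: v' (s i); pose w2 i := (b i)^-1 *: w' (s i).
have vw2 : dual_family p' v2 w2 := dual_family_rescale s_bij b0 vw'.
have fv i : f (v i) = v2 i by case: (fg i).
have gw i : g (w i) = w2 i by case: (fg i).
have Sv : lspan (range v2) = lspan (range v') by rewrite lspan_rescale.
have Sw : lspan (range w2) = lspan (range w').
  by rewrite (lspan_rescale s_bij) // => i; rewrite invr_eq0.
have [|qX qXb fj] := frame_projection (j' := jX') fb fv cX; first by rewrite Sv.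
have [|qY qYb gj] := frame_projection (j' := jY') gb gw cY; first by rewrite Sw.
have [lE mE _ oE] := isometry_frame_data vw2 fj gj fv gw iso.
exists s, qX, qY, (fun i => (b i)^-1); split=> //.
- by move=> i; rewrite invr_eq0.
- move=> x; apply: sub_finite_set (lE x) => i /= h E; apply: h.
  by rewrite la E pZr la'.
- move=> y; apply: sub_finite_set (mE y) => i /= h E; apply: h.
  by rewrite mu E pZl invrK mu'.
- move=> x y; rewrite om om' -[RHS](oE x y); congr (_ - _).
  apply: eq_fsbigr => i _; rewrite /frame_defect la mu pZl pZr la' mu'.
  by rewrite [in RHS]mulrACA mulVf // mul1r.
Qed.

End GlFrames.

Section CoefficientPairing.
Variable C : numClosedFieldType.

(** Polynomials stand for finitely supported sequences, with monomials as the standard basis; [ev]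
    pairs them with arbitrary sequences. *)
Definition ev (a : nat -> C) (f : {poly C}) := \sum_(i < size f) a i * f`_i.

Lemma ev_widen n a (f : {poly C}) : (size f <= n)%N -> ev a f = \sum_(i < n) a i * f`_i.
Proof.
move=> fn; rewrite /ev (big_ord_widen n (fun i => a i * f`_i)) //.
rewrite [RHS](bigID (fun i : 'I_n => i < size f)%N) /=.
rewrite [X in _ = _ + X]big1 ?addr0 // => i; rewrite -leqNgt => fi.
by rewrite nth_default // mulr0.
Qed.

Lemma ev_scalar a : scalar (ev a).
Proof.
move=> c f g; pose n := maxn (size f) (maxn (size g) (size (c *: f + g))).
rewrite !(@ev_widen n) ?leq_max ?leqnn ?orbT // mulr_sumr -big_split.
by apply: eq_bigr => i _; rewrite /= coefD coefZ; ring.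
Qed.

Lemma evD a (f g : {poly C}) : ev a (f + g) = ev a f + ev a g.
Proof. by have := ev_scalar a 1 f g; rewrite scale1r mul1r. Qed.

Lemma evZ a c (f : {poly C}) : ev a (c *: f) = c * ev a f.
Proof.
have := ev_scalar a c f 0; rewrite addr0 => ->; rewrite {2}/ev size_poly0.
by rewrite big_ord0 addr0.
Qed.

Lemma ev0 a : ev a 0 = 0.
Proof. by rewrite /ev size_poly0 big_ord0. Qed.

Lemma evX a i : ev a 'X^i = a i.
Proof.
rewrite (@ev_widen i.+1) ?size_polyXn // big_ord_recr /= coefXn eqxx mulr1.
rewrite big1 ?add0r // => j _; rewrite coefXn.
by rewrite (ltn_eqF (ltn_ord j)) mulr0.
Qed.

Lemma ev_linearl c a b (f : {poly C}) :
  ev (fun i => c * a i + b i) f = c * ev a f + ev b f.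
Proof.
rewrite /ev mulr_sumr -big_split; apply: eq_bigr => i _.
by rewrite /= mulrDl mulrA.
Qed.

Lemma ev_ext a b (f : {poly C}) : a =1 b -> ev a f = ev b f.
Proof. by move=> ab; apply: eq_bigr => i _; rewrite ab. Qed.

Lemma evC (f g : {poly C}) : ev (fun i => f`_i) g = ev (fun i => g`_i) f.
Proof.
pose n := maxn (size f) (size g).
rewrite !(@ev_widen n) ?leq_maxl ?leq_maxr //.
by apply: eq_bigr => i _; rewrite mulrC.
Qed.

Lemma lspan_Xn (U : lmodType C) (h : {linear {poly C} -> U}) :
  lspan (range (fun i => h 'X^i)) = range h.
Proof.
have -> : range h = h @` lspan (range (fun i => 'X^i)).
  congr image; apply/esym/seteqP; split=> // q _.
  rewrite -[q]coefK poly_def; apply: lspan_sum => i _; apply: lspanZ.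
  by apply: sub_lspan; exists (i : nat).
rewrite lspan_image; congr lspan; apply/seteqP; split.
  by move=> _ [i _ <-]; exists ('X^i) => //; exists i.
by move=> _ [_ [i _ <-] <-]; exists i.
Qed.

Lemma complement_inl (X Z : lmodType C) :
  complement_of (range (inr_lin X Z)) (inl_lin X Z).
Proof.
split=> [x y [//]||[x z]].
  apply/seteqP; split=> [u [[x _ <-] [z _ [<- _]]]|_ ->] //=.
  by split; exists 0.
exists x; exists (0, z); first by exists z.
by congr pair; rewrite /= ?addr0 ?add0r.
Qed.

End CoefficientPairing.

Section GlModel.
Variables (C : numClosedFieldType) (D : gl_datum C).
Local Notation V := (glX D * {poly C})%type.
Local Notation W := (glY D * {poly C})%type.

(** The pairing with blocks [ω], [λ], [μ] and the identity: the only one for which the monomials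
    form a dual family and the summands [X] and [Y] give back the datum. *)
Definition gl_model_fun (u : V) (z : W) : C :=
  gl_omega D u.1 z.1 + ev (fun i => gl_lambda D i u.1) z.2
  + ev (fun i => gl_mu D i z.1) u.2 + ev (fun i => u.2`_i) z.2.

Fact gl_model_bilinear : bilinear_for *%R *%R gl_model_fun.
Proof.
split=> [z|u] a x y; rewrite /gl_model_fun /=.
  rewrite pDl pZl evD evZ.
  rewrite (ev_ext (b := fun i => a * gl_lambda D i x.1 + gl_lambda D i y.1)).
    rewrite ev_linearl (ev_ext (a := fun i => (a *: x.2 + y.2)`_i)
      (b := fun i => a * x.2`_i + y.2`_i)) ?ev_linearl; first by ring.
    by move=> i; rewrite coefD coefZ.
  by move=> i; rewrite linearP.
rewrite pDr pZr !evD !evZ.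
rewrite (ev_ext (a := fun i => gl_mu D i _)
  (b := fun i => a * gl_mu D i x.1 + gl_mu D i y.1)) ?ev_linearl; first by ring.
by move=> i; rewrite linearP.
Qed.

Definition gl_model : pairing V W := pairing_of gl_model_bilinear.

Lemma gl_model_frame : gl_frame gl_model (inl_lin (glX D) {poly C})
  (inl_lin (glY D) {poly C}) (fun i => inr_lin (glX D) {poly C} 'X^i)
  (fun i => inr_lin (glY D) {poly C} 'X^i).
Proof.
have l0 i : gl_lambda D i 0 = 0 by rewrite linear0.
have m0 i : gl_mu D i 0 = 0 by rewrite linear0.
split.
- move=> i j; rewrite /= /gl_model_fun /= p0l !evX l0 m0 !add0r coefXn.
  by rewrite eq_sym.
- by rewrite lspan_Xn; exact: complement_inl.
- by rewrite lspan_Xn; exact: complement_inl.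
- split=> [x y|i x|i y]; rewrite /= /gl_model_fun /=.
  + by rewrite !ev0 !addr0.
  + by rewrite p0r ev0 !evX coef0 add0r !addr0.
  + by rewrite p0l !ev0 evX add0r addr0 add0r.
Qed.

End GlModel.

Section GlEquivalence.
Variable C : numClosedFieldType.

(** Every datum has a frame in its model, so equivalence is the existence of an isometry matching
    two frames up to permutation and scaling; identities, inverses and composites of such isometries
    are of the same kind. *)
Lemma gl_equivalent_equivalence : equivalence_on (@gl_equivalent C).
Proof.
split.
- move=> D; apply/(gl_equivalent_frames (gl_model_frame D) (gl_model_frame D)).
  have id_bij (U : Type) : bijective (@id U) by exists id.
  exists idfun, idfun, id, (fun=> 1); split=> [|||i|i] //.
  + exact: oner_neq0.
  + by rewrite invr1 !scale1r.
- move=> D D' /(gl_equivalent_frames (gl_model_frame D) (gl_model_frame D')).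
  move=> [f [g [s [b [[fb gb] s_bij iso b0 fg]]]]].
  apply/(gl_equivalent_frames (gl_model_frame D') (gl_model_frame D)).
  have [f' [fK fK']] := linear_inverse fb.
  have [g' [gK gK']] := linear_inverse gb.
  have [s' sK s'K] := s_bij.
  exists f', g', s', (fun i => (b (s' i))^-1); split.
  + by split; [exists f|exists g].
  + by exists s.
  + by move=> u z; rewrite -iso fK' gK'.
  + by move=> i; rewrite invr_eq0.
  + move=> i; have [fv gw] := fg (s' i); rewrite invrK; split.
      apply: (can_inj fK); rewrite fK' linearZ /= fv scalerA mulVf //.
      by rewrite scale1r s'K.
    apply: (can_inj gK); rewrite gK' linearZ /= gw scalerA mulfV //.
    by rewrite scale1r s'K.
- move=> D D' D'' /(gl_equivalent_frames (gl_model_frame D) (gl_model_frame D')).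
  move=> [f [g [s [b [[fb gb] s_bij iso b0 fg]]]]].
  move=> /(gl_equivalent_frames (gl_model_frame D') (gl_model_frame D'')).
  move=> [f' [g' [s' [b' [[fb' gb'] s_bij' iso' b0' fg']]]]].
  apply/(gl_equivalent_frames (gl_model_frame D) (gl_model_frame D'')).
  exists (f' \o f), (g' \o g), (s' \o s), (fun i => b i * b' (s i)); split.
  + by split; apply: bij_comp.
  + exact: bij_comp.
  + by move=> u z; exact: etrans (iso' _ _) (iso _ _).
  + by move=> i; rewrite mulf_neq0.
  + move=> i; have [fv gw] := fg i; have [fv' gw'] := fg' (s i).
    rewrite /= fv gw !linearZ /= fv' gw' !scalerA; split=> //.
    by rewrite invfM.
Qed.

End GlEquivalence.

Section Transport.
Variable C : numClosedFieldType.

Lemma complement_transport (V V' X : lmodType C) (I : Type) (f : {linear V -> V'})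
    (v : I -> V) (j : {linear X -> V}) : bijective f ->
  complement_of (lspan (range v)) j ->
  complement_of (lspan (range (fun i => f (v i)))) (f \o j).
Proof.
move=> /linear_inverse[f' [fK fK']] [j_inj jS jT]; split.
- by move=> x y /= /(can_inj fK)/j_inj.
- rewrite -(image_lspan_family (f := f) (v := v)) //.
  apply/seteqP; split=> [_ [[x _ <-] [s Ss E]]|_ -> /=].
    have : (range j `&` lspan (range v)) (j x).
      by split; [exists x|rewrite -(can_inj fK E)].
    by rewrite jS /= => jx0; rewrite jx0 linear0.
  by split; exists 0; rewrite ?linear0 //; exact: lspan0.
- move=> u; have [x [s Ss uE]] := jT (f' u); exists x; exists (f s).
    by rewrite -(image_lspan_family (f := f) (v := v)) //; exists s.
  by rewrite /= -linearD -uE fK'.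
Qed.

Lemma dual_family_independent (V W : lmodType C) (p : pairing V W)
    (v : nat -> V) (w : nat -> W) : dual_family p v w -> independent v.
Proof.
move=> vw n c c0 i; have := congr1 (fun x => p x (w i)) c0.
rewrite p0l p_suml (bigD1 i) //= pZl vw eqxx mulr1 big1 ?addr0 // => j ji.
rewrite pZl vw (_ : (j : nat) == i = false) ?mulr0 //.
by apply: contraNF ji => /eqP ij; apply/eqP/val_inj.
Qed.

Lemma line_generator (V : lmodType C) (L : set V) u : line L -> L u -> u <> 0 ->
  L = [set a *: u | a in [set: C]].
Proof.
move=> [u0 u0N0 ->] [a _ <-] au0.
have a0 : a != 0 by apply: contra_notN au0 => /eqP ->; rewrite scale0r.
apply/seteqP; split=> _ [c _ <-].
  by exists (c / a); rewrite // scalerA divfK.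
by exists (c * a); rewrite // scalerA.
Qed.

Lemma line_scale (V : lmodType C) (u : V) : u <> 0 -> line [set a *: u | a in [set: C]].
Proof. by move=> /eqP u0; exists u. Qed.

Lemma complement_setT (V : lmodType C) (j : {linear 'rV[C]_0 -> V}) :
  complement_of [set: V] j.
Proof.
split=> [x y _||u].
- by rewrite [x]thinmx0 [y]thinmx0.
- apply/seteqP; split=> [_ [[x _ <-] _]|_ ->] /=.
    by rewrite [x]thinmx0 linear0.
  by split=> //; exists 0; rewrite ?linear0.
- by exists 0, u; rewrite ?linear0 ?add0r.
Qed.

Lemma countable_dim_rV0 : countable_dim 'rV[C]_0.
Proof.
by exists (fun=> 0); apply/seteqP; split=> // x _; rewrite [x]thinmx0; exact: lspan0.
Qed.

Fact zero_linear (U V : lmodType C) : linear (fun _ : U => 0 : V).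
Proof. by move=> a x y; rewrite scaler0 addr0. Qed.
Definition zero_lin (U V : lmodType C) := linear_of (@zero_linear U V).

Fact zero_scalar_subproof (U : lmodType C) : scalar (fun _ : U => 0 : C).
Proof. by move=> a x y; rewrite mulr0 addr0. Qed.
Definition zero_scalar U := scalar_of (@zero_scalar_subproof U).

Fact zero_pairing_subproof (U V : lmodType C) :
  bilinear_for *%R *%R (fun (_ : U) (_ : V) => 0 : C).
Proof. by split=> [u|v] a x y; rewrite /= mulr0 addr0. Qed.
Definition zero_pairing U V := pairing_of (@zero_pairing_subproof U V).

Fact restrict_pairing_subproof (V W X Y : lmodType C) (p : pairing V W)
    (jX : {linear X -> V}) (jY : {linear Y -> W}) :
  bilinear_for *%R *%R (fun x y => p (jX x) (jY y)).
Proof. by split=> [u|u] a x y; rewrite linearP !pE. Qed.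
Definition restrict_pairing V W X Y p jX jY :=
  pairing_of (@restrict_pairing_subproof V W X Y p jX jY).

Fact restrict_left_subproof (V W X : lmodType C) (p : pairing V W)
    (j : {linear X -> V}) w : scalar (fun x => p (j x) w).
Proof. by move=> a x y; rewrite linearP !pE. Qed.
Definition restrict_left V W X p j w :=
  scalar_of (@restrict_left_subproof V W X p j w).

Fact restrict_right_subproof (V W Y : lmodType C) (p : pairing V W)
    (j : {linear Y -> W}) v : scalar (fun y => p v (j y)).
Proof. by move=> a x y; rewrite linearP !pE. Qed.
Definition restrict_right V W Y p j v :=
  scalar_of (@restrict_right_subproof V W Y p j v).

End Transport.

Section GlCompatible.
Variables (C : numClosedFieldType) (V W : lmodType C) (p : pairing V W).
Variable T : tensor_product V W.

Lemma dual_system_family (L : nat -> set V) (L' : nat -> set W) v w :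
  dual_system p L L' ->
  (forall i, [/\ L i (v i), L' i (w i) & p (v i) (w i) = 1]) ->
  [/\ dual_family p v w, lspan (\bigcup_i L i) = lspan (range v),
      lspan (\bigcup_i L' i) = lspan (range w) &
      forall g : set T, gl_system_torus g L L' = g `&` diag_set T v w].
Proof.
move=> [lL lL' LL'] vwP.
have vw0 i : v i <> 0 /\ w i <> 0.
  have [_ _ vw1] := vwP i; split=> E; move: vw1; rewrite E ?p0l ?p0r => /eqP;
  by rewrite eq_sym oner_eq0.
have LE i : L i = [set a *: v i | a in [set: C]].
  by have [Lv _ _] := vwP i; apply: line_generator => //; case: (vw0 i).
have L'E i : L' i = [set a *: w i | a in [set: C]].
  by have [_ Lv _] := vwP i; apply: line_generator => //; case: (vw0 i).
split.
- move=> i j; have [Lv _ vw1] := vwP i; have [_ Lw _] := vwP j.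
  have [ij|ij] := eqVneq i j; first by rewrite -ij.
  have := LL' i j; rewrite (negbTE ij) => E.
  have : [set p v0 w0 | v0 in L i & w0 in L' j] (p (v i) (w j)).
    by exists (v i) => //; exists (w j).
  by rewrite E.
- apply: lspan_line => i; first by case: (vwP i).
  by move=> u; rewrite LE => -[a _ <-]; exists a.
- apply: lspan_line => i; first by case: (vwP i).
  by move=> u; rewrite L'E => -[a _ <-]; exists a.
- move=> g; rewrite /gl_system_torus; congr (g `&` _).
  apply: lspan_line => i.
    by have [Lv Lw _] := vwP i; exists (v i) => //; exists (w i).
  rewrite LE L'E => _ [_ [a _ <-] [_ [b _ <-] <-]].
  by exists (a * b); rewrite tensZl tensZr scalerA.
Qed.

Lemma family_dual_system v w : dual_family p v w ->
  exists (L : nat -> set V) (L' : nat -> set W), dual_system p L L' /\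
    forall i, L i (v i) /\ L' i (w i).
Proof.
move=> vw.
have vw0 i : v i <> 0 /\ w i <> 0.
  have := vw i i; rewrite eqxx.
  by split=> E; move: H; rewrite E ?p0l ?p0r => /eqP; rewrite eq_sym oner_eq0.
exists (fun i => [set a *: v i | a in [set: C]]),
  (fun i => [set a *: w i | a in [set: C]]); split; last first.
  by move=> i; split; exists 1; rewrite ?scale1r.
split=> [i|i|i j].
- by apply: line_scale; case: (vw0 i).
- by apply: line_scale; case: (vw0 i).
- have [ij|ij] := eqVneq i j; apply/seteqP; split=> // c.
  + move=> _; exists (c *: v i); first by exists c.
    exists (w j); first by exists 1; rewrite ?scale1r.
    by rewrite pZl vw ij eqxx mulr1.
  + move=> [_ [a _ <-] [_ [b _ <-] <-]].
    by rewrite pZl pZr vw (negbTE ij) !mulr0.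
  + move=> /= ->; exists (v i); first by exists 1; rewrite ?scale1r.
    exists (w j); first by exists 1; rewrite ?scale1r.
    by rewrite vw (negbTE ij).
Qed.

Lemma gl_submaximalP (g t : set T) : gl_submaximal p g t <->
  exists v w, dual_family p v w /\ t = g `&` diag_set T (v : nat -> V) w.
Proof.
split=> [[L [L' [LL' ->]]]|[v [w [vw ->]]]].
  have [_ _ LL'1] := LL'.
  have /choice[vw vwP] i : exists vw : V * W,
      [/\ L i vw.1, L' i vw.2 & p vw.1 vw.2 = 1].
    have := LL'1 i i; rewrite eqxx => E; have : [set: C] 1 by [].
    by rewrite -E => -[v Lv [w Lw vw1]]; exists (v, w).
  exists (fun i => (vw i).1), (fun i => (vw i).2).
  by have [? _ _ ->] := dual_system_family LL' vwP.
have [L [L' [LL' Lvw]]] := family_dual_system vw.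
exists L, L'; split=> //.
have [|_ _ _ ->] := dual_system_family LL' (v := v) (w := w); last by [].
by move=> i; have [? ?] := Lvw i; split=> //; rewrite vw eqxx.
Qed.

Lemma gl_compatibleP (g t : set T) D : gl_compatible p g t D <->
  exists jX jY v w, @gl_frame C V W p D jX jY v w /\ t = g `&` diag_set T v w.
Proof.
split.
  move=> [L [L' [LL' -> [jX [jY [v [w [[cX cY] vwP om la mu]]]]]]]].
  have [vw Lv Lw ->] := dual_system_family LL' vwP.
  exists jX, jY, v, w; split=> //; split=> //; first by rewrite -Lv.
  by rewrite -Lw.
move=> [jX [jY [v [w [[vw cX cY [om la mu]] ->]]]]].
have [L [L' [LL' Lvw]]] := family_dual_system vw.
have vwP i : [/\ L i (v i), L' i (w i) & p (v i) (w i) = 1].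
  by have [? ?] := Lvw i; split=> //; rewrite vw eqxx.
have [_ Lv Lw LE] := dual_system_family LL' vwP.
exists L, L'; split=> //.
by exists jX, jY, v, w; rewrite Lv Lw; split.
Qed.

Lemma GL_pairing_isometry (f : {linear V -> V}) (g : {linear W -> W}) :
  bijective f -> bijective g -> (forall v w, p (f v) (g w) = p v w) ->
  GL_pairing p f.
Proof.
move=> fb gb iso; split=> //.
have [g' [gK gK']] := linear_inverse gb.
apply/seteqP; split.
  move=> _ [_ [w _ <-] <-]; exists (g' w) => //.
  by apply/funext => v; rewrite /= -iso gK'.
move=> _ [w _ <-]; exists (fun v => p v (g w)); first by exists (g w).
by apply/funext => v; rewrite /= iso.
Qed.

(** [g] is bijective: as [f] stabilizes the dual image, the functional [<f ., w>] is represented by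
    some [w'], and then [g w' = w]; injectivity comes from nondegeneracy. *)
Lemma gl_conjugateP (t t' : set T) : nondegenerate_pairing p ->
  gl_conjugate p T t t' <-> exists (f : {linear V -> V}) (g : {linear W -> W}),
    [/\ bijective f, bijective g, forall v w, p (f v) (g w) = p v w
      & t' = tmap T f g @` t].
Proof.
move=> nd; split.
  move=> [f [g [[fb fE] iso ->]]]; exists f, g; split=> //.
  have [f' [fK fK']] := linear_inverse fb.
  have ex w : exists w', g w' = w.
    have : dual_image p (fun x => p x w) by exists w.
    rewrite -fE => -[_ [w0 _ <-] E].
    have : [set phi \o f | phi in dual_image p] (fun x => p (f x) w).
      by exists (fun x => p x w) => //; exists w.
    rewrite fE => -[w' _ E']; exists w'; apply: (nondegr_eq nd) => v.
    by rewrite -(fK' v) iso; exact: (congr1 (fun h => h (f' v)) E').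
  have /choice[g' gK'] := ex.
  exists g' => // w; apply: (nondegr_eq nd) => v.
  by rewrite -iso gK' iso.
move=> [f [g [fb gb iso ->]]]; exists f, g; split=> //.
exact: GL_pairing_isometry fb gb iso.
Qed.

Lemma gl_conjugate_equivalence : nondegenerate_pairing p ->
  equivalence_on (gl_conjugate p T).
Proof.
move=> nd; split.
- move=> t; apply/gl_conjugateP => //; exists idfun, idfun; split=> //.
  by rewrite tmap_id_image.
- move=> t t1 /(gl_conjugateP _ _ nd)[f [g [fb gb iso ->]]].
  apply/gl_conjugateP => //.
  have [f' [fK fK']] := linear_inverse fb.
  have [g' [gK gK']] := linear_inverse gb.
  exists f', g'; split.
  + by exists f.
  + by exists g.
  + by move=> v w; rewrite -iso fK' gK'.
  + by rewrite tmap_image_can.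
- move=> t t1 t2 /(gl_conjugateP _ _ nd)[f [g [fb gb iso ->]]].
  move=> /(gl_conjugateP _ _ nd)[f' [g' [fb' gb' iso' ->]]].
  apply/gl_conjugateP => //; exists (f' \o f), (g' \o g); split.
  + exact: bij_comp.
  + exact: bij_comp.
  + by move=> v w; exact: etrans (iso' _ _) (iso _ _).
  + by rewrite tmap_image_comp.
Qed.

End GlCompatible.

Section GlTransport.
Variable C : numClosedFieldType.

Lemma gl_frame_transport (V W V' W' : lmodType C) (p : pairing V W)
    (p' : pairing V' W') D jX jY v w (f : {linear V -> V'})
    (g : {linear W -> W'}) : @gl_frame C V W p D jX jY v w ->
  bijective f -> bijective g -> (forall u z, p' (f u) (g z) = p u z) ->
  gl_frame p' (f \o jX) (g \o jY) (fun i => f (v i)) (fun i => g (w i)).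
Proof.
move=> [vw cX cY [om la mu]] fb gb iso; split.
- by move=> i j; rewrite iso.
- exact: complement_transport.
- exact: complement_transport.
- by split=> [x y|i x|i y]; rewrite /= iso.
Qed.

Definition trivial_gl_datum : gl_datum C :=
  GlDatum (countable_dim_rV0 C) (countable_dim_rV0 C)
    (zero_pairing 'rV[C]_0 'rV[C]_0)
    (fun=> zero_scalar 'rV[C]_0) (fun=> zero_scalar 'rV[C]_0).

(* A dual basis is a frame with zero complements, so two spaces with dual bases
   are isometric because the trivial datum is equivalent to itself. *)
Lemma dual_basis_isometry (V W V' W' : lmodType C) (p : pairing V W)
    (p' : pairing V' W') e f e' f' : dual_basis p e f -> dual_basis p' e' f' ->
  exists (F : {linear V -> V'}) (G : {linear W -> W'}),
    [/\ bijective F, bijective G & forall u z, p' (F u) (G z) = p u z].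
Proof.
have fr (U Z : lmodType C) (q : pairing U Z) u z : dual_basis q u z ->
    @gl_frame C U Z q trivial_gl_datum (zero_lin 'rV[C]_0 U)
      (zero_lin 'rV[C]_0 Z) u z.
  move=> [uz uT zT]; split=> //.
  - by rewrite uT; exact: complement_setT.
  - by rewrite zT; exact: complement_setT.
  - by split=> *; rewrite /= ?p0l ?p0r.
move=> /fr b /fr b'; have [er _ _] := gl_equivalent_equivalence C.
have [F [G [s [c [[Fb Gb] _ iso _ _]]]]] :=
  (gl_equivalent_frames b b').1 (er trivial_gl_datum).
by exists F, G.
Qed.

End GlTransport.

(** * Tori of gl and sl against complement data *)

Section GlTheorem.
Variables (C : numClosedFieldType) (V W : lmodType C) (p : pairing V W).
Variable T : tensor_product V W.
Hypotheses (Vinf : countably_infinite_dim V) (Winf : countably_infinite_dim W).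
Hypothesis p_nondeg : nondegenerate_pairing p.
Variable g : set T.
Hypothesis gg : gl_or_sl p g.

Lemma standard_dual_basis : exists e f, dual_basis p e f.
Proof.
have [e [eT e_ind]] := Vinf; have [e' [e'T _]] := Winf.
by apply: (dual_basis_ex p_nondeg e_ind); [exists e|exists e'].
Qed.

Lemma gl_torus_toral (K : choiceType) (v : K -> V) (w : K -> W) :
  dual_family p v w -> toral p g (g `&` diag_set T v w).
Proof.
have [e [f ef]] := standard_dual_basis; have gsub := subspace_gl_or_sl gg.
move=> vw; split; last by move=> a [_ da]; exact: (diag_semisimple vw).
split=> [|a []//|a b [ga da] [gb db]].
  exact: subspaceI gsub (subspace_lspan _).
have -> : bracket p a b = 0.
  apply: (tact_inj ef) => x; rewrite tact0 tact_bracket.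
  by rewrite (diag_commuting vw da db) subrr.
by split; [exact: (subspace0 gsub)|exact: lspan0].
Qed.

Lemma gl_torus_separating (v : nat -> V) (w : nat -> W) : dual_family p v w ->
  separating p v w (g `&` diag_set T v w).
Proof.
move=> vw; apply: diag_separating => // [k|j k jk].
  by exists k.+1 => /esym/n_Sn.
split; first exact: (dual_family_difference j k vw gg).
by apply: lspanB; apply: sub_lspan; [exists j|exists k].
Qed.

Lemma gl_maximal_submaximal t : maximal_toral p g t -> gl_submaximal p g t.
Proof.
have [e [f ef]] := standard_dual_basis.
move=> [[[tsub tg tbr] tss] tmax].
have tc a b : t a -> t b -> commuting p a b.
  by move=> ta tb; apply: (toral_commuting (g := g) ef _ ta tb).
have [v [w [vw td]]] := commuting_semisimple_diag p_nondeg ef tsub tss tc.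
apply/gl_submaximalP; exists v, w; split=> //.
apply/esym/tmax; first exact: gl_torus_toral.
by move=> a ta; split; [exact: tg|exact: td].
Qed.

Lemma gl_submaximal_compatible t : gl_submaximal p g t ->
  exists D, gl_compatible p g t D.
Proof.
move=> /gl_submaximalP[v [w [vw tE]]].
have [e [eT _]] := Vinf; have [e' [e'T _]] := Winf.
have [X [jX [cX cjX]]] := @complement_ex _ V (lspan (range v))
  (ex_intro _ e eT) (subspace_lspan _).
have [Y [jY [cY cjY]]] := @complement_ex _ W (lspan (range w))
  (ex_intro _ e' e'T) (subspace_lspan _).
exists (GlDatum cX cY (restrict_pairing p jX jY)
  (fun i => restrict_left p jX (w i)) (fun i => restrict_right p jY (v i))).
by apply/gl_compatibleP; exists jX, jY, v, w.
Qed.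

Lemma gl_compatible_submaximal t D : gl_compatible p g t D ->
  gl_submaximal p g t /\ gl_nondegenerate D.
Proof.
move=> /gl_compatibleP[jX [jY [v [w [fr tE]]]]]; split.
  by apply/gl_submaximalP; exists v, w; case: fr.
exact/(gl_frame_nondegenerate fr).
Qed.

Lemma gl_nondegenerate_compatible D : gl_nondegenerate D ->
  exists t, gl_compatible p g t D.
Proof.
have fr := gl_model_frame D.
move=> /(gl_frame_nondegenerate fr) nd.
have [e [f ef]] := standard_dual_basis.
have [e' [f' ef']] : exists e' f', dual_basis (gl_model D) e' f'.
  have [vw _ _ _] := fr; apply: (dual_basis_ex nd (dual_family_independent vw)).
    exact: countable_dim_prod (glX_countable D) (countable_dim_poly _).
  exact: countable_dim_prod (glY_countable D) (countable_dim_poly _).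
have [F [G [Fb Gb iso]]] := dual_basis_isometry ef' ef.
have fr' := gl_frame_transport fr Fb Gb iso.
eexists; apply/gl_compatibleP; do 4!eexists; split; [exact: fr'|reflexivity].
Qed.

(** The conjugated torus still contains the differences of its diagonal tensors, so the transported
    family is separated by [t'] and [diag_set_unique] matches it with the given family of [t']. *)
Lemma gl_conjugate_equivalent t t' D D' :
  gl_compatible p g t D -> gl_compatible p g t' D' ->
  gl_conjugate p T t t' <-> gl_equivalent D D'.
Proof.
move=> /gl_compatibleP[jX [jY [v [w [fr tE]]]]].
move=> /gl_compatibleP[jX' [jY' [v' [w' [fr' tE']]]]].
have [vw _ _ _] := fr; have [vw' _ _ _] := fr'.
have tsep' := gl_torus_separating vw'; rewrite -tE' in tsep'.
split.
  move=> /(gl_conjugateP _ _ p_nondeg)[f [h [fb hb iso t'E]]].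
  apply/(gl_equivalent_frames fr fr').
  have fh : dual_family p (fun i => f (v i)) (fun i => h (w i)).
    by move=> i j; rewrite iso.
  have tsep : separating p (fun i => f (v i)) (fun i => h (w i)) t'.
    apply: diag_separating => // [k|j k jk]; first by exists k.+1 => /esym/n_Sn.
    rewrite t'E; exists (tens T (v j) (w j) - tens T (v k) (w k)).
      rewrite tE; split; first exact: (dual_family_difference j k vw gg).
      by apply: lspanB; apply: sub_lspan; [exists j|exists k].
    by rewrite linearB /= !tmapE.
  have td : t' `<=` diag_set T (fun i => f (v i)) (fun i => h (w i)).
    by rewrite t'E -tmap_diag tE => _ [a [_ da] <-]; exists a.
  have td' : t' `<=` diag_set T v' w' by rewrite tE' => a [].
  have [s [b [s_bij sb]]] := diag_set_unique p_nondeg fh td tsep vw' td' tsep'.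
  exists f, h, s, b; split=> //; first by move=> i; case: (sb i).
  by move=> i; case: (sb i).
move=> /(gl_equivalent_frames fr fr')[f [h [s [b [[fb hb] s_bij iso b0 fh]]]]].
apply/(gl_conjugateP _ _ p_nondeg); exists f, h; split=> //.
have -> : t' = tmap T f h @` g `&` tmap T f h @` diag_set T v w.
  rewrite (tmap_gl_or_sl gg) // tmap_diag tE'; congr (_ `&` _).
  rewrite -(diag_rescale T v' w' s_bij b0); congr (diag_set T _ _).
    by apply/funext => i; case: (fh i).
  by apply/funext => i; case: (fh i).
have [f' [fK fK']] := linear_inverse fb.
have [h' [hK hK']] := linear_inverse hb.
have inj := can_inj (tmapK (T := T) fK hK).
rewrite tE; apply/seteqP; split=> [_ [[a ga <-] [b' db /inj ba]]|_ [a [ga da] <-]].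
  by exists a => //; split=> //; rewrite -ba.
by split; exists a.
Qed.

Lemma gl_maximal_datum t D : gl_compatible p g t D ->
  maximal_toral p g t <-> gl_nondegenerate D /\ gl_maximal D.
Proof.
have [e [f ef]] := standard_dual_basis.
move=> cD; have [_ nd] := gl_compatible_submaximal cD.
move: cD => /gl_compatibleP[jX [jY [v [w [fr tE]]]]].
have [vw cX cY _] := fr; have vwf := dual_family_flip vw.
have tsep := gl_torus_separating vw; rewrite -tE in tsep.
have td : t `<=` diag_set T v w by rewrite tE => a [].
split=> [[ttor tmax]|[_ Dmax]].
  split=> // x y; rewrite (glX0_frame fr) (glY0_frame fr) => x0 y0.
  rewrite (gl_tomega_frame _ _ fr); apply: contrapT => xy.
  have [u ux uw] := orth_lift vw x0; have [z zy vz] := orth_lift vwf y0.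
  rewrite -(orth_pairing vw ux uw zy) in xy.
  have [z' uz' [c z'E]] := pairing_normalize xy.
  have vz' i : p (v i) z' = 0 by rewrite z'E pZr (vz i : p (v i) z = 0) mulr0.
  pose v2 (i : option nat) := if i is Some j then v j else u.
  pose w2 (i : option nat) := if i is Some j then w j else z'.
  have vw2 : dual_family p v2 w2 by move=> [i|] [j|] //=; rewrite vw.
  pose t2 := g `&` diag_set T v2 w2.
  have tt2 : t `<=` t2.
    rewrite tE => a [ga da]; split=> //; apply: lspan_mono da => _ [i _ <-].
    by exists (Some i).
  have t2t := tmax _ (gl_torus_toral vw2) tt2.
  (* Subtracting [v_0 ⊗ w_0] keeps [h] in sl. It fixes [u], whereas every element of [t] kills
     [u]. *)
  pose h := tens T u z' - tens T (v 0) (w 0).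
  have : t2 h.
    split; first exact: (dual_family_difference None (Some 0) vw2 gg).
    by apply: lspanB; apply: sub_lspan; [exists None|exists (Some 0)].
  rewrite /t2 t2t => /td dh; have [r ur hr] := diag_tact vw dh.
  have := hr u; rewrite big1 => [|i _]; last by rewrite uw mulr0 scale0r.
  rewrite tactB !tactE uz' uw scale0r subr0 scale1r => u0.
  by move: uz'; rewrite u0 p0l => /eqP; rewrite eq_sym oner_eq0.
have ttor : toral p g t by rewrite tE; exact: gl_torus_toral.
split=> // t' t'tor tt'; apply/seteqP; split=> // a ta.
have [[_ t'g _] t'ss] := t'tor.
have ac b : t b -> commuting p a b.
  by move=> tb; apply: (toral_commuting ef t'tor ta); exact: tt'.
have [da|[u [z [c [c0 uz uvwz _ _]]]]] :=
  centralizer_dichotomy ef vw td tsep (t'ss _ ta) ac.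
  by rewrite tE; split=> //; exact: t'g.
have [x x0 ux] := orth_project vw cX (fun k => (uvwz k).1).
have [y y0 zy] := orth_project vwf cY (fun k => (uvwz k).2).
have := Dmax x y; rewrite (glX0_frame fr) (glY0_frame fr) => /(_ x0 y0).
rewrite (gl_tomega_frame _ _ fr).
rewrite -(orth_pairing vw ux (fun k => (uvwz k).1) zy) uz => /eqP.
by rewrite oner_eq0.
Qed.

Theorem gl_bijection : induces_bijection (gl_conjugate p T) (@gl_equivalent C)
  (gl_compatible p g) (gl_submaximal p g) (maximal_toral p g)
  (@gl_nondegenerate C) (fun D => gl_nondegenerate D /\ gl_maximal D).
Proof.
apply: induces_bijectionI.
- exact: gl_conjugate_equivalence.
- exact: gl_equivalent_equivalence.
- exact: gl_submaximal_compatible.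
- exact: gl_compatible_submaximal.
- exact: gl_nondegenerate_compatible.
- exact: gl_conjugate_equivalent.
- exact: gl_maximal_submaximal.
- by move=> D [].
- exact: gl_maximal_datum.
Qed.

End GlTheorem.

(** * The orthogonal and symplectic Lie algebras *)

Section NonzeroIntegers.

Lemma nzoppK : involutive nzopp.
Proof. by move=> i; apply: val_inj; rewrite /= opprK. Qed.

Lemma nzopp_inj : injective nzopp.
Proof. exact: can_inj nzoppK. Qed.

Lemma nzopp_neq (i : nzint) : nzopp i != i.
Proof.
apply/negP => /eqP/(congr1 val)/= /eqP; rewrite eq_sym -subr_eq0 opprK -mulr2n.
by rewrite mulrn_eq0 /= (negbTE (valP i)).
Qed.

Lemma nzopp_pos (i : nzint) : (0 < val (nzopp i)) = ~~ (0 < val i).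
Proof. by rewrite /= oppr_gt0 -leNgt le_eqVlt (negbTE (valP i)). Qed.

Definition nzpos (n : nat) : nzint := exist _ n.+1%:Z isT.

Definition nzrank (i : nzint) : nat := `|val i|%N.-1.

Lemma nzrank_opp i : nzrank (nzopp i) = nzrank i.
Proof. by rewrite /nzrank /= abszN. Qed.

Lemma nzrankK i : 0 < val i -> nzpos (nzrank i) = i.
Proof.
move=> i0; apply: val_inj; rewrite /= /nzrank prednK ?absz_gt0 ?(valP i) //.
by rewrite gtz0_abs.
Qed.

(** Dual families for a form are indexed by all nonzero integers, while the formal sums of a datum
    run over positive ones; this folds the former onto the latter. *)
Lemma nzint_sum (R : zmodType) (F : nzint -> R) : finite_set [set i | F i <> 0] ->
  \sum_(i \in [set: nzint]) F i = \sum_(i \in nzpositive) (F i + F (nzopp i)).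
Proof.
move=> /finite_set_enum[r ur rF].
pose q := undup (r ++ map nzopp r); have uq : uniq q := undup_uniq _.
have q_opp i : (nzopp i \in q) = (i \in q).
  have mem_opp j : (nzopp j \in map nzopp r) = (j \in r).
    by rewrite (mem_map nzopp_inj).
  by rewrite !mem_undup !mem_cat mem_opp -[in RHS](nzoppK i) mem_opp nzoppK orbC.
have qF i : i \notin q -> F i = 0.
  by move=> iq; apply/eqP; apply: contraNT iq => /eqP/rF ir; rewrite mem_undup mem_cat ir.
rewrite (fsbigE q) //; last by move=> i _; exact: qF.
pose q' := [seq i <- q | 0 < val i].
have q'pos : [set` q'] `<=` nzpositive by move=> i /=; rewrite mem_filter => /andP[].
have q'0 i : nzpositive i -> i \notin q' -> F i + F (nzopp i) = 0.
  move=> i0; rewrite mem_filter (i0 : 0 < val i) /= => iq.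
  by rewrite !qF ?q_opp // addr0.
rewrite (fsbigE q' _ (filter_uniq _ uq) q'pos q'0).
rewrite (eq_bigl xpredT) => [|i]; last by rewrite in_setT.
have -> : \sum_(i <- q' | i \in nzpositive) (F i + F (nzopp i)) =
    \sum_(i <- q') (F i + F (nzopp i)).
  rewrite big_seq_cond [RHS]big_seq; apply: eq_bigl => i.
  case: (boolP (i \in q')) => //=; rewrite mem_filter => /andP[i0 _].
  exact/mem_set.
rewrite big_split /= (bigID (fun i : nzint => 0 < val i)) /= -big_filter -/q'.
congr (_ + _); rewrite -(big_map nzopp xpredT F) -big_filter.
apply: perm_big; apply: uniq_perm.
- exact: filter_uniq.
- by rewrite (map_inj_uniq nzopp_inj) filter_uniq.
move=> i; rewrite -(nzoppK i) (mem_map nzopp_inj) !mem_filter q_opp.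
by rewrite nzoppK nzopp_pos.
Qed.

End NonzeroIntegers.

(** * Self-dual families and their tori *)

Section SelfDual.
Variables (C : numClosedFieldType) (k : form_kind).
Local Notation eps := (Defs.form_sign C k).

(** The value of [<v_i, v_{-i}>] when it is normalized to 1 for positive [i]. *)
Definition sgn_eps (i : nzint) : C := if 0 < val i then 1 else eps.

Lemma sgn_eps_sqr i : sgn_eps i * sgn_eps i = 1.
Proof. by rewrite /sgn_eps; case: ifP; rewrite ?mulr1 // form_sign_sqr. Qed.

Lemma sgn_eps_neq0 i : sgn_eps i != 0.
Proof. by rewrite /sgn_eps; case: ifP; rewrite ?oner_neq0 // form_sign_neq0. Qed.

Lemma sgn_eps_opp i : sgn_eps (nzopp i) = eps * sgn_eps i.
Proof.
by rewrite /sgn_eps nzopp_pos; case: (0 < _); rewrite /= ?mulr1 ?form_sign_sqr.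
Qed.

Lemma sgn_eps_nzsg i : sgn_eps i = if k is Orthogonal then 1 else nzsg C i.
Proof.
rewrite /sgn_eps /nzsg; case: k => /=; first by case: ifP.
case: ltgtP (valP i) => // i0 _; first by rewrite gtr0_sg // mulr1z.
by rewrite ltr0_sg // mulrN1z.
Qed.

Variables (V : lmodType C) (p : pairing V V) (T : tensor_product V V).
Hypothesis p_sym : form_symmetric k p.

Definition self_dual (v : nzint -> V) :=
  forall i j, p (v i) (v j) = if i == nzopp j then sgn_eps i else 0.

(** The left half of a dual family whose right half is [v]: with [v] on the right, the coordinates
    are the functionals [λ_i = <., v_i>]. *)
Definition twist (v : nzint -> V) (i : nzint) := sgn_eps (nzopp i) *: v (nzopp i).

Lemma twist_dual v : self_dual v -> dual_family p (twist v) v.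
Proof.
move=> vP i j; rewrite pZl vP (inj_eq nzopp_inj).
by case: eqVneq => _; rewrite ?mulr0 // sgn_eps_sqr.
Qed.

Lemma twist_opp v i : twist v (nzopp i) = sgn_eps i *: v i.
Proof. by rewrite /twist nzoppK. Qed.

Lemma twistK v i : v i = sgn_eps i *: twist v (nzopp i).
Proof. by rewrite twist_opp scalerA sgn_eps_sqr scale1r. Qed.

Lemma lspan_twist v : lspan (range (twist v)) = lspan (range v).
Proof.
apply: lspan_eq => _ [i _ <-].
  by apply: lspanZ; apply: sub_lspan; exists (nzopp i).
by rewrite twistK; apply: lspanZ; apply: sub_lspan; exists (nzopp i).
Qed.

Lemma self_dual_scaling v s (b : nzint -> C) : self_dual v ->
  self_dual (fun i => b i *: v (s i)) ->
  (forall i, s (nzopp i) = nzopp (s i)) /\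
  (forall i, b i * b (nzopp i) = sgn_eps i * sgn_eps (s i)).
Proof.
move=> vP v2P.
have s_opp i : s (nzopp i) = nzopp (s i).
  have := v2P (nzopp i) i; rewrite pZl pZr vP eqxx.
  case: eqVneq => // _; rewrite !mulr0 => /eqP.
  by rewrite eq_sym (negbTE (sgn_eps_neq0 _)).
split=> // i.
have := v2P i (nzopp i); rewrite pZl pZr vP s_opp !nzoppK !eqxx => <-.
by rewrite -!mulrA sgn_eps_sqr mulr1.
Qed.

Lemma twist_linear (V' : lmodType C) (f : {linear V -> V'}) v i :
  f (twist v i) = sgn_eps (nzopp i) *: f (v (nzopp i)).
Proof. by rewrite linearZ. Qed.

Definition form_torus (v : nzint -> V) : set T :=
  lspan [set form_tens k T (v i) (v (nzopp i)) | i in nzpositive].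

Definition hyp_torus (K : Type) (a b : K -> V) : set T :=
  lspan (range (fun n => form_tens k T (a n) (b n))).

Lemma form_torus_hyp v :
  form_torus v = hyp_torus (fun n => v (nzpos n)) (fun n => v (nzopp (nzpos n))).
Proof.
congr lspan; apply/seteqP; split=> [_ [i i0 <-]|_ [n _ <-]].
  by exists (nzrank i); rewrite // nzrankK.
by exists (nzpos n).
Qed.

Lemma self_dual_hyp v : self_dual v ->
  hyp_family p (fun n => v (nzpos n)) (fun n => v (nzopp (nzpos n))).
Proof.
move=> vP i j; rewrite !vP !nzoppK.
have E n m : (nzpos n == nzopp (nzpos m)) = false.
  by apply/eqP => /(congr1 val).
rewrite [nzopp _ == _]eq_sym !E /sgn_eps /=; split=> //.
by rewrite -val_eqE /= eqz_nat eqSS; case: eqP.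
Qed.

Definition hyp_self_dual (a b : nat -> V) (i : nzint) : V :=
  if 0 < val i then a (nzrank i) else b (nzrank i).

Lemma hyp_self_dualP a b : hyp_family p a b -> self_dual (hyp_self_dual a b).
Proof.
move=> ab i j; rewrite /hyp_self_dual /sgn_eps.
have key (x y : nzint) : 0 < val x -> 0 < val y -> (x == y) = (nzrank x == nzrank y).
  move=> x0 y0; apply/eqP/eqP => [->//|E].
  by rewrite -(nzrankK x0) -(nzrankK y0) E.
have [h1 h2 h3] := ab (nzrank i) (nzrank j).
have [h1' _ _] := ab (nzrank j) (nzrank i).
have [i0|i0] := boolP (0 < val i); have [j0|j0] := boolP (0 < val j).
- rewrite h2; case: eqP => // ij; move: i0; rewrite ij nzopp_pos j0.
  by [].
- by rewrite h1 (key i (nzopp j)) ?nzopp_pos // nzrank_opp; case: eqP.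
- rewrite p_sym h1' (_ : (i == nzopp j) = (nzopp i == j)); last first.
    by rewrite -(inj_eq nzopp_inj) nzoppK.
  rewrite (key (nzopp i) j) ?nzopp_pos // nzrank_opp eq_sym.
  by case: eqP; rewrite ?mulr1 ?mulr0.
- rewrite h3; case: eqP => // ij; move: i0; rewrite ij nzopp_pos negbK.
  by rewrite (negbTE j0).
Qed.

Lemma hyp_self_dual_range a b :
  range (hyp_self_dual a b) = range a `|` range b.
Proof.
apply/seteqP; split=> [_ [i _ <-]|_ [[n _ <-]|[n _ <-]]].
- by rewrite /hyp_self_dual; case: ifP => _; [left|right]; exists (nzrank i).
- by exists (nzpos n).
- exists (nzopp (nzpos n)) => //.
Qed.

Lemma hyp_self_dual_torus a b : form_torus (hyp_self_dual a b) = hyp_torus a b.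
Proof. by rewrite form_torus_hyp. Qed.

(** The pairs and their flips form one dual family over [K * bool], in which each generator is a
    difference of two diagonal tensors. *)
Lemma hyp_torus_toral (e f : nat -> V) (K : choiceType) (a b : K -> V) :
  dual_basis p e f -> hyp_family p a b ->
  toral p (form_algebra k T) (hyp_torus a b).
Proof.
move=> ef ab.
pose v2 (x : K * bool) := if x.2 then a x.1 else b x.1.
pose w2 (x : K * bool) := if x.2 then b x.1 else eps *: a x.1.
have vw2 : dual_family p v2 w2.
  move=> [i []] [j []]; rewrite /v2 /w2 /= xpair_eqE ?andbT ?andbF ?pZr.
  - by have [] := ab i j.
  - by have [_ -> _] := ab i j; rewrite mulr0.
  - by have [_ _ ->] := ab i j.
  - have [E _ _] := ab j i; rewrite p_sym E mulrA form_sign_sqr mul1r.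
    by rewrite eq_sym.
have sub : hyp_torus a b `<=` diag_set T v2 w2.
  apply: lspan_min; first exact: subspace_lspan.
  move=> _ [n _ <-]; apply: lspanB; apply: sub_lspan; first by exists (n, true).
  by exists (n, false); rewrite // /v2 /w2 /= tensZr.
split; last by move=> c /sub; exact: (diag_semisimple vw2).
split; first exact: subspace_lspan.
- by apply: lspan_mono => _ [n _ <-]; exists (a n) => //; exists (b n).
- move=> c d cT dT.
  have -> : bracket p c d = 0; last exact: lspan0.
  apply: (tact_inj ef) => x; rewrite tact0 tact_bracket.
  by rewrite (diag_commuting vw2 (sub _ cT) (sub _ dT)) subrr.
Qed.

Lemma tmap_form_torus (f : {linear V -> V}) v :
  tmap T f f @` form_torus v = form_torus (fun i => f (v i)).
Proof.
rewrite !form_torus_hyp; apply: image_lspan_family => n.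
by rewrite /form_tens linearB /= linearZ /= !tmapE.
Qed.

Section Torus.
Variable v : nzint -> V.
Hypothesis vP : self_dual v.

(** The generator of the torus for [i > 0], rewritten in the twisted dual family so that it makes
    sense for every [i] and is odd in [i]. *)
Definition torus_gen i := tens T (twist v (nzopp i)) (v (nzopp i))
  - tens T (twist v i) (v i).

Lemma torus_genE i : 0 < val i ->
  form_tens k T (v i) (v (nzopp i)) = torus_gen i.
Proof.
move=> i0; rewrite /torus_gen twist_opp /twist /form_tens !tensZl.
by rewrite /sgn_eps nzopp_pos i0 /= scale1r.
Qed.

Lemma torus_gen_opp i : torus_gen (nzopp i) = - torus_gen i.
Proof. by rewrite /torus_gen nzoppK opprB. Qed.

Lemma form_torus_gen i : form_torus v (torus_gen i).
Proof.
have pos j : 0 < val j -> form_torus v (torus_gen j).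
  by move=> j0; rewrite -torus_genE //; apply: sub_lspan; exists j.
have [i0|i0] := boolP (0 < val i); first exact: pos.
rewrite -(nzoppK i) torus_gen_opp -scaleN1r; apply: lspanZ.
by apply: pos; rewrite nzopp_pos.
Qed.

Lemma form_torus_diag : form_torus v `<=` diag_set T (twist v) v.
Proof.
apply: lspan_min; first exact: subspace_lspan.
move=> _ [i i0 <-]; rewrite torus_genE //.
by apply: lspanB; apply: sub_lspan; [exists (nzopp i)|exists i].
Qed.

Lemma form_torus_separating : separating p (twist v) v (form_torus v).
Proof.
have vw := twist_dual vP.
have E j l : weight p (twist v) v (torus_gen j) l =
    (nzopp j == l)%:R - (j == l)%:R.
  rewrite /weight tactB !tactE pBl [p (_ *: twist v (nzopp j)) _]pZl.
  rewrite [p (_ *: twist v j) _]pZl !vw ![l == _]eq_sym.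
  by case: (nzopp j == l) (j == l) => [] []; rewrite ?mulr0 ?mulr1.
have Ej j : weight p (twist v) v (torus_gen j) j = -1.
  by rewrite E eqxx (negbTE (nzopp_neq j)) sub0r.
split=> [j l jl|j]; exists (torus_gen j); try exact: form_torus_gen.
  rewrite Ej E; move/eqP/negbTE: jl => ->; rewrite subr0 => /eqP.
  by case: (nzopp j == l); rewrite eq_sym -subr_eq0 opprK ?add0r ?oner_eq0 //
    -mulr2n pnatr_eq0.
by rewrite Ej; apply/eqP; rewrite oppr_eq0 oner_neq0.
Qed.

(** Skewness makes the weights odd in [i]. Adding the diagonal expansion of [a] to its reindexing by
    [- i] gives [2 a] as a combination of the generators. *)
Lemma diag_skew_torus a : diag_set T (twist v) v a -> skew_op p a -> form_torus v a.
Proof.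
move=> da sa; have vw := twist_dual vP.
pose wt i := weight p (twist v) v a i.
have wt_opp i : wt (nzopp i) = - wt i.
  have av : tact p a (v (nzopp i)) = wt i *: v (nzopp i).
    apply: (scalerI (sgn_eps_neq0 (nzopp i))).
    have := diag_eigenl vw i da.
    by rewrite /twist linearZ /= scalerA mulrC -scalerA.
  by rewrite /wt /weight sa av pZr vw eqxx mulr1.
have [r [c ur aE]] := diag_setP da.
have wtE i : wt i = if i \in r then c i else 0 by rewrite /wt aE weight_diag.
pose d i := tens T (twist v i) (v i).
pose q := undup (r ++ map nzopp r); have uq : uniq q := undup_uniq _.
have q_opp i : (nzopp i \in q) = (i \in q).
  have mem_opp j : (nzopp j \in map nzopp r) = (j \in r).
    by rewrite (mem_map nzopp_inj).
  by rewrite !mem_undup !mem_cat mem_opp -[in RHS](nzoppK i) mem_opp nzoppK orbC.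
have wt0 i : i \notin r -> wt i *: d i = 0.
  by move=> ir; rewrite wtE (negbTE ir) scale0r.
have aq : a = \sum_(i <- q) wt i *: d i.
  rewrite -(fsum_seq uq) => [|i]; last first.
    by rewrite mem_undup mem_cat negb_or => /andP[/wt0].
  rewrite (fsum_seq ur wt0) [LHS]aE; apply: eq_big_seq => i ir.
  by rewrite wtE ir.
have aq' : a = \sum_(i <- q) wt (nzopp i) *: d (nzopp i).
  rewrite [LHS]aq -(big_map nzopp xpredT (fun i => wt i *: d i)).
  apply: perm_big; apply: uniq_perm => //; first by rewrite (map_inj_uniq nzopp_inj).
  by move=> i; rewrite -(nzoppK i) (mem_map nzopp_inj) q_opp.
have two0 : 2 != 0 :> C by rewrite pnatr_eq0.
have -> : a = \sum_(i <- q) (- wt i / 2) *: torus_gen i.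
  apply: (scalerI two0); rewrite scaler_nat mulr2n {1}aq aq' -big_split.
  rewrite scaler_sumr; apply: eq_bigr => i _ /=.
  rewrite wt_opp /torus_gen -/(d i) -/(d (nzopp i)) !scalerBr !scalerA.
  have -> : 2 * (- wt i / 2) = - wt i by field.
  by rewrite !scaleNr opprK addrC.
by apply: lspan_sum => i _; apply: lspanZ; exact: form_torus_gen.
Qed.

End Torus.
Lemma form_torus_genE v : form_torus v = lspan (range (torus_gen v)).
Proof.
apply/seteqP; split; apply: lspan_min; try exact: subspace_lspan.
  by move=> _ [i i0 <-]; rewrite torus_genE //; apply: sub_lspan; exists i.
by move=> _ [i _ <-]; exact: form_torus_gen.
Qed.

Lemma form_torus_rescale v s (b : nzint -> C) : bijective s -> self_dual v ->
  self_dual (fun i => b i *: v (s i)) ->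
  form_torus (fun i => b i *: v (s i)) = form_torus v.
Proof.
move=> [s' sK s'K] vP v2P; have [s_opp bb] := self_dual_scaling vP v2P.
have E i : tens T (twist (fun i => b i *: v (s i)) i) (b i *: v (s i)) =
    tens T (twist v (s i)) (v (s i)).
  rewrite /twist !tensZl tensZr s_opp !scalerA; congr (_ *: _).
  rewrite -mulrA (mulrC (b _)) bb !sgn_eps_opp mulrA -(mulrA eps) sgn_eps_sqr mulr1.
  by [].
have genE i : torus_gen (fun i => b i *: v (s i)) i = torus_gen v (s i).
  by rewrite /torus_gen !E s_opp.
rewrite !form_torus_genE; congr lspan; apply/seteqP; split=> _ [i _ <-].
  by exists (s i); rewrite ?genE.
by exists (s' i); rewrite // genE s'K.
Qed.

End SelfDual.

Arguments form_torus {C} k {V} T v.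
Arguments hyp_torus {C} k {V} T {K} a b.

(** * Form data as frames: nondegeneracy and equivalence *)

Section FormFrames.
Variables (C : numClosedFieldType) (k : form_kind).
Local Notation eps := (Defs.form_sign C k).
Local Notation sgn := (sgn_eps C k).
Local Notation twist := (twist k).

Definition form_frame (V : lmodType C) (p : pairing V V) (D : form_datum C k)
    (j : {linear formX D -> V}) (v : nzint -> V) :=
  [/\ self_dual k p v, complement_of (lspan (range v)) j,
      forall x y, form_omega D x y = p (j x) (j y)
    & forall i x, form_lambda D i x = p (j x) (v i)].

Section OneFrame.
Variables (V : lmodType C) (p : pairing V V) (D : form_datum C k).
Variables (j : {linear formX D -> V}) (v : nzint -> V).
Hypotheses (p_sym : form_symmetric k p) (fr : form_frame p j v).

Lemma form_frame_dual : dual_family p (twist v) v.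
Proof. by have [vP _ _ _] := fr; exact: twist_dual. Qed.

Lemma form_frame_complement : complement_of (lspan (range (twist v))) j.
Proof. by have [_ cX _ _] := fr; rewrite lspan_twist. Qed.

Lemma twist_pairing i y : p (twist v i) (j y) = sgn i * form_lambda D (nzopp i) y.
Proof.
have [_ _ _ la] := fr; rewrite pZl p_sym -la sgn_eps_opp mulrACA.
by rewrite form_sign_sqr mul1r.
Qed.

Definition form_summand i x y := p (j x) (v i) * p (twist v i) (j y).

(** The link between the sum over the twisted dual family and the formal sum of the datum. *)
Lemma form_summand_pair i x y : 0 < val i ->
  form_summand i x y + form_summand (nzopp i) x y = form_term i x y.
Proof.
have [_ _ _ la] := fr; move=> i0.
rewrite /form_summand !twist_pairing nzoppK sgn_eps_opp /sgn_eps i0 -!la.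
by rewrite /form_term; ring.
Qed.

Lemma formX0_frame :
  @formX0 _ _ D = [set x | (fun i => p (j x) (v i)) ≈ (fun=> 0)].
Proof.
have [_ _ _ la] := fr; apply/seteqP; split=> x;
  apply: sub_finite_set => i /=; by rewrite la.
Qed.

Lemma form_tomega_frame x y : formX0 x ->
  form_tomega x y = frame_tomega p (twist v) v j j x y.
Proof.
have [_ _ om _] := fr; rewrite formX0_frame => x0.
rewrite /form_tomega /frame_tomega om; congr (_ - _).
rewrite nzint_sum.
  by apply: eq_fsbigr => i /set_mem i0; rewrite -form_summand_pair.
by apply: sub_finite_set x0 => i /= h E; apply: h; rewrite E mul0r.
Qed.

Lemma form_frame_nondegenerate : nondegenerate_pairing p <-> form_nondegenerate D.
Proof.
have [_ cX _ _] := fr.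
have L := frame_nondegl form_frame_dual form_frame_complement cX.
split=> [[pl _] x x0 xN0|nd].
  move: (x0); rewrite formX0_frame => x0'.
  have [y xy] := L.1 pl x x0' xN0.
  by exists y; rewrite form_tomega_frame.
have pl : forall u, (forall z, p u z = 0) -> u = 0.
  apply/L => x x0' xN0; have x0 : formX0 x by rewrite formX0_frame.
  have [y xy] := nd x x0 xN0.
  by exists y; rewrite -form_tomega_frame.
by split=> // w w0; apply: pl => z; apply: (p_eq0C p_sym); exact: w0.
Qed.

Lemma orth_liftX0 x : formX0 x ->
  exists2 u, lspan (range v) (u - j x) & forall i, p u (v i) = 0.
Proof.
rewrite formX0_frame => /(orth_lift form_frame_dual)[u]; rewrite lspan_twist.
by exists u.
Qed.

Lemma orth_projectX0 u : (forall i, p u (v i) = 0) ->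
  exists2 x, formX0 x & lspan (range v) (u - j x).
Proof.
move=> /(orth_project form_frame_dual form_frame_complement)[x x0].
by rewrite lspan_twist => ux; exists x; rewrite ?formX0_frame.
Qed.

Lemma form_tomega_orth x u y z : formX0 x -> lspan (range v) (u - j x) ->
  (forall i, p u (v i) = 0) -> lspan (range v) (z - j y) ->
  form_tomega x y = p u z.
Proof.
move=> x0 ux uv zy; rewrite form_tomega_frame //; apply/esym.
by apply: (orth_pairing form_frame_dual) => //; rewrite lspan_twist.
Qed.

End OneFrame.

Section TwoFormFrames.
Variables (V V' : lmodType C) (p : pairing V V) (p' : pairing V' V').
Variables (D D' : form_datum C k).
Variables (j : {linear formX D -> V}) (v : nzint -> V).
Variables (j' : {linear formX D' -> V'}) (v' : nzint -> V').
Hypotheses (p_sym : form_symmetric k p) (p'_sym : form_symmetric k p').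
Hypotheses (fr : form_frame p j v) (fr' : form_frame p' j' v').

Definition form_isometric := exists (f : {linear V -> V'}) (s : nzint -> nzint)
  (b : nzint -> C), [/\ bijective f, bijective s,
    forall x y, p' (f x) (f y) = p x y, forall i, b i != 0
  & forall i, f (v i) = b i *: v' (s i)].

(* Summand of index [i] of the second datum, after matching [i] with [s i]. *)
Lemma matched_term s (b : nzint -> C) i x y :
  0 < val i -> s (nzopp i) = nzopp (s i) -> b i * b (nzopp i) = sgn (s i) ->
  (b i * form_lambda D' (s i) x) * (b (nzopp i) * form_lambda D' (s (nzopp i)) y)
  + eps * ((b (nzopp i) * form_lambda D' (s (nzopp i)) x)
      * (b i * form_lambda D' (s i) y)) = form_term (nzabs (s i)) x y.
Proof.
move=> i0 s_opp bb; rewrite s_opp.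
have -> : forall A B A' B', b i * A * (b (nzopp i) * B)
    + eps * (b (nzopp i) * A' * (b i * B')) = sgn (s i) * (A * B + eps * (A' * B')).
  by move=> A B A' B'; rewrite -bb; ring.
rewrite /form_term /nzabs /sgn_eps; case: ifP => _; first by rewrite mul1r.
rewrite nzoppK mulrDr [eps * (eps * _)]mulrA form_sign_sqr mul1r addrC.
by [].
Qed.

Lemma rescaled_self_dual s (b : nzint -> C) : bijective s ->
  (forall i, s (nzopp i) = nzopp (s i)) ->
  (forall i, b i * b (nzopp i) = sgn i * sgn (s i)) ->
  self_dual k p' (fun i => b i *: v' (s i)).
Proof.
have [v'P _ _ _] := fr'; move=> s_bij s_opp bb i l.
rewrite pZl pZr v'P -s_opp (bij_eq s_bij).
have [->|_] := eqVneq i (nzopp l); last by rewrite !mulr0.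
have := bb (nzopp l); rewrite nzoppK mulrA => ->.
by rewrite -mulrA sgn_eps_sqr mulr1.
Qed.

(** The comparison of frames is applied with [twist v] on the left, [v] on the right and a single
    lift [f] in both roles. Here [α] itself is the scaling factor, because [λ_i] is the pairing with
    [v_i]. *)
Lemma form_equivalent_frames : form_equivalent D D' <-> form_isometric.
Proof.
have [vP cX om la] := fr; have [v'P cX' om' la'] := fr'.
have vw := form_frame_dual fr; have cXt := form_frame_complement fr.
split.
  move=> [s [q [al [[s_bij s_opp q_bij] al0 al_opp lE oE]]]].
  (* The orthogonal and the symplectic condition on [α_{-i}] become one: it is what keeps the
     rescaled family self-dual. *)
  have bb i : al i * al (nzopp i) = sgn i * sgn (s i).
    rewrite al_opp !sgn_eps_nzsg; case: (k) => /=; first by rewrite mulfV // mulr1.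
    by rewrite !mulrA mulfV // mul1r.
  pose v2 i := al i *: v' (s i).
  have v2P : self_dual k p' v2 := rescaled_self_dual s_bij s_opp bb.
  have vw2 := twist_dual v2P.
  have Sv2 : lspan (range v2) = lspan (range v') by rewrite lspan_rescale.
  have cX2 : complement_of (lspan (range (twist v2))) j'.
    by rewrite lspan_twist Sv2.
  have [|f [fb fc fj ft]] := frame_lift_bij vw vw2 cXt cX2 q_bij.
    move=> x; apply: sub_finite_set (lE x) => i /= h E; apply: h.
    by rewrite -la E pZr la'.
  have fv i : f (v i) = v2 i.
    by rewrite (twistK k v) linearZ /= ft -twistK.
  (* Coordinates against the twisted family follow from those against [v2] by the symmetry of the
     forms, so no second lift is needed. *)
  have gc z i : p' (twist v2 i) (f z) = p (twist v i) z.
    by rewrite [LHS]pZl [RHS]pZl p'_sym fc -p_sym.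
  have fj' x : lspan (range v2) (f (j x) - j' (q x)).
    by have := fj x; rewrite lspan_twist.
  exists f, s, al; split=> //.
  apply: (frame_data_isometry vw2 cXt cX fj fj' ft fv fc gc) => x y.
  rewrite -om -om' -{}[RHS](oE x y); congr (_ - _).
  rewrite nzint_sum; last exact: (frame_defect_finite vw2 fj fj' fc gc).
  apply: eq_fsbigr => i /set_mem i0.
  rewrite -(form_summand_pair p_sym fr) // -(matched_term (b := al) _ _ i0 (s_opp i)).
    rewrite /frame_defect /form_summand addrACA -opprD; congr (_ - _).
    have tw l z : p' (twist v2 l) (j' z) =
        sgn l * (al (nzopp l) * form_lambda D' (s (nzopp l)) z).
      rewrite pZl p'_sym pZr -la' sgn_eps_opp mulrACA form_sign_sqr mul1r.
      by [].
    rewrite !tw !pZr -!la' nzoppK sgn_eps_opp /sgn_eps (i0 : 0 < val i) mulr1 mul1r.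
    by congr (_ + _); ring.
  by rewrite bb /sgn_eps (i0 : 0 < val i) mul1r.
move=> [f [s [b [fb s_bij iso b0 fv]]]].
pose v2 i := b i *: v' (s i).
have v2P : self_dual k p' v2 by move=> i l; rewrite /v2 -!fv iso vP.
have [s_opp bb] := self_dual_scaling v'P v2P.
have vw2 := twist_dual v2P.
have Sv2 : lspan (range v2) = lspan (range v') by rewrite lspan_rescale.
have [|q q_bij fj'] := frame_projection (u' := v2) (j' := j') fb fv cX.
  by rewrite Sv2.
have ft i : f (twist v i) = twist v2 i by rewrite twist_linear fv.
have fj x : lspan (range (twist v2)) (f (j x) - j' (q x)) by rewrite lspan_twist.
have [lE _ fin oE] := isometry_frame_data vw2 fj fj' ft fv iso.
exists s, q, b; split=> //.
- move=> i; have bE : b (nzopp i) = (b i)^-1 * (sgn i * sgn (s i)).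
    by rewrite -bb mulKf.
  by rewrite bE !sgn_eps_nzsg; case: (k) => /=; rewrite ?mulr1 ?mulrA.
- move=> x; apply: sub_finite_set (lE x) => i /= h E; apply: h.
  by rewrite la E pZr la'.
- move=> x y; rewrite om om' -[RHS](oE x y); congr (_ - _).
  rewrite [in RHS]nzint_sum //; apply: eq_fsbigr => i /set_mem i0.
  rewrite -(form_summand_pair p_sym fr) // -(matched_term (b := b) _ _ i0 (s_opp i)).
    rewrite /frame_defect /form_summand addrACA -opprD; congr (_ - _).
    have tw l z : p' (twist v2 l) (j' z) =
        sgn l * (b (nzopp l) * form_lambda D' (s (nzopp l)) z).
      rewrite pZl p'_sym pZr -la' sgn_eps_opp mulrACA form_sign_sqr mul1r.
      by [].
    rewrite !tw !pZr -!la' nzoppK sgn_eps_opp /sgn_eps (i0 : 0 < val i) mulr1 mul1r.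
    by congr (_ + _); ring.
  by rewrite bb /sgn_eps (i0 : 0 < val i) mul1r.
Qed.

End TwoFormFrames.
End FormFrames.

(** * The model of a form datum *)

Section FormModel.
Variables (C : numClosedFieldType) (k : form_kind) (D : form_datum C k).
Local Notation eps := (Defs.form_sign C k).
Local Notation P2 := ({poly C} * {poly C})%type.
Local Notation V := (formX D * P2)%type.
Local Notation lpos x := (fun n => form_lambda D (nzpos n) x).
Local Notation lneg x := (fun n => form_lambda D (nzopp (nzpos n)) x).

(** The two polynomial summands carry the positive and the negative indices. They pair with [X]
    through [λ], and with each other as a hyperbolic family. *)
Definition form_model_fun (u z : V) : C :=
  form_omega D u.1 z.1
  + (ev (lpos u.1) z.2.1 + ev (lneg u.1) z.2.2)
  + eps * (ev (lpos z.1) u.2.1 + ev (lneg z.1) u.2.2)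
  + (ev (fun i => u.2.1`_i) z.2.2 + eps * ev (fun i => u.2.2`_i) z.2.1).

Lemma ev_lambda (a : C) x y (f : {poly C}) (n : nat -> nzint) :
  ev (fun m => form_lambda D (n m) (a *: x + y)) f =
  a * ev (fun m => form_lambda D (n m) x) f + ev (fun m => form_lambda D (n m) y) f.
Proof.
by rewrite -ev_linearl; apply: ev_ext => m; rewrite linearP.
Qed.

Lemma ev_coef (a : C) (f g h : {poly C}) :
  ev (fun m => (a *: f + g)`_m) h = a * ev (fun m => f`_m) h + ev (fun m => g`_m) h.
Proof. by rewrite -ev_linearl; apply: ev_ext => m; rewrite coefD coefZ. Qed.

Fact form_model_bilinear : bilinear_for *%R *%R form_model_fun.
Proof.
split=> [z|u] a x y; rewrite /form_model_fun /=.
  by rewrite pDl pZl !ev_lambda !ev_coef !evD !evZ; ring.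
by rewrite pDr pZr !ev_lambda !evD !evZ; ring.
Qed.

Definition form_model : pairing V V := pairing_of form_model_bilinear.

Lemma form_model_sym : form_symmetric k form_model.
Proof.
move=> u z; rewrite /= /form_model_fun (form_omega_symmetric u.1 z.1).
rewrite (evC u.2.1) (evC u.2.2).
rewrite !mulrDr !(mulrA eps eps) form_sign_sqr !mul1r.
by ring.
Qed.

Definition form_model_family (i : nzint) : V :=
  if 0 < val i then (0, ('X^(nzrank i), 0)) else (0, (0, 'X^(nzrank i))).

Lemma form_model_frame :
  form_frame form_model (inl_lin (formX D) P2) form_model_family.
Proof.
have l0 i : form_lambda D i 0 = 0 by rewrite linear0.
pose a n : V := (0, ('X^n, 0)); pose b n : V := (0, (0, 'X^n)).
have ab : hyp_family form_model a b.
  move=> i j; rewrite /= /form_model_fun /= p0l !evX !ev0 !l0 !coefXn !coef0.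
  by rewrite !(add0r, addr0, mulr0) eq_sym.
have vE : form_model_family = hyp_self_dual a b by [].
split.
- by rewrite vE; exact: (hyp_self_dualP form_model_sym ab).
- have -> : lspan (range form_model_family) = range (inr_lin (formX D) P2).
    rewrite vE hyp_self_dual_range; apply/seteqP; split.
      apply: lspan_min.
        have -> : range (inr_lin (formX D) P2) = inr_lin (formX D) P2 @` setT by [].
        exact: subspace_image.
      by move=> _ [[n _ <-]|[n _ <-]]; [exists ('X^n, 0)|exists (0, 'X^n)].
    move=> _ [[f g] _ <-].
    pose ia := inr_lin (formX D) P2 \o inl_lin {poly C} {poly C}.
    pose ib := inr_lin (formX D) P2 \o inr_lin {poly C} {poly C}.
    have -> : inr_lin (formX D) P2 (f, g) = ia f + ib g.
      by rewrite /ia /ib /=; congr (_, (_, _)); rewrite /= ?addr0 ?add0r.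
    apply: lspanD.
      have : lspan (range (fun i => ia 'X^i)) (ia f) by rewrite lspan_Xn; exists f.
      by apply: lspan_mono => _ [i _ <-]; left; exists i.
    have : lspan (range (fun i => ib 'X^i)) (ib g) by rewrite lspan_Xn; exists g.
    by apply: lspan_mono => _ [i _ <-]; right; exists i.
  exact: complement_inl.
- by move=> x y; rewrite /= /form_model_fun /= !ev0 !(addr0, mulr0).
- move=> i x; rewrite /= /form_model_fun /form_model_family.
  case: ifP => i0 /=; rewrite p0r !ev0 evX ?evX !coef0 !(add0r, addr0, mulr0).
    by rewrite nzrankK.
  by rewrite -nzrank_opp nzrankK ?nzoppK // nzopp_pos i0.
Qed.

End FormModel.

Section FormEquivalence.
Variables (C : numClosedFieldType) (k : form_kind).

Lemma form_equivalent_equivalence : equivalence_on (@form_equivalent C k).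
Proof.
have P (D D' : form_datum C k) := form_equivalent_frames (@form_model_sym _ _ D)
  (@form_model_sym _ _ D') (form_model_frame D) (form_model_frame D').
split.
- move=> D; apply/P; exists idfun, id, (fun=> 1).
  have id_bij (U : Type) : bijective (@id U) by exists id.
  split=> [|||i|i] //; first exact: oner_neq0.
  by rewrite scale1r.
- move=> D D' /P[f [s [b [fb s_bij iso b0 fv]]]]; apply/P.
  have [f' [fK fK']] := linear_inverse fb.
  have [s' sK s'K] := s_bij.
  exists f', s', (fun i => (b (s' i))^-1); split.
  + by exists f.
  + by exists s.
  + by move=> u z; rewrite -iso !fK'.
  + by move=> i; rewrite invr_eq0.
  + move=> i; apply: (can_inj fK); rewrite fK' linearZ /= fv scalerA mulVf //.
    by rewrite scale1r s'K.
- move=> D D' D'' /P[f [s [b [fb s_bij iso b0 fv]]]].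
  move=> /P[f' [s' [b' [fb' s_bij' iso' b0' fv']]]]; apply/P.
  exists (f' \o f), (s' \o s), (fun i => b i * b' (s i)); split.
  + exact: bij_comp.
  + exact: bij_comp.
  + by move=> u z; exact: etrans (iso' _ _) (iso _ _).
  + by move=> i; rewrite mulf_neq0.
  + by move=> i; rewrite /= fv linearZ /= fv' scalerA.
Qed.

End FormEquivalence.

Section FormCompatible.
Variables (C : numClosedFieldType) (k : form_kind) (V : lmodType C).
Variables (p : pairing V V) (T : tensor_product V V).
Local Notation sgn := (sgn_eps C k).

Lemma self_dual_eq0 v : self_dual k p v -> forall i, v i <> 0.
Proof.
move=> vP i E; have := vP i (nzopp i); rewrite nzoppK eqxx E p0l => /eqP.
by rewrite eq_sym (negbTE (sgn_eps_neq0 _ _ _)).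
Qed.

Lemma self_dual_system_family (L : nzint -> set V) v : form_symmetric k p ->
  self_dual_system p L -> (forall i, L i (v i)) ->
  (forall i, 0 < val i -> p (v i) (v (nzopp i)) = 1) ->
  [/\ self_dual k p v, lspan (\bigcup_i L i) = lspan (range v)
    & @form_system_torus C k V T L = form_torus k T v].
Proof.
move=> p_sym [lL LL] Lv v1.
have vP : self_dual k p v.
  move=> i j; case: eqVneq => [ij|/negbTE ij].
    have [i0|i0] := boolP (0 < val i).
      by rewrite /sgn_eps i0 -(v1 i i0) ij nzoppK.
    have j0 : 0 < val j by rewrite -(nzoppK j) nzopp_pos -ij.
    by rewrite ij p_sym v1 // sgn_eps_opp /sgn_eps j0.
  have : [set p v w | v in L i & w in L j] (p (v i) (v j)).
    by exists (v i); rewrite //; exists (v j).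
  by rewrite LL ij.
have v0 := self_dual_eq0 vP.
have LE i : L i = [set a *: v i | a in [set: C]] by apply: line_generator.
split=> //.
  by apply: lspan_line => // i u; rewrite LE => -[a _ <-]; exists a.
apply: lspan_eq => u.
  move=> [i i0 [x + [y + <-]]]; rewrite !LE => -[a _ <-] [b _ <-].
  have -> : form_tens k T (a *: v i) (b *: v (nzopp i)) =
      (a * b) *: form_tens k T (v i) (v (nzopp i)).
    rewrite /form_tens !tensZl !tensZr scalerBr !scalerA.
    by congr (_ *: _ - _ *: _); ring.
  apply: lspanZ; apply: sub_lspan.
  by exists i.
move=> [i i0 <-]; apply: sub_lspan; exists i => //.
by exists (v i) => //; exists (v (nzopp i)).
Qed.

Lemma self_dual_family_system v : self_dual k p v ->
  exists L : nzint -> set V, self_dual_system p L /\ forall i, L i (v i).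
Proof.
move=> vP; have v0 := self_dual_eq0 vP.
exists (fun i => [set a *: v i | a in [set: C]]); split; last first.
  by move=> i; exists 1; rewrite ?scale1r.
split=> [i|i j]; first exact: line_scale.
have [ij|/negbTE ij] := eqVneq i (nzopp j); apply/seteqP; split=> // c.
- move=> _; exists ((c * sgn i) *: v i); first by exists (c * sgn i).
  exists (v j); first by exists 1; rewrite ?scale1r.
  by rewrite pZl vP ij eqxx -mulrA sgn_eps_sqr mulr1.
- move=> [_ [a _ <-] [_ [b _ <-] <-]].
  by rewrite pZl pZr vP ij !mulr0.
- move=> /= ->; exists (v i); first by exists 1; rewrite ?scale1r.
  exists (v j); first by exists 1; rewrite ?scale1r.
  by rewrite vP ij.
Qed.

Hypothesis p_sym : form_symmetric k p.

Lemma form_submaximalP (t : set T) : form_submaximal k p T t <->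
  exists v, self_dual k p v /\ t = form_torus k T v.
Proof.
split=> [[L [LL ->]]|[v [vP ->]]].
  have [_ LL1] := LL.
  have /choice[ab abP] i : exists ab : V * V,
      [/\ L i ab.1, L (nzopp i) ab.2 & p ab.1 ab.2 = 1].
    have := LL1 i (nzopp i); rewrite nzoppK eqxx => E; have : [set: C] 1 by [].
    by rewrite -E => -[a La [b Lb ab1]]; exists (a, b).
  (* At a negative index the partner selected at [- i] is used, so that [<v_i, v_{-i}> = 1] holds
     for positive [i]. *)
  pose v i := if 0 < val i then (ab i).1 else (ab (nzopp i)).2.
  have [||vP _ tE] := self_dual_system_family (v := v) p_sym LL.
  - move=> i; rewrite /v; case: ifP => _; first by case: (abP i).
    by have [_ + _] := abP (nzopp i); rewrite nzoppK.
  - by move=> i i0; rewrite /v nzopp_pos i0 /= nzoppK; case: (abP i).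
  by exists v.
have [L [LL Lv]] := self_dual_family_system vP; exists L; split=> //.
have [|_ _ ->] := self_dual_system_family p_sym LL Lv; last by [].
by move=> i i0; rewrite vP nzoppK eqxx /sgn_eps i0.
Qed.

Lemma form_compatibleP (t : set T) D : form_compatible k p T t D <->
  exists j v, @form_frame C k V p D j v /\ t = form_torus k T v.
Proof.
split.
  move=> [L [LL -> [j [v [cX Lv v1 om la]]]]].
  have [|vP LE ->] := self_dual_system_family p_sym LL Lv.
    by move=> i i0; case: (v1 i i0).
  by exists j, v; split=> //; split=> //; rewrite -LE.
move=> [j [v [[vP cX om la] ->]]].
have [L [LL Lv]] := self_dual_family_system vP.
have v1 i : 0 < val i -> p (v i) (v (nzopp i)) = 1.
  by move=> i0; rewrite vP nzoppK eqxx /sgn_eps i0.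
have [_ LE tE] := self_dual_system_family p_sym LL Lv v1.
exists L; split=> //; exists j, v; rewrite LE; split=> // i i0.
by split; [exact/eqP/(self_dual_eq0 vP)|exact: v1].
Qed.

Lemma form_conjugateP (t t' : set T) :
  form_conjugate p T t t' <-> exists f : {linear V -> V},
    [/\ bijective f, forall v w, p (f v) (f w) = p v w & t' = tmap T f f @` t].
Proof.
split=> [[f [[fb _] iso] ->]|[f [fb iso ->]]]; first by exists f.
by exists f => //; split=> //; exact: (GL_pairing_isometry fb fb iso).
Qed.

Lemma form_conjugate_equivalence : equivalence_on (form_conjugate p T).
Proof.
split.
- move=> t; apply/form_conjugateP; exists idfun; split=> //.
  by rewrite tmap_id_image.
- move=> t t1 /form_conjugateP[f [fb iso ->]]; apply/form_conjugateP.
  have [f' [fK fK']] := linear_inverse fb.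
  exists f'; split; first by exists f.
    by move=> v w; rewrite -iso !fK'.
  by rewrite tmap_image_can.
- move=> t t1 t2 /form_conjugateP[f [fb iso ->]] /form_conjugateP[f' [fb' iso' ->]].
  apply/form_conjugateP; exists (f' \o f); split.
  + exact: bij_comp.
  + by move=> v w; exact: etrans (iso' _ _) (iso _ _).
  + by rewrite tmap_image_comp.
Qed.

End FormCompatible.

Section FormTransport.
Variables (C : numClosedFieldType) (k : form_kind).

Lemma form_frame_transport (V V' : lmodType C) (p : pairing V V)
    (p' : pairing V' V') (D : form_datum C k) j v (f : {linear V -> V'}) :
  @form_frame C k V p D j v -> bijective f ->
  (forall u z, p' (f u) (f z) = p u z) ->
  form_frame p' (f \o j) (fun i => f (v i)).
Proof.
move=> [vP cX om la] fb iso; split.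
- by move=> i l; rewrite iso.
- exact: complement_transport.
- by move=> x y; rewrite /= iso.
- by move=> i x; rewrite /= iso.
Qed.

Fact zero_form_symmetric (X : lmodType C) : form_symmetric k (zero_pairing X X).
Proof. by move=> x y; rewrite /= mulr0. Qed.

Definition trivial_form_datum : form_datum C k :=
  FormDatum (countable_dim_rV0 C) (@zero_form_symmetric 'rV[C]_0)
    (fun=> zero_scalar 'rV[C]_0).

Lemma self_dual_basis_isometry (V V' : lmodType C) (p : pairing V V)
    (p' : pairing V' V') v v' : form_symmetric k p -> form_symmetric k p' ->
  self_dual k p v -> lspan (range v) = setT ->
  self_dual k p' v' -> lspan (range v') = setT ->
  exists F : {linear V -> V'}, bijective F /\ forall u z, p' (F u) (F z) = p u z.
Proof.
move=> p_sym p'_sym vP vT v'P v'T.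
have fr (U : lmodType C) (q : pairing U U) u : self_dual k q u ->
    lspan (range u) = setT ->
    @form_frame C k U q trivial_form_datum (zero_lin 'rV[C]_0 U) u.
  move=> uP uT; split=> //.
  - by rewrite uT; exact: complement_setT.
  - by move=> x y; rewrite /= p0l.
  - by move=> i x; rewrite /= p0l.
have [er _ _] := form_equivalent_equivalence C k.
have [F [s [b [Fb _ iso _ _]]]] := (form_equivalent_frames p_sym p'_sym
  (fr _ _ _ vP vT) (fr _ _ _ v'P v'T)).1 (er trivial_form_datum).
by exists F.
Qed.

Lemma self_dual_basis_ex (V : lmodType C) (p : pairing V V) (i : nat -> V) :
  form_symmetric k p -> nondegenerate_pairing p -> independent i ->
  countable_dim V -> exists v, self_dual k p v /\ lspan (range v) = setT.
Proof.
move=> p_sym p_nondeg i_ind Vc.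
have [a [b [ab abT]]] := hyp_basis_ex p_sym p_nondeg i_ind Vc.
exists (hyp_self_dual a b); rewrite hyp_self_dual_range; split=> //.
exact: hyp_self_dualP.
Qed.

End FormTransport.

(** Rank 0 means that [ω~] vanishes on [X_0], so the orthogonal and symplectic definitions differ
    only by the rank 1 case. *)
Lemma form_maximalP (C : numClosedFieldType) k (D : form_datum C k) :
  form_maximal D <->
  (forall x y, formX0 x -> formX0 y -> @form_tomega C k D x y = 0) \/
  k = Orthogonal /\ has_rank_on (@form_tomega C k D) (@formX0 C k D) 1.
Proof.
case: k D => D; rewrite /form_maximal /=; last first.
  by split=> [|[//|[]//]]; left.
split=> [[[e [_ _ eS]]|r1]|[t0|[_ r1]]]; [left|right|left|right] => //.
  move=> x y /eS[c cE] /cE ->; exact: big_ord0.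
exists (fun i : 'I_0 => 0); split=> [[]//|c _ []//|x xX0].
by exists (fun=> 0) => y yX0; rewrite big_ord0 t0.
Qed.

Section FormTheorem.
Variables (C : numClosedFieldType) (k : form_kind) (V : lmodType C).
Variables (p : pairing V V) (T : tensor_product V V).
Hypothesis Vinf : countably_infinite_dim V.
Hypotheses (p_nondeg : nondegenerate_pairing p) (p_sym : form_symmetric k p).
Local Notation toral := (toral p (form_algebra k T)).
Local Notation maximal_toral := (maximal_toral p (form_algebra k T)).

Lemma form_torus_toral v : self_dual k p v -> toral (form_torus k T v).
Proof.
have [e [f ef]] := standard_dual_basis Vinf Vinf p_nondeg.
move=> /self_dual_hyp vP; rewrite form_torus_hyp.
exact: (hyp_torus_toral T p_sym ef vP).
Qed.

Lemma form_maximal_submaximal t : maximal_toral t -> form_submaximal k p T t.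
Proof.
have [e [f ef]] := standard_dual_basis Vinf Vinf p_nondeg.
move=> [ttor tmax]; have [[tsub tg _] tss] := ttor.
have tc a b : t a -> t b -> commuting p a b.
  by move=> ta tb; apply: (toral_commuting ef ttor ta tb).
have [a [b [ab tab]]] :=
  commuting_semisimple_form_diag p_nondeg p_sym ef tsub tss tc tg.
apply/form_submaximalP => //; exists (hyp_self_dual a b).
split; first exact: hyp_self_dualP.
rewrite hyp_self_dual_torus; apply/esym/tmax => //.
exact: (hyp_torus_toral T p_sym ef ab).
Qed.

Lemma form_submaximal_compatible t : form_submaximal k p T t ->
  exists D, form_compatible k p T t D.
Proof.
move=> /(form_submaximalP p_sym _)[v [vP tE]].
have [e [eT _]] := Vinf.
have [X [j [cX cj]]] := @complement_ex _ V (lspan (range v))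
  (ex_intro _ e eT) (subspace_lspan _).
have om_sym : form_symmetric k (restrict_pairing p j j) by move=> x y; exact: p_sym.
exists (FormDatum cX om_sym (fun i => restrict_left p j (v i))).
by apply/form_compatibleP => //; exists j, v.
Qed.

Lemma form_compatible_submaximal t D : form_compatible k p T t D ->
  form_submaximal k p T t /\ form_nondegenerate D.
Proof.
move=> /(form_compatibleP p_sym _ _)[j [v [fr tE]]]; split.
  by apply/form_submaximalP => //; exists v; case: fr.
exact/(form_frame_nondegenerate p_sym fr).
Qed.

Lemma form_nondegenerate_compatible (D : form_datum C k) : form_nondegenerate D ->
  exists t, form_compatible k p T t D.
Proof.
have fr := form_model_frame D; have m_sym := @form_model_sym _ _ D.
move=> /(form_frame_nondegenerate m_sym fr) nd.
have [e [eT e_ind]] := Vinf.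
have [v [vP vT]] := self_dual_basis_ex p_sym p_nondeg e_ind (ex_intro _ e eT).
have [|v' [v'P v'T]] := self_dual_basis_ex m_sym nd (i :=
    fun n => form_model_family D (nzpos n)) _ (countable_dim_prod (formX_countable D)
    (countable_dim_prod (countable_dim_poly _) (countable_dim_poly _))).
  have [mP _ _ _] := fr; apply: dual_family_independent => i j.
  by have [ab _ _] := self_dual_hyp mP i j; exact: ab.
have [F [Fb iso]] := self_dual_basis_isometry m_sym p_sym v'P v'T vP vT.
have fr' := form_frame_transport fr Fb iso.
eexists; apply/form_compatibleP => //; do 2!eexists; split; [exact: fr'|reflexivity].
Qed.

Lemma form_conjugate_equivalent t t' D D' :
  form_compatible k p T t D -> form_compatible k p T t' D' ->
  form_conjugate p T t t' <-> form_equivalent D D'.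
Proof.
move=> /(form_compatibleP p_sym _ _)[j [v [fr ->]]].
move=> /(form_compatibleP p_sym _ _)[j' [v' [fr' ->]]].
have [vP _ _ _] := fr; have [v'P _ _ _] := fr'.
rewrite (form_equivalent_frames p_sym p_sym fr fr'); split.
  move=> /form_conjugateP[f [fb iso]]; rewrite tmap_form_torus => tE.
  have fP : self_dual k p (fun i => f (v i)) by move=> i l; rewrite iso.
  have sep := form_torus_separating T fP.
  have sep' := form_torus_separating T v'P.
  have td' := @form_torus_diag _ k _ T v'.
  rewrite tE in sep' td'.
  have [s [b [s_bij sb]]] := diag_set_unique p_nondeg (twist_dual fP)
    (@form_torus_diag _ _ _ _ _) sep (twist_dual v'P)
    td' sep'.
  exists f, s, (fun i => (b i)^-1); split=> // i; have [b0 _ E] := sb i.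
    by rewrite invr_eq0.
  exact: E.
move=> [f [s [b [fb s_bij iso b0 fv]]]].
apply/form_conjugateP; exists f; split=> //.
have E : (fun i => f (v i)) = (fun i => b i *: v' (s i)) by apply/funext.
rewrite tmap_form_torus E (form_torus_rescale _ s_bij v'P) //.
by move=> i l; rewrite -!fv iso vP.
Qed.

(** * Maximal tori of forms: hyperbolic pairs orthogonal to the family *)

Section Maximality.
Variables (D : form_datum C k) (j : {linear formX D -> V}) (v : nzint -> V).
Hypothesis fr : form_frame p j v.

Definition torus_orth : set V := [set u | forall i, p u (v i) = 0].

Lemma subspace_torus_orth : subspace torus_orth.
Proof.
split=> [i|a x y /= xv yv i]; first by rewrite p0l.
by rewrite pDl pZl xv yv mulr0 addr0.
Qed.

(** Adjoining the pair gives a larger toral subalgebra, equal to the torus by maximality; but the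
    new generator fixes [a], and every element of the torus kills [a]. *)
Lemma maximal_no_hyperbolic a b : maximal_toral (form_torus k T v) ->
  torus_orth a -> torus_orth b -> ~ hyperbolic_pair p a b.
Proof.
have [e [f ef]] := standard_dual_basis Vinf Vinf p_nondeg.
have [vP _ _ _] := fr; have vw := twist_dual vP.
move=> [_ tmax] av bv [ab aa bb].
have va i : p (v i) a = 0 by apply: (p_eq0C p_sym); exact: av.
have vb i : p (v i) b = 0 by apply: (p_eq0C p_sym); exact: bv.
pose a2 (n : option nat) := if n is Some m then v (nzpos m) else a.
pose b2 (n : option nat) := if n is Some m then v (nzopp (nzpos m)) else b.
have ab2 : hyp_family p a2 b2.
  move=> [n|] [m|] /=; rewrite ?va ?vb ?av ?bv //.
  exact: (self_dual_hyp vP n m).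
have E : hyp_torus k T a2 b2 = form_torus k T v.
  apply: tmax; first exact: (hyp_torus_toral T p_sym ef ab2).
  rewrite form_torus_hyp; apply: lspan_mono => _ [n _ <-].
  by exists (Some n).
have : hyp_torus k T a2 b2 (form_tens k T a b) by apply: sub_lspan; exists None.
rewrite E => /form_torus_diag /(diag_tact vw)[r _ /(_ a)].
rewrite big1 => [|i _]; last by rewrite av mulr0 scale0r.
rewrite tact_form_tens ab aa mulr0 scale0r subr0 scale1r => a0.
by move: ab; rewrite a0 p0l => /eqP; rewrite eq_sym oner_eq0.
Qed.

Lemma maximal_isotropic u z : maximal_toral (form_torus k T v) ->
  torus_orth u -> torus_orth z -> p u u = 0 -> p u z = 0.
Proof.
move=> tmax Su Sz uu; apply: contrapT => /eqP uz.
have Sz' : torus_orth ((p u z)^-1 *: z) by apply: (subspaceZ subspace_torus_orth).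
have uz' : p u ((p u z)^-1 *: z) = 1 by rewrite pZr mulVf.
have [b [Sb ub _]] :=
  hyperbolic_pair_isotropic p_sym subspace_torus_orth Su Sz' uu uz'.
exact: (maximal_no_hyperbolic tmax Su Sb ub).
Qed.

Lemma maximal_rank0 : maximal_toral (form_torus k T v) ->
  (forall u, torus_orth u -> p u u = 0) ->
  forall x y, formX0 x -> formX0 y -> @form_tomega C k D x y = 0.
Proof.
move=> tmax Siso x y /[dup] x0 /(orth_liftX0 fr)[u ux uv].
move=> /(orth_liftX0 fr)[z zy zv].
rewrite (form_tomega_orth p_sym fr x0 ux uv zy).
by apply: (maximal_isotropic tmax) => //; exact: Siso.
Qed.

(** An anisotropic vector orthogonal to [u0] would span a hyperbolic plane with it. So vectors
    orthogonal to [u0] are isotropic, hence in the radical of the form on [torus_orth], and [u0]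
    alone carries the form. *)
Lemma maximal_rank1 u0 : k = Orthogonal -> maximal_toral (form_torus k T v) ->
  torus_orth u0 -> p u0 u0 <> 0 -> has_rank_on (@form_tomega C k D) (@formX0 C k D) 1.
Proof.
move=> kO tmax Su0 /eqP u00.
have ker z w : torus_orth z -> torus_orth w -> p u0 z = 0 -> p z w = 0.
  move=> Sz Sw u0z; apply: (maximal_isotropic tmax) => //; apply: contrapT => zz.
  have [a [b [Sa Sb ab _]]] := hyperbolic_pair_anisotropic p_sym
    subspace_torus_orth kO Su0 Sz (elimN eqP u00) zz u0z.
  exact: (maximal_no_hyperbolic tmax Sa Sb ab).
have [x0 x00 u0x0] := orth_projectX0 fr Su0.
exists (fun=> x0); split=> [//|c /(_ x0 x00)|x xX0].
  rewrite big_ord1 (form_tomega_orth p_sym fr x00 u0x0 Su0 u0x0) => /eqP.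
  by rewrite mulf_eq0 (negbTE u00) orbF => /eqP c0 i; rewrite ord1.
have [u ux Su] := orth_liftX0 fr xX0.
exists (fun=> p u u0 / p u0 u0) => y yX0; rewrite big_ord1.
have [z zy Sz] := orth_liftX0 fr yX0.
rewrite (form_tomega_orth p_sym fr xX0 ux Su zy).
rewrite (form_tomega_orth p_sym fr x00 u0x0 Su0 zy).
apply/eqP; rewrite -subr_eq0 -pZl -pBl; apply/eqP; apply: ker => //.
  apply: (subspaceB subspace_torus_orth) => //.
  by apply: (subspaceZ subspace_torus_orth).
by rewrite pBr pZr divfK // (orthogonal_sym p_sym u u0 kO) subrr.
Qed.

Lemma maximal_toral_datum : maximal_toral (form_torus k T v) -> form_maximal D.
Proof.
move=> tmax; apply/form_maximalP.
have [Siso|/existsNP[u0 /not_implyP[Su0 u00]]] :=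
    pselect (forall u, torus_orth u -> p u u = 0).
  by left; exact: maximal_rank0.
right; have kO : k = Orthogonal.
  by case kE : k => //; case: u00; exact: (symplectic_isotropic p_sym).
by split=> //; exact: (maximal_rank1 kO tmax Su0 u00).
Qed.

(** In rank 1 every [ω~(x, .)] is a multiple of one functional [ω~(e, .)]. From [ω~(x,y) = 1] and
    [ω~(x,x) = 0] it follows that [ω~(e,x) = 0], so [ω~(y,x) = 0], against symmetry. *)
Lemma maximal_datum_no_hyperbolic u z : form_maximal D ->
  torus_orth u -> torus_orth z -> ~ hyperbolic_pair p u z.
Proof.
move=> /form_maximalP Dmax Su Sz [uz uu zz].
have [x xX0 ux] := orth_projectX0 fr Su.
have [y yX0 zy] := orth_projectX0 fr Sz.
have xx : form_tomega x x = 0 by rewrite (form_tomega_orth p_sym fr xX0 ux Su ux).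
have xy : form_tomega x y = 1 by rewrite (form_tomega_orth p_sym fr xX0 ux Su zy).
have yx : form_tomega y x <> 0.
  rewrite (form_tomega_orth p_sym fr yX0 zy Sz ux) p_sym uz mulr1.
  exact/eqP/form_sign_neq0.
case: Dmax => [/(_ y x yX0 xX0)//|[_ [e [eX0 _ eS]]]].
have [c cE] := eS x xX0; have [d dE] := eS y yX0.
have := cE x xX0; have := cE y yX0; have := dE x xX0; rewrite !big_ord1 xx xy.
move=> yxE /eqP; rewrite eq_sym => /eqP c1 /esym/eqP; rewrite mulf_eq0.
have -> : (c ord0 == 0) = false.
  by apply/eqP => c0; move: c1; rewrite c0 mul0r => /eqP; rewrite eq_sym oner_eq0.
by move=> /eqP ex; apply: yx; rewrite yxE ex mulr0.
Qed.

(** In the first case of [centralizer_dichotomy], skewness puts [a] in the torus. In the second, [u]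
    and [z] have eigenvalues [c] and [- c], hence are isotropic, and form the excluded hyperbolic
    pair. *)
Lemma maximal_datum_toral : form_maximal D -> maximal_toral (form_torus k T v).
Proof.
have [e [f ef]] := standard_dual_basis Vinf Vinf p_nondeg.
have [vP _ _ _] := fr; have vw := twist_dual vP.
move=> Dmax; split; first exact: form_torus_toral.
move=> t' t'tor tt'; apply/seteqP; split=> // a ta.
have [[_ t'g _] t'ss] := t'tor; have sa := form_algebra_skew p_sym (t'g _ ta).
have ac b : form_torus k T v b -> commuting p a b.
  by move=> tb; apply: (toral_commuting ef t'tor ta); exact: tt'.
have [da|[u [z [c [c0 uz uvwz au az]]]]] := centralizer_dichotomy ef vw
  (@form_torus_diag _ _ _ _ _) (form_torus_separating T vP) (t'ss _ ta) ac.
  exact: (diag_skew_torus vP da sa).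
have Su : torus_orth u by move=> i; case: (uvwz i).
have Sz : torus_orth z.
  move=> i; apply: (p_eq0C p_sym); rewrite (twistK k v) pZl.
  by case: (uvwz (nzopp i)) => _ ->; rewrite mulr0.
have cc (d : C) : d != 0 -> d + d != 0 by move=> d0; rewrite -mulr2n mulrn_eq0.
have {}az : tact p a z = (- c) *: z.
  by apply: (nondegr_eq p_nondeg) => x; rewrite pZr mulNr -az sa opprK.
case: (maximal_datum_no_hyperbolic Dmax Su Sz); split=> //.
  exact: (skew_eigen_isotropic sa au au (cc _ c0)).
by apply: (skew_eigen_isotropic sa az az (cc _ _)); rewrite oppr_eq0.
Qed.

End Maximality.

Theorem form_bijection : induces_bijection (form_conjugate p T)
  (@form_equivalent C k) (form_compatible k p T) (form_submaximal k p T)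
  maximal_toral (@form_nondegenerate C k)
  (fun D => form_nondegenerate D /\ form_maximal D).
Proof.
apply: induces_bijectionI.
- exact: form_conjugate_equivalence.
- exact: form_equivalent_equivalence.
- exact: form_submaximal_compatible.
- exact: form_compatible_submaximal.
- exact: form_nondegenerate_compatible.
- exact: form_conjugate_equivalent.
- exact: form_maximal_submaximal.
- by move=> D [].
- move=> t D cD; have [_ nd] := form_compatible_submaximal cD.
  move: cD => /(form_compatibleP p_sym _ _)[j [v [fr ->]]].
  split=> [tmax|[_ Dmax]]; last exact: (maximal_datum_toral fr Dmax).
  by split=> //; exact: (maximal_toral_datum fr tmax).
Qed.

End FormTheorem.

Theorem theorem5p9 (R : realType) :
  (forall (V W : lmodType R[i]) (p : pairing V W) (T : tensor_product V W),
     countably_infinite_dim V -> countably_infinite_dim W ->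
     nondegenerate_pairing p ->
     forall g : set T, g = gl_algebra T \/ g = sl_algebra p T ->
     induces_bijection (gl_conjugate p T) (@gl_equivalent R[i])
       (gl_compatible p g)
       (gl_submaximal p g) (maximal_toral p g)
       (@gl_nondegenerate R[i])
       (fun D => gl_nondegenerate D /\ gl_maximal D)) /\
  (forall (k : form_kind) (V : lmodType R[i]) (p : pairing V V)
          (T : tensor_product V V),
     countably_infinite_dim V ->
     nondegenerate_pairing p -> form_symmetric k p ->
     induces_bijection (form_conjugate p T) (@form_equivalent R[i] k)
       (form_compatible k p T)
       (form_submaximal k p T) (maximal_toral p (form_algebra k T))
       (@form_nondegenerate R[i] k)
       (fun D => form_nondegenerate D /\ form_maximal D)).
Proof.
split=> [V W p T Vinf Winf nd g gg|k V p T Vinf nd p_sym].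
  exact: (gl_bijection Vinf Winf nd gg).
exact: (form_bijection T Vinf nd p_sym).
Qed.
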